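(* Under the standing assumptions below, the canonical semimartingale decomposition of $\zeta$ in its filtration $\mathbb F^{\zeta,c}$ is $$\zeta_t=\widetilde N_t+\int_0^t(1-\zeta_s)\int_{(s,+\infty)}\frac{1}{r-s}\,\phi_s^r(\zeta_s)\,\mathbb P_\tau(dr)\,\mathbb I_{\{0<\zeta_s<1\}}\,ds,\qquad t\ge0,$$ where $(\widetilde N_t,t\ge0)$ is an $\mathbb F^{\zeta,c}$-martingale stopped at $\tau$.
   Context: $\gamma$ a standard gamma process (driftless subordinator, $\gamma_0=0$, càdlàg, $\mathbb E[e^{-\lambda\gamma_t}]=(1+\lambda)^{-t}$) on a complete probability space $(\Omega,\mathcal F,\mathbb P)$ with null sets $\mathcal N_P$; $\tau:\Omega\to(0,\infty)$ a random variable independent of $\gamma$, with law $\mathbb P_\tau$; $\zeta_t=\gamma_{t\wedge\tau}/\gamma_\tau$; $\mathcal F^{\zeta,c}_t=\sigma(\zeta_s,s\le t)\vee\mathcal N_P$. For $0<s<r$, $\phi_s^r(x)=\dfrac{(1-x)^r\,\Gamma(r)/\Gamma(r-s)}{\int_{(s,+\infty)}(1-x)^v\,\Gamma(v)/\Gamma(v-s)\,\mathbb P_\tau(dv)}\,\mathbb I_{(0,1)}(x)$. *)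

(* Defs.v *)
From HB Require Import structures.
From mathcomp Require Import all_boot all_order all_algebra.
From mathcomp Require Import all_classical all_reals all_analysis.
Set Implicit Arguments. Unset Strict Implicit. Unset Printing Implicit Defensive.
Import Order.TTheory GRing.Theory Num.Theory.
Import numFieldNormedType.Exports.
Local Open Scope classical_set_scope.
Local Open Scope ring_scope.

Section defs.
Context (R : realType) (d : measure_display) (T : measurableType d).

Definition Gammaf (a : R) : R :=
  fine (\int[@lebesgue_measure R]_(x in `]0%R, +oo[%classic) (powR x (a - 1) * expR (- x))%:E)%E.

Definition complete_prob (P : probability T R) : Prop :=
  forall N : set T, measurable N -> P N = 0%E ->
    forall A, A `<=` N -> measurable A.

Definition gen_sigma (I : set R) (X : R -> T -> R) : set (set T) :=
  <<s [set A | exists u, I u /\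
        exists B : set R, measurable B /\ A = X u @^-1` B] >>.

Definition sigma_rv (Y : T -> R) : set (set T) :=
  <<s [set A | exists B : set R, measurable B /\ A = Y @^-1` B] >>.

Definition indep (P : probability T R) (F G : set (set T)) : Prop :=
  forall A B, F A -> G B -> P (A `&` B) = (P A * P B)%E.

Definition cadlag (f : R -> R) : Prop :=
  (forall t, 0 <= t -> f x @[x --> t^'+] --> f t) /\
  (forall t, 0 < t -> cvg (f x @[x --> t^'-])).

(** Standard gamma process: a Lévy process (independent stationary
    increments, gamma_0 = 0, càdlàg paths) with
    E[exp(-lambda gamma_t)] = (1+lambda)^(-t); increments are
    characterised by their Laplace transforms. *)
Definition gamma_process (P : probability T R) (g : R -> T -> R) : Prop :=
  [/\ (forall t, measurable_fun setT (g t)),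
      (forall w, g 0 w = 0),
      (forall w, cadlag (fun t => g t w)),
      (forall s t, 0 <= s -> s <= t ->
         indep P (gen_sigma `[0, s] g) (sigma_rv (fun w => g t w - g s w))) &
      (forall s t lam, 0 <= s -> s <= t -> 0 <= lam ->
         (\int[P]_w (expR (- (lam * (g t w - g s w))))%:E)%E
           = (powR (1 + lam) (- (t - s)))%:E)].

Definition martingale (P : probability T R) (F : R -> set (set T))
    (N : R -> T -> R) : Prop :=
  (forall t, 0 <= t ->
     (forall B : set R, measurable B -> F t (N t @^-1` B)) /\
     P.-integrable setT (EFin \o N t)) /\
  (forall s t, 0 <= s -> s <= t -> forall A, F s A ->
     (\int[P]_(w in A) (N t w)%:E = \int[P]_(w in A) (N s w)%:E)%E).

End defs.

(* Main.v *)
(** Given [tau = r], [zeta] is a gamma bridge of length [r].  Comparing the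
    Laplace transforms of finite-dimensional marginals yields two facts on this
    bridge: for [s <= u < r] the conditional mean of [1 - zeta_u] given the past
    up to [s] is [(r - u) / (r - s) * (1 - zeta_s)]; and, because
    [gamma_v / gamma_r], [v <= r], is independent of [gamma_r] (Lukacs), the
    laws on [[0, u]] of the bridges of lengths [r > u] have densities,
    proportional in [r] to [(1 - x)^r Gamma(r) / Gamma(r - u)] at
    [x = zeta_u], with respect to a common law.  The second fact identifies
    [phi_u^r] as the conditional density of [tau] given the past, so that for
    [A] in the past up to [s] the expectation of the drift at time [u > s] on
    [A] is the integral over [r > u] of [(r - s)^-1 E[1_A (1 - zeta_s) | r]].
    Integrating over [u] in [(s, t]] gives
    [(min(t, r) - s) / (r - s) * E[1_A (1 - zeta_s) | r]], which by the first
    fact is [E[1_A (zeta_t - zeta_s) | r]].  This is checked on finite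
    rectangles of [zeta] and extended by a monotone class argument to the
    completed filtration. *)

Require Import Defs.
From HB Require Import structures.
From mathcomp Require Import all_boot all_order all_algebra.
From mathcomp Require Import all_classical all_reals all_analysis.
From mathcomp Require Import measurable_realfun ring lra.
Set Implicit Arguments.
Unset Strict Implicit.
Unset Printing Implicit Defensive.
Import Order.TTheory GRing.Theory Num.Theory.
Import numFieldNormedType.Exports.
Local Open Scope classical_set_scope.
Local Open Scope ring_scope.

(** No conditional expectation is formed. The facts on bridges are equalities of two measures with
    nonnegative densities [k1], [k2], pushed to path space and compared by Laplace transforms; hence
    the weights in all the uniqueness lemmas. Nonnegativity is kept throughout ([|1 - zeta|] for 1 -
    zeta, sums instead of differences), so Tonelli and pi-system arguments apply before anything is
    known to be integrable. Integrability of the drift then follows from the balance identity, and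
    subtraction occurs only at the very end. At time u the common law is that of the bridge of
    length u + 1: the increment over [u, u + 1] is exponential, and length r corresponds to its
    power r - u - 1, which may be negative but exceeds -1. Two obstacles remain. Gamma increases
    only almost surely, with an exceptional set depending on the times, so null sets have to be
    carried from fixed lengths r to the random length tau. And 1 / (r - u) is singular at r = u; the
    singularity cancels against the bridge mean of 1 - zeta_u. *)

(** * Weighted measures, uniqueness on pi-systems, independence *)

Section weighted_measure.
Local Open Scope ereal_scope.
Context d (T : measurableType d) (R : realType).
Variable m : {measure set T -> \bar R}.

Lemma weighted_measure_ex (k : T -> \bar R) :
  (forall x, 0 <= k x) -> measurable_fun setT k ->
  exists mu : {measure set T -> \bar R}, forall A, mu A = \int[m]_(x in A) k x.
Proof.
move=> k0 mk; pose nu A := \int[m]_(x in A) k x.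
have nu0 : nu set0 = 0 by rewrite /nu integral_set0.
have nuge A : 0 <= nu A by rewrite /nu integral_ge0.
have nus : semi_sigma_additive nu.
  move=> F mF tF mUF; rewrite /nu; apply: cvg_toP.
    apply: ereal_nondecreasing_is_cvgn => i j ij.
    by apply: lee_sum_nneg_natr => // n _ _; apply: integral_ge0.
  by rewrite ge0_integral_bigcup//=; exact: measurable_funTS.
pose B := isMeasure.Build _ _ _ nu nu0 nuge nus.
pose mu : {measure set T -> \bar R} := HB.pack nu B.
by exists mu.
Qed.

Import HBNNSimple.

(** Both sides are limits along the same increasing simple approximation of [f], which leaves the
    case of indicators. Taking [k] real valued lets multiplication by [k x] commute with the
    limit. *)
Lemma weighted_integral (k : T -> R) (mu : {measure set T -> \bar R}) :
  (forall x, 0 <= k x)%R -> measurable_fun setT k ->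
  (forall A, measurable A -> mu A = \int[m]_(x in A) (k x)%:E) ->
  forall f : T -> \bar R, (forall x, 0 <= f x) -> measurable_fun setT f ->
  \int[mu]_x f x = \int[m]_x (f x * (k x)%:E).
Proof.
move=> k0 mk muE f f0 mf; pose h := nnsfun_approx measurableT mf.
have hf x : EFin \o h ^~ x @ \oo --> f x by exact: cvg_nnsfun_approx.
have mkE : measurable_fun setT (EFin \o k) by exact/measurable_EFinP.
transitivity (limn (fun n => \int[mu]_x (h n x)%:E)).
  rewrite -monotone_convergence//.
  - by apply: eq_integral => x _; apply/esym/cvg_lim => //; exact: hf.
  - by move=> n; exact/measurable_EFinP.
  - by move=> n x _; rewrite lee_fin.
  - by move=> x _ a b ab; rewrite lee_fin; exact/lefP/nd_nnsfun_approx.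
transitivity (limn (fun n => \int[m]_x ((h n x)%:E * (k x)%:E))); last first.
  rewrite -monotone_convergence//.
  - apply: eq_integral => x _; apply/cvg_lim => //.
    by apply: cvgeZr => //; exact: hf.
  - by move=> n; apply: emeasurable_funM => //; exact/measurable_EFinP.
  - by move=> n x _; rewrite mule_ge0 ?lee_fin.
  - move=> x _ a b ab; rewrite lee_wpmul2r ?lee_fin//.
    exact/lefP/nd_nnsfun_approx.
congr (limn _); apply/funext => n.
have indich r : measurable_fun setT (fun x => (r * \1_(h n @^-1` [set r]) x)%:E).
  by apply/measurable_EFinP/measurable_funM.
transitivity (\int[mu]_x (\sum_(y \in range (h n)) (y * \1_(h n @^-1` [set y]) x)%:E)).
  by apply: eq_integral => t tE; rewrite /= fimfunE -fsumEFin.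
rewrite ge0_integral_fsum//; last by move=> r y Ey; exact: nnfun_muleindic_ge0.
transitivity (\int[m]_x (\sum_(y \in range (h n))
    ((y * \1_(h n @^-1` [set y]) x)%:E * (k x)%:E))); last first.
  apply: eq_integral => x _.
  rewrite -ge0_mule_fsuml => [|y]; last exact: nnfun_muleindic_ge0.
  by rewrite fsumEFin // -(fimfunE _ x).
rewrite ge0_integral_fsum//; last 2 first.
  - by move=> y; apply: emeasurable_funM.
  - by move=> r y Ey; rewrite mule_ge0 ?lee_fin ?k0// -lee_fin nnfun_muleindic_ge0.
apply: eq_fsbigr => r rhn.
rewrite integralZl_indic_nnsfun//.
under [RHS]eq_integral do rewrite EFinM -muleA.
rewrite ge0_integralZl//.
- rewrite integral_indic// setIT muE//; congr (_ * _).
  rewrite integral_mkcond; apply: eq_integral => x _.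
  by rewrite muleC epatch_indic.
- by apply: emeasurable_funM => //; exact/measurable_EFinP.
- by move=> t Et; rewrite mule_ge0 ?lee_fin.
- by move: rhn; rewrite inE => -[t _ <-]; rewrite lee_fin.
Qed.

End weighted_measure.

Section weighted_pushforward.
Local Open Scope ereal_scope.
Context d1 d2 d3 (T1 : measurableType d1) (T2 : measurableType d2)
  (T3 : measurableType d3) (R : realType).
Variables (m1 : {measure set T1 -> \bar R}) (m2 : {measure set T2 -> \bar R}).
Variables (k1 : T1 -> R) (k2 : T2 -> R) (X1 : T1 -> T3) (X2 : T2 -> T3).
Hypotheses (k10 : forall x, (0 <= k1 x)%R) (k20 : forall x, (0 <= k2 x)%R).
Hypotheses (mk1 : measurable_fun setT k1) (mk2 : measurable_fun setT k2).
Hypotheses (mX1 : measurable_fun setT X1) (mX2 : measurable_fun setT X2).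
Hypothesis fin1 : \int[m1]_x (k1 x)%:E < +oo.

(** Both sides integrate [f] against the image of a weighted measure, so agreement on a pi-system
    suffices. The cover [g] by members of [G] replaces the condition that [setT] is in [G], which
    fails for the rays used in [laplace_unique]. *)
Lemma weighted_law_unique (G : set (set T3)) (g : (set T3)^nat) :
  @measurable _ T3 = <<s G >> -> setI_closed G ->
  (forall i, G (g i)) -> \bigcup_i g i = setT ->
  (forall B, G B -> \int[m1]_(x in X1 @^-1` B) (k1 x)%:E =
                    \int[m2]_(x in X2 @^-1` B) (k2 x)%:E) ->
  forall f : T3 -> \bar R, (forall x, 0 <= f x) -> measurable_fun setT f ->
  \int[m1]_x (f (X1 x) * (k1 x)%:E) = \int[m2]_x (f (X2 x) * (k2 x)%:E).
Proof.
move=> mG GI Gg gT H f f0 mf.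
have mk1E : measurable_fun setT (EFin \o k1) by exact/measurable_EFinP.
have mk2E : measurable_fun setT (EFin \o k2) by exact/measurable_EFinP.
have [mu1 mu1E] := weighted_measure_ex m1 (k := EFin \o k1) k10 mk1E.
have [mu2 mu2E] := weighted_measure_ex m2 (k := EFin \o k2) k20 mk2E.
have E1 := weighted_integral k10 mk1 (fun A _ => mu1E A) (f := f \o X1)
  (fun x => f0 (X1 x)) (measurableT_comp mf mX1).
have E2 := weighted_integral k20 mk2 (fun A _ => mu2E A) (f := f \o X2)
  (fun x => f0 (X2 x)) (measurableT_comp mf mX2).
transitivity (\int[mu1]_x (f \o X1) x); first by rewrite E1.
transitivity (\int[mu2]_x (f \o X2) x); last by rewrite E2.
pose mfX1 := isMeasurableFun.Build _ _ _ _ _ mX1.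
pose Y1 : {mfun _ >-> _} := HB.pack X1 mfX1.
pose mfX2 := isMeasurableFun.Build _ _ _ _ _ mX2.
pose Y2 : {mfun _ >-> _} := HB.pack X2 mfX2.
rewrite -(preimage_setT X1) -(ge0_integral_pushforward mX1)//.
rewrite -[in RHS](preimage_setT X2) -(ge0_integral_pushforward mX2)//.
apply: (@eq_measure_integral _ _ _ _ (pushforward mu2 Y2) (pushforward mu1 Y1)).
move=> A mA _.
apply: (measure_unique G g) => //.
- by move=> B GB; change (mu1 (X1 @^-1` B) = mu2 (X2 @^-1` B)); rewrite mu1E mu2E H.
- move=> i; change (mu1 (X1 @^-1` (g i)) < +oo); rewrite mu1E.
  apply: le_lt_trans fin1.
  have mA' : measurable (X1 @^-1` g i).
    rewrite -[X in measurable X]setTI; apply: mX1 => //; rewrite mG.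
    exact: sub_sigma_algebra.
  by have := ge0_subset_integral m1 mA' measurableT mk1E; apply => // x _; rewrite lee_fin.
Qed.

End weighted_pushforward.

Section indep_integral.
Local Open Scope ereal_scope.
Context d d1 d2 (T : measurableType d) (T1 : measurableType d1)
  (T2 : measurableType d2) (R : realType) (P : probability T R).
Variables (X : {mfun T >-> T1}) (Y : {mfun T >-> T2}).
Hypothesis XY : forall A B, measurable A -> measurable B ->
  P ((X @^-1` A) `&` (Y @^-1` B)) = P (X @^-1` A) * P (Y @^-1` B).

(** Independence gives the pair the product law, and Tonelli integrates out [Y] at frozen [X]. It
    serves for the increments of gamma, for a bridge and its terminal value, and for [tau] and
    gamma. *)
Lemma indep_integral (h : T1 * T2 -> \bar R) :
  (forall z, 0 <= h z) -> measurable_fun setT h ->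
  \int[P]_w h (X w, Y w) = \int[distribution P X]_x \int[P]_w h (x, Y w).
Proof.
move=> h0 mh.
have mXY : measurable_fun setT (fun w => (X w, Y w)) by exact: measurable_fun_pair.
pose mfXY := isMeasurableFun.Build _ _ _ _ _ mXY.
pose Z : {mfun T >-> (T1 * T2)%type} := HB.pack (fun w => (X w, Y w)) mfXY.
transitivity (\int[distribution P Z]_z h z); first by rewrite ge0_integral_distribution.
transitivity (\int[distribution P X \x distribution P Y]_z h z).
  apply: eq_measure_integral => A mA _; apply/esym/product_measure_unique => //.
rewrite fubini_tonelli1//; apply: eq_integral => x _.
rewrite /fubini_F ge0_integral_distribution//; exact: measurableT_comp.
Qed.

End indep_integral.

(** * Bernstein approximation of Lipschitz functions *)

Section bernstein.
Context (R : realType).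
Implicit Types (f g : nat -> R) (t : R) (n : nat).

(* The expectation of f under the binomial law of parameters n and t. *)
Fixpoint bern n f t : R :=
  if n is m.+1 then t * bern m (fun k => f k.+1) t + (1 - t) * bern m f t
  else f 0%N.

Lemma bern_le n f g t : 0 <= t <= 1 -> (forall k, f k <= g k) ->
  bern n f t <= bern n g t.
Proof.
move=> /andP[t0 t1]; elim: n f g => [|n ih] f g fg /=; first exact: fg.
by apply: lerD; apply: ler_wpM2l; rewrite ?subr_ge0// ih.
Qed.

Lemma bern_lin n (a b : R) f g t :
  bern n (fun k => a * f k + b * g k) t = a * bern n f t + b * bern n g t.
Proof. by elim: n f g => [|n ih] f g //=; rewrite !ih; ring. Qed.

Lemma bern_cst n c t : bern n (fun=> c) t = c.
Proof. by elim: n => [|n ih] //=; rewrite ih; ring. Qed.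

Lemma bern_ext n f g t : f =1 g -> bern n f t = bern n g t.
Proof. by move=> /funext ->. Qed.

(** The free shift [c] closes the induction, a success turning [c] into [1 + c]. At c = - n t this
    is the binomial variance n t (1 - t). *)
Lemma bern_var n c t :
  bern n (fun k => (k%:R + c) ^+ 2) t = n%:R * t * (1 - t) + (n%:R * t + c) ^+ 2.
Proof.
elim: n c => [|n ih] c /=; first by rewrite !mul0r !add0r.
rewrite ih (@bern_ext _ _ (fun k => (k%:R + (1 + c)) ^+ 2)); last first.
  by move=> k; rewrite -natr1 addrA.
by rewrite ih -natr1; ring.
Qed.

Lemma bern_approx n (h : R -> R) (L e t : R) : (0 < n)%N -> 0 < e ->
  (forall x y, `|h x - h y| <= L * `|x - y|) -> 0 <= L -> 0 <= t <= 1 ->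
  `|bern n (fun k => h (k%:R / n%:R)) t - h t| <= L * (e + (n%:R * e)^-1).
Proof.
move=> n0 e0 hL L0 t01; set f := fun k => _.
have n0' : n%:R != 0 :> R by rewrite pnatr_eq0 -lt0n.
have n0'' : 0 < n%:R :> R by rewrite ltr0n.
pose v k : R := (k%:R + - (n%:R * t)) ^+ 2.
pose B k := (L / (n%:R ^+ 2 * e)) * v k + (L * e) * 1.
(* The inequality |z| <= e + z^2 / e replaces the Lipschitz bound by a second moment, which
   [bern_var] evaluates. *)
have fB k : `|f k - h t| <= B k.
  apply: (le_trans (hL _ _)); rewrite /B mulr1 mulrAC -mulrA -mulrDr ler_wpM2l//.
  set z := _ - t; have -> : v k / (n%:R ^+ 2 * e) = z ^+ 2 / e.
    by rewrite /v /z; field; rewrite n0' gt_eqF.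
  rewrite -(@ler_pM2r _ e)// mulrDl mulfVK ?gt_eqF//.
  have [z0|z0] := lerP 0 z; rewrite ?(ger0_norm z0) ?(ltr0_norm z0).
    have := sqr_ge0 (z - e); nra.
  have := sqr_ge0 (z + e); nra.
have bB : bern n B t <= L * (e + (n%:R * e)^-1).
  have -> : bern n B t = L * (e + (n%:R * e)^-1 * (t * (1 - t))).
    rewrite /B bern_lin bern_cst /v bern_var subrr.
    by field; rewrite n0' gt_eqF.
  rewrite ler_wpM2l// lerD2l.
  rewrite ler_piMr// ?invr_ge0 ?mulr_ge0 ?ltW//.
  by case/andP: t01 => t0 t1; nra.
have e1 : bern n f t - h t = bern n (fun k => 1 * f k + (- h t) * 1) t.
  by rewrite bern_lin bern_cst mul1r mulr1.
rewrite ler_norml; apply/andP; split; last first.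
  apply: le_trans bB; rewrite e1; apply: bern_le => // k.
  by rewrite mul1r mulr1; apply: le_trans (ler_norm _) (fB k).
rewrite lerNl; apply: le_trans bB.
have -> : - (bern n f t - h t) = bern n (fun k => (-1) * f k + h t * 1) t.
  by rewrite bern_lin bern_cst; ring.
apply: bern_le => // k.
have -> : -1 * f k + h t * 1 = - (f k - h t) by ring.
by apply: le_trans (ler_norm _) _; rewrite normrN.
Qed.

Lemma cvg_bern (h : R -> R) (L t : R) :
  (forall x y, `|h x - h y| <= L * `|x - y|) -> 0 <= L -> 0 <= t <= 1 ->
  bern n (fun k => h (k%:R / n%:R)) t @[n --> \oo] --> h t.
Proof.
move=> hL L0 t01; apply/cvgrPdist_le => /= e e0.
(* As soon as 1 / (n a) <= a, the error is at most 2 L a <= e. The 1 added to [L] covers L = 0. *)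
pose a := e / (2 * (L + 1)).
have L1 : 0 < L + 1 by rewrite ltr_wpDl.
have a0 : 0 < a by rewrite divr_gt0// mulr_gt0.
near=> n.
have n0 : (0 < n)%N by near: n; exists 1%N.
rewrite distrC; apply: (le_trans (bern_approx n0 a0 hL L0 t01)).
have na : (n%:R * a)^-1 <= a.
  have na0 : 0 < n%:R * a by rewrite mulr_gt0// ltr0n.
  have ia0 : 0 < a^-1 by rewrite invr_gt0.
  rewrite -[leRHS]invrK lef_pV2// -ler_pdivrMr//.
  by near: n; exact: nbhs_infty_ger.
have : L * (a + (n%:R * a)^-1) <= L * (2 * a).
  have -> : 2 * a = a + a by ring.
  apply: ler_wpM2l => //; rewrite lerD2l.
  exact: na.
move=> /le_trans; apply; rewrite /a.
have -> : L * (2 * (e / (2 * (L + 1)))) = L / (L + 1) * e by field; rewrite gt_eqF.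
by apply: ler_piMl; [exact: ltW|rewrite ler_pdivrMr// mul1r lerDl].
Unshelve. all: by end_near. Qed.

Lemma measurable_bern n f : measurable_fun setT (bern n f).
Proof.
elim: n f => [|n ih] f /=; first exact: measurable_cst.
by apply: measurable_funD; apply: measurable_funM => //; exact: measurable_funB.
Qed.

End bernstein.

(** * Finite measures on [0, 1] are determined by their moments *)

Section hausdorff_moments.
Local Open Scope ereal_scope.
Context d1 d2 (T1 : measurableType d1) (T2 : measurableType d2) (R : realType).
Variables (m1 : {measure set T1 -> \bar R}) (m2 : {measure set T2 -> \bar R}).
Variables (k1 : T1 -> R) (k2 : T2 -> R) (Y1 : T1 -> R) (Y2 : T2 -> R).
Hypotheses (k10 : forall x, (0 <= k1 x)%R) (k20 : forall x, (0 <= k2 x)%R).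
Hypotheses (mk1 : measurable_fun setT k1) (mk2 : measurable_fun setT k2).
Hypotheses (mY1 : measurable_fun setT Y1) (mY2 : measurable_fun setT Y2).
Hypothesis fin1 : \int[m1]_x (k1 x)%:E < +oo.
Hypothesis fin2 : \int[m2]_x (k2 x)%:E < +oo.
Hypotheses (Y101 : forall x, (0 <= Y1 x <= 1)%R) (Y201 : forall x, (0 <= Y2 x <= 1)%R).
Hypothesis moments : forall n,
  \int[m1]_x (Y1 x ^+ n * k1 x)%:E = \int[m2]_x (Y2 x ^+ n * k2 x)%:E.

(** The bound is asked on [0, 1] only, where [Y1] and [Y2] take their values: polynomials are
    unbounded on the line. *)
Let bnd (g : R -> R) := measurable_fun setT g /\
  exists M, forall t, (0 <= t <= 1 -> `|g t| <= M)%R.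

Let ok (g : R -> R) :=
  \int[m1]_x (g (Y1 x) * k1 x)%:E = \int[m2]_x (g (Y2 x) * k2 x)%:E.

Let int_gen d (T : measurableType d) (m : {measure set T -> \bar R})
    (k Y : T -> R) (g : R -> R) :
  (forall x, (0 <= k x)%R) -> measurable_fun setT k -> measurable_fun setT Y ->
  \int[m]_x (k x)%:E < +oo -> (forall x, (0 <= Y x <= 1)%R) -> bnd g ->
  m.-integrable setT (EFin \o (fun x => g (Y x) * k x)%R).
Proof.
move=> k0 mk mY fink Y01 [mg [M gM]].
have ik : m.-integrable setT (EFin \o k).
  apply/integrableP; split; first exact/measurable_EFinP.
  by under eq_integral do rewrite /= ger0_norm//.
apply: (le_integrable measurableT _ _ (integrableZl measurableT M ik)).
  apply/measurable_EFinP; apply: measurable_funM => //; exact: measurableT_comp.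
move=> x _ /=; rewrite lee_fin normrM [leRHS]normrM ler_wpM2r//.
by apply: le_trans (gM _ (Y01 x)) (ler_norm _).
Qed.

Let int1 g : bnd g -> m1.-integrable setT (EFin \o (fun x => g (Y1 x) * k1 x)%R).
Proof. exact: int_gen. Qed.

Let int2 g : bnd g -> m2.-integrable setT (EFin \o (fun x => g (Y2 x) * k2 x)%R).
Proof. exact: int_gen. Qed.

Let okD f g : bnd f -> bnd g -> ok f -> ok g -> ok (fun t => f t + g t)%R.
Proof.
move=> bf bg okf okg; rewrite /ok.
transitivity (\int[m1]_x ((f (Y1 x) * k1 x)%:E + (g (Y1 x) * k1 x)%:E)).
  by apply: eq_integral => x _; rewrite mulrDl EFinD.
rewrite (integralD measurableT (int1 bf) (int1 bg)).
transitivity (\int[m2]_x ((f (Y2 x) * k2 x)%:E + (g (Y2 x) * k2 x)%:E)); last first.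
  by apply: eq_integral => x _; rewrite mulrDl EFinD.
by rewrite (integralD measurableT (int2 bf) (int2 bg)); congr (_ + _).
Qed.

Let okB f g : bnd f -> bnd g -> ok f -> ok g -> ok (fun t => f t - g t)%R.
Proof.
move=> bf bg okf okg; rewrite /ok.
transitivity (\int[m1]_x ((f (Y1 x) * k1 x)%:E - (g (Y1 x) * k1 x)%:E)).
  by apply: eq_integral => x _; rewrite mulrBl EFinB.
rewrite (integralB measurableT (int1 bf) (int1 bg)).
transitivity (\int[m2]_x ((f (Y2 x) * k2 x)%:E - (g (Y2 x) * k2 x)%:E)); last first.
  by apply: eq_integral => x _; rewrite mulrBl EFinB.
by rewrite (integralB measurableT (int2 bf) (int2 bg)); congr (_ - _).
Qed.

Let bndB f g : bnd f -> bnd g -> bnd (fun t => f t - g t)%R.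
Proof.
move=> [mf [M1 H1]] [mg [M2 H2]]; split; first exact: measurable_funB.
exists (M1 + M2)%R => t t01; apply: le_trans (ler_normB _ _) _.
by apply: lerD; [exact: H1|exact: H2].
Qed.

Let bnd_bern n (f : nat -> R) i : bnd (fun t => t ^+ i * bern n f t)%R.
Proof.
split; first by apply: measurable_funM; [exact: measurable_funX|exact: measurable_bern].
elim: n f i => [|n ih] f i /=.
  exists `|f 0%N|%R => t /andP[t0 t1]; rewrite normrM ler_piMl//.
  by rewrite ger0_norm ?exprn_ge0// exprn_ile1.
have [M1 H1] := ih (fun k => f k.+1) i.+1; have [M2 H2] := ih f i; have [M3 H3] := ih f i.+1.
exists (M1 + (M2 + M3))%R => t t01.
have -> : (t ^+ i * (t * bern n (fun k => f k.+1) t + (1 - t) * bern n f t) =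
  t ^+ i.+1 * bern n (fun k => f k.+1) t + (t ^+ i * bern n f t - t ^+ i.+1 * bern n f t))%R.
  by rewrite exprS; ring.
apply: le_trans (ler_normD _ _) _; apply: lerD; first exact: H1.
by apply: le_trans (ler_normB _ _) _; apply: lerD; [exact: H2|exact: H3].
Qed.

(** The recursion of [bern] multiplies by t and by 1 - t. A free power t^i absorbs both factors, and
    the base case is the hypothesis on moments. *)
Let ok_bern n (f : nat -> R) i : ok (fun t => t ^+ i * bern n f t)%R.
Proof.
elim: n f i => [|n ih] f i /=.
  rewrite /ok; under eq_integral do rewrite [(_ * f _)%R]mulrC -mulrA EFinM.
  under [RHS]eq_integral do rewrite [(_ * f _)%R]mulrC -mulrA EFinM.
  have b : bnd (fun t => t ^+ i)%R.
    split; first exact: measurable_funX.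
    exists 1%R => t /andP[t0 t1]; by rewrite ger0_norm ?exprn_ge0// exprn_ile1.
  by rewrite !integralZl//; [rewrite moments|exact: (int2 b)|exact: (int1 b)].
have -> : (fun t : R => t ^+ i * (t * bern n (fun k => f k.+1) t + (1 - t) * bern n f t))%R =
  (fun t => t ^+ i.+1 * bern n (fun k => f k.+1) t +
    (t ^+ i * bern n f t - t ^+ i.+1 * bern n f t))%R.
  by apply/funext => t; rewrite exprS; ring.
apply: okD; [exact: bnd_bern|exact: bndB (bnd_bern _ _ _) (bnd_bern _ _ _)|exact: ih|].
exact: okB (bnd_bern _ _ _) (bnd_bern _ _ _) (ih _ _) (ih _ _).
Qed.

Let bnd_lip (h : R -> R) (L : R) : (forall x y, `|h x - h y| <= L * `|x - y|)%R ->
  bnd h.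
Proof.
move=> hL; split.
  apply: continuous_measurable_fun => x; apply/cvgrPdist_le => /= e e0.
  have L1 : (0 < `|L| + 1)%R by rewrite ltr_wpDl.
  near=> y; apply: (le_trans (hL _ _)).
  apply: (@le_trans _ _ ((`|L| + 1) * `|x - y|)%R).
    by rewrite ler_wpM2r// (le_trans (ler_norm _))// lerDl.
  rewrite mulrC -ler_pdivlMr//; near: y.
  by apply: (@cvgr_dist_le _ _ _ (nbhs x) _ id x) => //; rewrite divr_gt0.
exists (`|h 0| + `|L|)%R => t /andP[t0 t1].
have := hL t 0%R; rewrite subr0 (ger0_norm t0) => H.
have H2 : (L * t <= `|L|)%R.
  apply: (le_trans (ler_norm _)); rewrite normrM (ger0_norm t0).
  by rewrite ler_piMr.
have -> : h t = (h 0 + (h t - h 0))%R by rewrite addrC subrK.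
by apply: le_trans (ler_normD _ _) _; rewrite lerD2l (le_trans H).
Unshelve. all: by end_near. Qed.

Let bern_bound n (h : R -> R) M t : (0 <= t <= 1)%R -> (forall x, `|h x| <= M)%R ->
  (`|bern n (fun k => h (k%:R / n%:R)) t| <= M)%R.
Proof.
move=> t01 hM; rewrite ler_norml; apply/andP; split.
  by rewrite -[leLHS](bern_cst n _ t); apply: bern_le => // k; have := hM (k%:R / n%:R)%R; rewrite ler_norml => /andP[].
by rewrite -[leRHS](bern_cst n _ t); apply: bern_le => // k; have := hM (k%:R / n%:R)%R; rewrite ler_norml => /andP[].
Qed.

Let cvg_gen d (T : measurableType d) (m : {measure set T -> \bar R})
    (k Y : T -> R) (g_ : nat -> R -> R) (g : R -> R) (M : R) :
  (forall x, (0 <= k x)%R) -> measurable_fun setT k -> measurable_fun setT Y ->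
  \int[m]_x (k x)%:E < +oo -> (forall x, (0 <= Y x <= 1)%R) ->
  (forall n, measurable_fun setT (g_ n)) -> measurable_fun setT g ->
  (forall n t, (0 <= t <= 1)%R -> (`|g_ n t| <= M)%R) ->
  (forall t, (0 <= t <= 1)%R -> g_ n t @[n --> \oo] --> g t) ->
  \int[m]_x (g_ n (Y x) * k x)%:E @[n --> \oo] --> \int[m]_x (g (Y x) * k x)%:E.
Proof.
move=> k0 mk mY fink Y01 mg_ mg gM gg.
have ik : m.-integrable setT (EFin \o k).
  apply/integrableP; split; first exact/measurable_EFinP.
  by under eq_integral do rewrite /= ger0_norm//.
have [] := @dominated_convergence _ _ R m setT measurableT
  (fun n x => (g_ n (Y x) * k x)%:E) (fun x => (g (Y x) * k x)%:E) (fun x => M%:E * (k x)%:E).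
- by move=> n; apply/measurable_EFinP; apply: measurable_funM => //; exact: measurableT_comp.
- by apply/measurable_EFinP; apply: measurable_funM => //; exact: measurableT_comp.
- apply: aeW => x _; apply: cvg_EFin; first by apply: nearW => n.
  by apply: cvgM; [exact: gg|exact: cvg_cst].
- exact: (integrableZl measurableT M ik).
- apply: aeW => x n _; rewrite /= lee_fin normrM (ger0_norm (k0 x)) ler_wpM2r//.
  exact: gM.
by [].
Qed.

Let ok_cvg (g_ : nat -> R -> R) (g : R -> R) (M : R) :
  (forall n, measurable_fun setT (g_ n)) -> measurable_fun setT g ->
  (forall n t, (0 <= t <= 1)%R -> (`|g_ n t| <= M)%R) ->
  (forall t, (0 <= t <= 1)%R -> g_ n t @[n --> \oo] --> g t) ->
  (forall n, ok (g_ n)) -> ok g.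
Proof.
move=> mg_ mg gM gg okg.
have H1 := cvg_gen k10 mk1 mY1 fin1 Y101 mg_ mg gM gg.
have H2 := cvg_gen k20 mk2 mY2 fin2 Y201 mg_ mg gM gg.
rewrite /ok -(cvg_lim _ H1)// -(cvg_lim _ H2)//.
by apply/congr_lim/funext => n; exact: okg.
Qed.

Let ok_lip (h : R -> R) (L M : R) : (0 <= L)%R ->
  (forall x y, `|h x - h y| <= L * `|x - y|)%R -> (forall x, `|h x| <= M)%R ->
  ok h.
Proof.
move=> L0 hL hM.
apply: (@ok_cvg (fun n => bern n (fun k => h (k%:R / n%:R)%R)) h M).
- by move=> n; exact: measurable_bern.
- by have [] := bnd_lip hL.
- by move=> n t t01; exact: bern_bound.
- by move=> t t01; exact: cvg_bern hL L0 t01.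
- move=> n; have := ok_bern n (fun k => h (k%:R / n%:R)%R) 0.
  rewrite (_ : (fun t => _) = bern n (fun k => h (k%:R / n%:R)%R))//.
  by apply/funext => t; rewrite expr0 mul1r.
Qed.

(** Lipschitz with constant n, bounded by 1, and tending to the indicator of the open ray []y,
    +oo[]; its value 0 at [y] is what makes the ray open. *)
Let ramp (y : R) n t : R := Num.min 1%R (n%:R * Num.max (t - y) 0)%R.

Let lip_min1 (a b : R) : (`|Num.min 1 a - Num.min 1 b| <= `|a - b|)%R.
Proof.
have [a1|a1] := lerP 1%R a; have [b1|b1] := lerP 1%R b;
  rewrite ?subrr ?normr0// ler_norml; apply/andP; split;
  have := ler_norm (a - b)%R; have := ler_norm (- (a - b))%R; rewrite normrN; lra.
Qed.

Let lip_max0 (a b : R) : (`|Num.max a 0 - Num.max b 0| <= `|a - b|)%R.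
Proof.
have [a1|a1] := lerP a 0%R; have [b1|b1] := lerP b 0%R;
  rewrite ?subrr ?normr0// ler_norml; apply/andP; split;
  have := ler_norm (a - b)%R; have := ler_norm (- (a - b))%R; rewrite normrN; lra.
Qed.

(** Two dominated passages to the limit: from Bernstein polynomials to Lipschitz functions, then
    from ramps to the indicator of a ray. The densities [k1], [k2], of finite mass, dominate. *)
Lemma hausdorff_ray (y : R) :
  \int[m1]_(x in [set x | (y < Y1 x)%R]) (k1 x)%:E =
  \int[m2]_(x in [set x | (y < Y2 x)%R]) (k2 x)%:E.
Proof.
have lipr n : (forall t s, `|ramp y n t - ramp y n s| <= n%:R * `|t - s|)%R.
  move=> t s; apply: (le_trans (lip_min1 _ _)); rewrite -mulrBr normrM normr_nat.
  rewrite ler_wpM2l//; apply: (le_trans (lip_max0 _ _)).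
  by have -> : (t - y - (s - y) = t - s)%R by ring.
have ramp0 n t : (0 <= ramp y n t)%R.
  by rewrite /ramp le_min ler01 mulr_ge0// le_max lexx orbT.
have rampM n t : (`|ramp y n t| <= 1)%R.
  by rewrite ger0_norm// /ramp ge_min lexx.
have mind : measurable_fun setT (\1_(`]y, +oo[%classic : set R) : R -> R).
  exact: measurable_indic.
have : ok (\1_(`]y, +oo[%classic : set R)).
  apply: (@ok_cvg (ramp y) _ 1%R) => //.
  - by move=> n; have [] := bnd_lip (lipr n).
  - move=> t _; rewrite indicE; have [yt|ty] := ltP y t.
      rewrite mem_set/=; last by rewrite in_itv/= yt.
      apply: cvg_near_cst; near=> n.
      rewrite /ramp; apply/min_idPl; rewrite (max_idPl _); last by rewrite subr_ge0 ltW.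
      rewrite -ler_pdivrMr ?subr_gt0//; near: n; exact: nbhs_infty_ger.
    rewrite memNset/=; last by rewrite in_itv/= andbT; apply/negP; rewrite -leNgt.
    apply: cvg_near_cst; near=> n.
    by rewrite /ramp (max_idPr _) ?subr_le0// mulr0 (min_idPr _).
  - by move=> n; apply: ok_lip (lipr n) (rampM n).
rewrite /ok => H; rewrite integral_mkcond [RHS]integral_mkcond.
have E d (T : measurableType d) (m : {measure set T -> \bar R}) (k Y : T -> R) :
  \int[m]_x ((fun x => (k x)%:E) \_ [set x | (y < Y x)%R]) x =
  \int[m]_x (\1_(`]y, +oo[%classic : set R) (Y x) * k x)%:E.
  apply: eq_integral => x _; rewrite patchE indicE.
  by have [yt|ty] := ltP y (Y x); [rewrite !mem_set/= ?in_itv/= ?yt// mul1r|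
    rewrite !memNset/= ?in_itv/= ?andbT ?mul0r//; apply/negP; rewrite -leNgt].
by rewrite !E.
Unshelve. all: by end_near. Qed.

End hausdorff_moments.

(** * Uniqueness from Laplace transforms at integers *)

Section laplace_unique.
Local Open Scope ereal_scope.
Context d1 d2 (T1 : measurableType d1) (T2 : measurableType d2) (R : realType).
Variables (m1 : {measure set T1 -> \bar R}) (m2 : {measure set T2 -> \bar R}).
Variables (k1 : T1 -> R) (k2 : T2 -> R) (X1 : T1 -> R) (X2 : T2 -> R).
Hypotheses (k10 : forall x, (0 <= k1 x)%R) (k20 : forall x, (0 <= k2 x)%R).
Hypotheses (mk1 : measurable_fun setT k1) (mk2 : measurable_fun setT k2).
Hypotheses (mX1 : measurable_fun setT X1) (mX2 : measurable_fun setT X2).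
Hypothesis fin1 : \int[m1]_x (k1 x)%:E < +oo.
Hypothesis fin2 : \int[m2]_x (k2 x)%:E < +oo.
Hypotheses (X10 : {ae m1, forall x, (0 <= X1 x)%R}).
Hypotheses (X20 : {ae m2, forall x, (0 <= X2 x)%R}).
Hypothesis laplace : forall n : nat,
  \int[m1]_x (expR (- (n%:R * X1 x)) * k1 x)%:E =
  \int[m2]_x (expR (- (n%:R * X2 x)) * k2 x)%:E.

(** [X] is nonnegative only almost everywhere, while the moment problem needs exp(-X) in [0, 1] at
    every point; |X| repairs this without changing any integral. *)
Let absE d (T : measurableType d) (m : {measure set T -> \bar R}) (k X : T -> R)
  (f : R -> \bar R) :
  (forall x, (0 <= k x)%R) -> measurable_fun setT k -> measurable_fun setT X ->
  {ae m, forall x, (0 <= X x)%R} ->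
  (forall x, 0 <= f x) -> measurable_fun setT f ->
  \int[m]_x (f `|X x|%R * (k x)%:E) = \int[m]_x (f (X x) * (k x)%:E).
Proof.
move=> k0 mk mX X0 f0 mf; apply: ge0_ae_eq_integral => //.
- apply: emeasurable_funM; last exact/measurable_EFinP.
  by apply: measurableT_comp => //; exact: measurableT_comp.
- apply: emeasurable_funM; last exact/measurable_EFinP.
  exact: measurableT_comp.
- by move=> x _; rewrite mule_ge0// lee_fin.
- by move=> x _; rewrite mule_ge0// lee_fin.
- by apply: filterS X0 => x Xx0 _; rewrite ger0_norm.
Qed.

(** The Laplace transform of X at the integer n is the n-th moment of exp(-X), so integers suffice.
    As exp(-x) decreases, the rays to the right for exp(-X) are the rays to the left for X, which
    form a generating pi-system. *)
Lemma laplace_unique (f : R -> \bar R) :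
  (forall x, 0 <= f x) -> measurable_fun setT f ->
  \int[m1]_x (f (X1 x) * (k1 x)%:E) = \int[m2]_x (f (X2 x) * (k2 x)%:E).
Proof.
move=> f0 mf.
rewrite -(absE k10 mk1 mX1 X10 f0 mf) -(absE k20 mk2 mX2 X20 f0 mf).
pose Y1 x := expR (- `|X1 x|); pose Y2 x := expR (- `|X2 x|).
have mA1 : measurable_fun setT (fun x => `|X1 x|%R) by exact: measurableT_comp.
have mA2 : measurable_fun setT (fun x => `|X2 x|%R) by exact: measurableT_comp.
have mY1 : measurable_fun setT Y1.
  by apply: measurableT_comp => //; exact: measurableT_comp.
have mY2 : measurable_fun setT Y2.
  by apply: measurableT_comp => //; exact: measurableT_comp.
have Y101 x : (0 <= Y1 x <= 1)%R.
  by rewrite expR_ge0/= -expR0 ler_expR oppr_le0.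
have Y201 x : (0 <= Y2 x <= 1)%R.
  by rewrite expR_ge0/= -expR0 ler_expR oppr_le0.
have mexp n : measurable_fun setT (fun t : R => (expR (- (n%:R * t)))%:E).
  apply/measurable_EFinP; apply: measurableT_comp => //.
  by apply: measurableT_comp => //; exact: mulrl_measurable.
have ray := @hausdorff_ray _ _ _ _ R m1 m2 k1 k2 Y1 Y2 k10 k20 mk1 mk2 mY1 mY2 fin1 fin2 Y101 Y201.
have mom n : \int[m1]_x (Y1 x ^+ n * k1 x)%:E = \int[m2]_x (Y2 x ^+ n * k2 x)%:E.
  transitivity (\int[m1]_x ((expR (- (n%:R * `|X1 x|)))%:E * (k1 x)%:E)).
    by apply: eq_integral => x _; rewrite /Y1 -expRM_natl mulrN EFinM.
  transitivity (\int[m2]_x ((expR (- (n%:R * `|X2 x|)))%:E * (k2 x)%:E)); last first.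
    by apply: eq_integral => x _; rewrite /Y2 -expRM_natl mulrN EFinM.
  rewrite (absE (f := fun t => (expR (- (n%:R * t)))%:E) k10 mk1 mX1 X10)//.
  rewrite (absE (f := fun t => (expR (- (n%:R * t)))%:E) k20 mk2 mX2 X20)//.
  under eq_integral do rewrite -EFinM.
  under [RHS]eq_integral do rewrite -EFinM.
  exact: laplace.
apply: (@weighted_law_unique _ _ _ _ _ (measurableTypeR R) R m1 m2 k1 k2 (fun x => `|X1 x|%R)
  (fun x => `|X2 x|%R) k10 k20 mk1 mk2 mA1 mA2 fin1 (@RGenInftyO.G R) (fun n => `]-oo, n%:R[%classic)) => //.
- exact: (@RGenInftyO.measurableE R).
- move=> _ _ [x ->] [y ->]; exists (Num.min x y).
  by apply/seteqP; split => z /=; rewrite !in_itv/= lt_min => /andP.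
- by move=> n; exists n%:R.
- rewrite -subTset => x _; exists (Num.truncn `|x|).+1 => //=.
  by rewrite in_itv/= (le_lt_trans (ler_norm x))// truncnS_gt.
- move=> _ [x ->].
  have pre d (T : measurableType d) (Z : T -> R) :
      (fun w => `|Z w|%R) @^-1` `]-oo, x[%classic = [set w | (expR (- x) < expR (- `|Z w|))%R].
    by apply/seteqP; split => w /=; rewrite in_itv/= ltr_expR ltrN2.
  by rewrite !pre; exact: ray.
Qed.

End laplace_unique.

(** * The path space and its rectangles *)

Section path_space.
Context (R : realType).

Definition cylinders : set (set (R -> R)) :=
  [set A | exists v (B : set R), measurable B /\ A = (fun p => p v) @^-1` B].

(** All real functions of time with the product sigma-algebra. No path regularity is built in, so
    every real process is a measurable map into it. *)
Definition pathT := g_sigma_algebraType cylinders.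

Lemma measurable_path_fun d (T : measurableType d) (X : T -> pathT) :
  (forall v, measurable_fun setT (fun w => X w v)) -> measurable_fun setT X.
Proof.
move=> mX; apply: (@measurability _ _ T pathT setT X cylinders) => //.
move=> _ [_ [v [B [mB ->]]] <-].
exact: mX.
Qed.

Lemma measurable_eval_path v : measurable_fun setT (fun p : pathT => p v).
Proof.
move=> _ B mB; rewrite setTI; apply: sub_sigma_algebra; by exists v, B.
Qed.

Fixpoint mrect (l : seq (R * set R)) : Prop :=
  if l is q :: l' then measurable q.2 /\ mrect l' else True.

(** Constraints form a list in which a time may occur several times, so that intersection is
    concatenation and the empty list gives the whole space. *)
Fixpoint rect (l : seq (R * set R)) : set pathT :=
  if l is q :: l' then [set p | q.2 (p q.1)] `&` rect l' else setT.

Lemma measurable_rect l : mrect l -> measurable (rect l).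
Proof.
elim: l => //= q l ih [mq ml]; apply: measurableI; last exact: ih.
by rewrite -[X in measurable X]setTI; exact: measurable_eval_path.
Qed.

Lemma rect_cat l1 l2 : rect (l1 ++ l2) = rect l1 `&` rect l2.
Proof. by elim: l1 => [|q l ih] /=; rewrite ?setTI// ih setIA. Qed.

Lemma mrect_cat l1 l2 : mrect l1 -> mrect l2 -> mrect (l1 ++ l2).
Proof. by elim: l1 => [|q l ih] //= [mq ml] m2; split => //; exact: ih. Qed.

Definition rects : set (set pathT) := [set A | exists2 l, mrect l & A = rect l].

Lemma setI_closed_rects : setI_closed rects.
Proof.
move=> _ _ [l1 m1 ->] [l2 m2 ->]; exists (l1 ++ l2); first exact: mrect_cat.
by rewrite rect_cat.
Qed.

Lemma measurable_rects : @measurable _ pathT = <<s rects >>.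
Proof.
apply/seteqP; split => A.
  apply: smallest_sub; first exact: smallest_sigma_algebra.
  move=> _ [v [B [mB ->]]]; apply: sub_sigma_algebra; exists [:: (v, B)] => //=.
  by rewrite setIT.
apply: smallest_sub; first exact: sigma_algebra_measurable.
by move=> _ [l ml ->]; exact: measurable_rect.
Qed.

End path_space.

(** * Laplace uniqueness for laws on path space *)

Section laplace_unique_path.
Local Open Scope ereal_scope.
Context d1 d2 (T1 : measurableType d1) (T2 : measurableType d2) (R : realType).
Variables (m1 : {measure set T1 -> \bar R}) (m2 : {measure set T2 -> \bar R}).
Variables (k1 : T1 -> R) (k2 : T2 -> R) (X1 : R -> T1 -> R) (X2 : R -> T2 -> R).
Hypotheses (k10 : forall x, (0 <= k1 x)%R) (k20 : forall x, (0 <= k2 x)%R).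
Hypotheses (mk1 : measurable_fun setT k1) (mk2 : measurable_fun setT k2).
Hypotheses (mX1 : forall v, measurable_fun setT (X1 v)).
Hypotheses (mX2 : forall v, measurable_fun setT (X2 v)).
Hypothesis fin1 : \int[m1]_x (k1 x)%:E < +oo.
Hypothesis fin2 : \int[m2]_x (k2 x)%:E < +oo.
Hypotheses (X10 : forall v, {ae m1, forall x, (0 <= X1 v x)%R}).
Hypotheses (X20 : forall v, {ae m2, forall x, (0 <= X2 v x)%R}).
Hypothesis laplace : forall e : seq (nat * R),
  \int[m1]_x (expR (- \sum_(q <- e) q.1%:R * X1 q.2 x) * k1 x)%:E =
  \int[m2]_x (expR (- \sum_(q <- e) q.1%:R * X2 q.2 x) * k2 x)%:E.

(** An intermediate weight: coordinates listed in [l] are already tested by indicators, those in [e]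
    still by exponentials. *)
Let K (T : Type) (k : T -> R) (X : R -> T -> R) (e : seq (nat * R)) (l : seq (R * set R)) x : R :=
  (\1_(rect l) ((X ^~ x) : pathT R) * (expR (- \sum_(q <- e) q.1%:R * X q.2 x) * k x))%R.

Let K0 (T : Type) (k : T -> R) (X : R -> T -> R) e l x : (forall x, 0 <= k x)%R ->
  (0 <= K k X e l x)%R.
Proof. by move=> k0; rewrite !mulr_ge0// expR_ge0. Qed.

Let mpath d (T : measurableType d) (X : R -> T -> R) :
  (forall v, measurable_fun setT (X v)) ->
  measurable_fun setT (fun w => (X ^~ w) : pathT R).
Proof. by move=> mX; exact: measurable_path_fun. Qed.

Let mE d (T : measurableType d) (X : R -> T -> R) (e : seq (nat * R)) :
  (forall v, measurable_fun setT (X v)) ->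
  measurable_fun setT (fun x => expR (- \sum_(q <- e) q.1%:R * X q.2 x))%R.
Proof.
move=> mX; apply: measurableT_comp => //; apply: measurableT_comp => //.
apply: measurable_sum => q; apply: measurable_funM => //.
Qed.

Let mK d (T : measurableType d) (k : T -> R) (X : R -> T -> R) e l :
  measurable_fun setT k -> (forall v, measurable_fun setT (X v)) -> mrect l ->
  measurable_fun setT (K k X e l).
Proof.
move=> mk mX ml; apply: measurable_funM.
  by apply: measurableT_comp (mpath mX); apply: measurable_indic; exact: measurable_rect.
by apply: measurable_funM => //; exact: mE.
Qed.

Let finK d (T : measurableType d) (m : {measure set T -> \bar R}) (k : T -> R)
    (X : R -> T -> R) e l :
  (forall x, 0 <= k x)%R ->
  measurable_fun setT k -> (forall v, measurable_fun setT (X v)) -> mrect l ->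
  (forall v, {ae m, forall x, (0 <= X v x)%R}) ->
  \int[m]_x (k x)%:E < +oo -> \int[m]_x (K k X e l x)%:E < +oo.
Proof.
move=> k0 mk mX ml X0; apply: le_lt_trans; apply: ae_ge0_le_integral => //.
- by move=> x _; rewrite lee_fin K0.
- exact/measurable_EFinP/mK.
- by move=> x _; rewrite lee_fin.
- exact/measurable_EFinP.
have : {ae m, forall x, (0 <= \sum_(q <- e) q.1%:R * X q.2 x)%R}.
  elim: e => [|q e ih]; first by apply: aeW => x; rewrite big_nil.
  apply: filterS2 ih (X0 q.2) => x h1 h2.
  by rewrite big_cons addr_ge0// mulr_ge0.
apply: filterS => x S0 _; rewrite lee_fin /K.
apply: (@le_trans _ _ (1 * (1 * k x))%R); last by rewrite !mul1r.
have i1 : (\1_(rect l) ((X ^~ x) : pathT R) <= 1 :> R)%R.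
  by rewrite indicE; case: (_ \in _).
have i2 : (expR (- \sum_(q <- e) q.1%:R * X q.2 x) * k x <= 1 * k x)%R.
  by apply: ler_wpM2r => //; rewrite -[leRHS]expR0 ler_expR oppr_le0.
by apply: ler_pM => //; rewrite mulr_ge0// expR_ge0.
Qed.

(** Coordinates pass from exponentials to indicators one at a time: with the rest of [K] as density,
    the one-dimensional [laplace_unique] applies to the next coordinate. The exponentials it calls
    for at that coordinate are added to [e], hence the induction for all [e]. *)
Let step e l : mrect l ->
  \int[m1]_x (K k1 X1 e l x)%:E = \int[m2]_x (K k2 X2 e l x)%:E.
Proof.
elim: l e => [|q l ih] e /= ml.
  rewrite /K; under eq_integral do rewrite indicT mul1r.
  under [RHS]eq_integral do rewrite indicT mul1r.
  exact: laplace.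
case: ml => mq ml.
have := @laplace_unique _ _ _ _ R m1 m2 (K k1 X1 e l) (K k2 X2 e l) (X1 q.1) (X2 q.1).
have KE (T : Type) (k : T -> R) (X : R -> T -> R) n x :
  (expR (- (n%:R * X q.1 x)) * K k X e l x = K k X ((n, q.1) :: e) l x)%R.
  by rewrite /K big_cons/= opprD expRD; ring.
move=> /(_ (fun x => K0 _ _ _ _ k10) (fun x => K0 _ _ _ _ k20) (mK _ mk1 mX1 ml) (mK _ mk2 mX2 ml)).
move=> /(_ (mX1 _) (mX2 _) (finK _ k10 mk1 mX1 ml X10 fin1) (finK _ k20 mk2 mX2 ml X20 fin2)).
move=> /(_ (X10 _) (X20 _)) H.
have ind (p : pathT R) : \1_([set p : pathT R | q.2 (p q.1)] `&` rect l) p =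
    (\1_(q.2) (p q.1) * \1_(rect l) p)%R :> R.
  rewrite indicI /= !indicE.
  suff -> : (p \in [set p : pathT R | q.2 (p q.1)]) = (p q.1 \in q.2) by [].
  by rewrite /in_mem /= /in_set /=.
have {}H := H _ (fun x => (\1_(q.2) x)%:E) _ _.
transitivity (\int[m1]_x ((\1_(q.2) (X1 q.1 x))%:E * (K k1 X1 e l x)%:E)).
  by apply: eq_integral => x _; rewrite /K/= -EFinM ind -!mulrA.
rewrite H.
- by apply: eq_integral => x _; rewrite /K/= -EFinM ind -!mulrA.
- move=> n; under eq_integral do rewrite KE.
  by under [RHS]eq_integral do rewrite KE; exact: ih.
- by move=> x; rewrite lee_fin.
- by apply/measurable_EFinP; exact: measurable_indic.
Qed.

Lemma laplace_unique_path (h : pathT R -> \bar R) :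
  (forall x, 0 <= h x) -> measurable_fun setT h ->
  \int[m1]_x (h (X1 ^~ x) * (k1 x)%:E) = \int[m2]_x (h (X2 ^~ x) * (k2 x)%:E).
Proof.
move=> h0 mh.
apply: (@weighted_law_unique _ _ _ _ _ (pathT R) R m1 m2 k1 k2 (fun x => X1 ^~ x)
  (fun x => X2 ^~ x) k10 k20 mk1 mk2 (mpath mX1) (mpath mX2) fin1 (@rects R) (fun=> setT)) => //.
- exact: measurable_rects.
- exact: setI_closed_rects.
- by move=> _; exists [::].
- by rewrite bigcup_const//; exists 0%N.
- move=> _ [l ml ->].
  have E d (T : measurableType d) (m : {measure set T -> \bar R}) (k : T -> R) (X : R -> T -> R) :
    \int[m]_(x in (fun x => X ^~ x : pathT R) @^-1` rect l) (k x)%:E =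
    \int[m]_x (K k X [::] l x)%:E.
    rewrite integral_mkcond; apply: eq_integral => x _.
    rewrite epatch_indic/= /K big_nil oppr0 expR0 mul1r -EFinM mulrC.
    by rewrite !indicE.
  by rewrite !E; exact: step.
Qed.

End laplace_unique_path.

(** * Scaling of Lebesgue measure *)

Section lebesgue_scaling.
Local Open Scope ereal_scope.
Context (R : realType).
Local Notation mu := (@lebesgue_measure R).

Lemma pushforward_measure_ex d1 d2 (T1 : measurableType d1) (T2 : measurableType d2)
    (m : {measure set T1 -> \bar R}) (f : T1 -> T2) : measurable_fun setT f ->
  exists nu : {measure set T2 -> \bar R}, forall A, nu A = m (f @^-1` A).
Proof.
move=> mf.
by exists (measure_function_pushforward__canonical__measure_function_Measure m mf).
Qed.

(** The image of Lebesgue measure under x -> c x, multiplied by c, gives half-open intervals their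
    length; uniqueness of Lebesgue measure concludes. *)
Lemma lebesgue_scale (c : R) (f : R -> \bar R) : (0 < c)%R ->
  (forall x, 0 <= f x) -> measurable_fun setT f ->
  \int[mu]_x f (c * x)%R = (c^-1)%:E * \int[mu]_x f x.
Proof.
move=> c0 f0 mf.
have mc : measurable_fun setT ( *%R c : measurableTypeR R -> measurableTypeR R).
  exact: mulrl_measurable.
have [nu nuE] := pushforward_measure_ex mu mc.
pose k : {nonneg R} := NngNum (ltW c0).
have nuE' A : measurable A -> mu A = mscale k nu A.
  move=> mA; apply: lebesgue_measure_unique => // _ [[a b] _ <-].
  change (mu `]a, b]%classic = c%:E * nu `]a, b]%classic); rewrite nuE.
  rewrite (_ : _ @^-1` _ = `](a / c)%R, (b / c)%R]%classic); last first.
    apply/seteqP; split => x /=; rewrite !in_itv/=.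
      by rewrite ltr_pdivrMr// ler_pdivlMr// ![(x * _)%R]mulrC.
    by rewrite ltr_pdivrMr// ler_pdivlMr// ![(x * _)%R]mulrC.
  have itvE (x y : R) : mu `]x, y]%classic = if (x < y)%R then (y - x)%:E else 0.
    by rewrite lebesgue_measure_itv/= lte_fin EFinB.
  have ci0 : (0 < c^-1)%R by rewrite invr_gt0.
  transitivity (if (a < b)%R then (b - a)%:E else 0); first exact: itvE.
  transitivity (c%:E * if (a / c < b / c)%R then (b / c - a / c)%:E else 0); last first.
    exact: (congr1 (fun z => c%:E * z) (esym (itvE _ _))).
  rewrite (ltr_pM2r ci0); case: ifPn => _; last by rewrite mule0.
  by rewrite -EFinM -mulrBl mulrC mulfVK// gt_eqF.
have -> : \int[mu]_x f x = c%:E * \int[mu]_x f (c * x)%R.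
  transitivity (\int[mscale k nu]_x f x).
    by apply: eq_measure_integral => A mA _; exact: nuE'.
  rewrite ge0_integral_mscale//; congr (_ * _).
  transitivity (\int[pushforward mu ( *%R c : measurableTypeR R -> measurableTypeR R)]_x f x).
    by apply: eq_measure_integral => A mA _; rewrite nuE.
  by rewrite (ge0_integral_pushforward mc).
by rewrite muleA -EFinM mulVf ?gt_eqF// mul1e.
Qed.

End lebesgue_scaling.

(** * The Gamma function and its densities *)

Section gamma_function.
Local Open Scope ereal_scope.
Context (R : realType).
Local Notation mu := (@lebesgue_measure R).
Implicit Types a x lam : R.

(** The gamma density without the constant 1 / Gamma(a). Vanishing off the half line, it turns
    integrals there into integrals over the line, the form in which [lebesgue_scale] changes
    variables. *)
Definition gdens a x : R := if (0 < x)%R then (x `^ (a - 1) * expR (- x))%R else 0%R.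

Lemma gdens_ge0 a x : (0 <= gdens a x)%R.
Proof. by rewrite /gdens; case: ifP => // _; rewrite mulr_ge0 ?powR_ge0 ?expR_ge0. Qed.

Lemma measurable_gdens a : measurable_fun setT (gdens a).
Proof.
apply: measurable_fun_ifT => //; first exact: measurable_fun_ltr.
apply: measurable_funM; first exact: measurable_powR.
by apply: measurableT_comp => //; exact: measurableT_comp.
Qed.

Lemma integral_gdens a : \int[mu]_x (gdens a x)%:E =
  \int[mu]_(x in `]0%R, +oo[) (x `^ (a - 1) * expR (- x))%:E.
Proof.
rewrite [RHS]integral_mkcond; apply: eq_integral => x _.
rewrite /gdens patchE; case: ifPn => x0; first by rewrite mem_set//= in_itv/= x0.
by rewrite memNset//= in_itv/= andbT; exact/negP.
Qed.

Lemma powR_le_expR a : exists2 C : R, (0 <= C)%R &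
  forall x, (1 <= x -> x `^ (a - 1) <= C * expR (x / 2))%R.
Proof.
(* From ln y <= y at y = x / (2 M) follows M ln x <= x / 2 + M ln(2 M), whose last term gives the
   constant. The 1 in [M] keeps it positive. *)
pose M := (`|a - 1| + 1)%R.
have M0 : (0 < M)%R by rewrite ltr_wpDl.
pose e := ((2 * M)^-1)%R.
have e0 : (0 < e)%R by rewrite invr_gt0 mulr_gt0.
exists (expR (- (M * ln e))); first exact: expR_ge0.
move=> x x1; have x0 : (0 < x)%R by apply: lt_le_trans x1.
rewrite /powR gt_eqF// -expRD ler_expR.
have lx : (0 <= ln x)%R by exact: ln_ge0.
have le1 : ((a - 1) * ln x <= M * ln x)%R.
  by rewrite ler_wpM2r// /M (le_trans (ler_norm _))// lerDl.
apply: (le_trans le1).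
have -> : (x / 2 = M * (e * x))%R by rewrite /e; field; rewrite gt_eqF.
rewrite -mulrN -mulrDr; apply: ler_wpM2l; first exact: ltW.
have : (ln (e * x) <= e * x)%R by rewrite ltW// ln_sublinear// mulr_gt0.
rewrite lnM ?posrE//; lra.
Qed.

(** On [1 / (n + 1), 1] the antiderivative x^a / a bounds the integral by 1 / a, uniformly in n;
    these intervals exhaust ]0, 1]. *)
Lemma integral_powR01 a : (0 < a)%R ->
  \int[mu]_(x in `]0%R, 1%R]) (x `^ (a - 1))%:E < +oo.
Proof.
move=> a0; pose F n : set R := `[(n.+1%:R^-1 : R)%R, 1%R]%classic.
have F0 i x : F i x -> (0 < x)%R.
  by rewrite /F/= in_itv/= => /andP[+ _]; apply: lt_le_trans; rewrite invr_gt0 ltr0n.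
have -> : `]0%R, 1%R]%classic = \bigcup_n F n.
  apply/seteqP; split => x /=; last first.
    move=> [n _ Fx]; have := F0 _ _ Fx; move: Fx; rewrite /F/= !in_itv/= => /andP[_ ->] ->//.
  rewrite in_itv/= => /andP[x0 x1]; exists (Num.truncn x^-1) => //=.
  rewrite /F/= in_itv/= x1 andbT -[leRHS]invrK lef_pV2 ?posrE ?invr_gt0// ?ltr0n//.
  by rewrite ltW// truncnS_gt.
have bnd n : \int[mu]_(x in F n) (x `^ (a - 1))%:E <= (a^-1)%:E.
  have n0 : (0 < n.+1%:R^-1 :> R)%R by rewrite invr_gt0 ltr0n.
  (* The second case is n = 0, where the interval is the single point 1 and the fundamental theorem
     of calculus does not apply. *)
  have [n1|n1] := ltP (n.+1%:R^-1 : R)%R 1%R; last first.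
    rewrite (@null_set_integral _ _ _ mu (F n)) ?lee_fin ?invr_ge0 ?(ltW a0)//.
      by apply: measurable_itv.
      by apply: measurable_funTS; apply/measurable_EFinP; exact: measurable_powR.
    have : mu `[(n.+1%:R^-1 : R)%R, 1%R]%classic = 0.
      by rewrite lebesgue_measure_itv/= lte_fin ltNge n1.
    exact.
  have dF x : (0 < x)%R -> is_derive x 1%R (fun x => a^-1 * x `^ a)%R (x `^ (a - 1))%R.
    move=> x0; have H : is_derive x 1%R (@powR R ^~ a) (a * x `^ (a - 1))%R by exact: is_derive1_powR.
    have H2 : is_derive x 1%R (a^-1 *: (@powR R ^~ a))%R (a^-1 *: (a * x `^ (a - 1)))%R.
      exact: is_deriveZ.
    have -> : (x `^ (a - 1))%R = (a^-1 *: (a * x `^ (a - 1)))%R.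
      by rewrite /GRing.scale/= mulrA mulVf ?mul1r// gt_eqF.
    exact: H2.
  have cF x : (0 < x)%R -> {for x, continuous (fun x => a^-1 * x `^ a)%R}.
    by move=> x0; apply: differentiable_continuous; apply/derivable1_diffP; have [] := dF x x0.
  rewrite (@continuous_FTC2 _ _ (fun x => a^-1 * x `^ a)%R)//.
  - by rewrite powR1 mulr1 -EFinB lee_fin gerBl mulr_ge0 ?invr_ge0 ?powR_ge0// (ltW a0).
  - apply/continuous_in_subspaceT => x; rewrite inE/= => /F0 x0.
    have H : is_derive x 1%R (@powR R ^~ (a - 1)%R) ((a - 1) * x `^ (a - 1 - 1))%R by exact: is_derive1_powR.
    by apply: differentiable_continuous; apply/derivable1_diffP; have [] := H.
  - split.
    + by move=> x; rewrite in_itv/= => /andP[nx _]; have [] := dF x (lt_trans n0 nx).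
    + by apply: cvg_at_right_filter; exact: cF.
    + by apply: cvg_at_left_filter; exact: cF.
  - move=> x; rewrite in_itv/= => /andP[nx _]; rewrite derive1E.
    by have [_ ->] := dF x (lt_trans n0 nx).
have nd : nondecreasing_seq F.
  move=> m n mn; apply/subsetPset => x; rewrite /F/= !in_itv/= => /andP[mx ->].
  rewrite andbT; apply: le_trans mx.
  by rewrite lef_pV2 ?posrE ?ltr0n// ler_nat ltnS.
have H : \int[mu]_(x in F i) (x `^ (a - 1))%:E @[i --> \oo] -->
    \int[mu]_(x in \bigcup_i F i) (x `^ (a - 1))%:E.
  apply: ge0_nondecreasing_set_cvg_integral => //.
  - by move=> i; exact: measurable_itv.
  - by move=> i; apply: measurable_funTS; apply/measurable_EFinP; exact: measurable_powR.
  - by move=> i x _; rewrite lee_fin powR_ge0.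
apply: (@le_lt_trans _ _ (a^-1)%:E); last exact: ltry.
rewrite -(cvg_lim _ H)//; apply: lime_le; last exact: nearW.
by apply/cvg_ex; eexists; exact: H.
Qed.

Lemma gdens_fin a : (0 < a)%R -> \int[mu]_x (gdens a x)%:E < +oo.
Proof.
move=> a0; have [C C0 HC] := powR_le_expR a.
(* Up to 1 the power alone dominates. Beyond 1 the power is absorbed by half of the exponential;
   what is left is C exp(-x / 2), that is 2 C times the exponential density of rate 1/2. *)
pose f1 : R -> \bar R := (fun x => (x `^ (a - 1))%:E) \_ `]0%R, 1%R].
pose f2 x : \bar R := (2 * C)%:E * (exponential_pdf (2^-1)%R x)%:E.
have mf1 : measurable_fun setT f1.
  apply/measurable_restrict => //; rewrite setTI; apply: measurable_funTS.
  by apply/measurable_EFinP; exact: measurable_powR.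
have mf2 : measurable_fun setT f2.
  by apply: measurable_funeM; apply/measurable_EFinP; exact: measurable_exponential_pdf.
have f10 x : 0 <= f1 x.
  by rewrite /f1 patchE; case: ifP => // _; rewrite lee_fin powR_ge0.
have f20 x : 0 <= f2 x.
  by rewrite /f2 -EFinM lee_fin !mulr_ge0// exponential_pdf_ge0.
apply: (@le_lt_trans _ _ (\int[mu]_x (f1 x + f2 x))).
  apply: ge0_le_integral => //.
  - by move=> x _; rewrite lee_fin gdens_ge0.
  - by apply/measurable_EFinP; exact: measurable_gdens.
  - exact: emeasurable_funD.
  move=> x _; rewrite /gdens; case: ifPn => x0; last by rewrite adde_ge0.
  have e1 : (expR (- x) <= 1)%R by rewrite -expR0 ler_expR oppr_le0 ltW.
  have [x1|x1] := leP x 1%R.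
    rewrite -[leLHS]adde0 leeD// /f1 patchE mem_set; last by rewrite /= in_itv/= x0.
    by rewrite lee_fin ler_piMr// powR_ge0.
  rewrite -[leLHS]add0e leeD// /f2 -EFinM lee_fin exponential_pdfE ?(ltW x0)//.
  apply: (@le_trans _ _ (C * expR (x / 2) * expR (- x))%R).
    by apply: ler_wpM2r; [exact: expR_ge0|apply: HC; exact: ltW].
  rewrite -mulrA -expRD le_eqVlt; apply/orP; left; apply/eqP.
  have -> : (x / 2 - x = - 2^-1 * x)%R by field.
  by field.
rewrite ge0_integralD// lte_add_pinfty//.
  rewrite /f1 -integral_mkcond; exact: integral_powR01.
rewrite /f2 ge0_integralZl//.
- by rewrite integral_exponential_pdf ?mule1 ?ltry// invr_gt0.
- by apply/measurable_EFinP; exact: measurable_exponential_pdf.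
- by move=> x _; rewrite lee_fin exponential_pdf_ge0.
- by rewrite lee_fin mulr_ge0.
Qed.

Lemma GammafE a : (0 < a)%R -> (Gammaf a)%:E = \int[mu]_x (gdens a x)%:E.
Proof.
move=> a0; rewrite /Gammaf -integral_gdens fineK// ge0_fin_numE ?gdens_fin//.
by apply: integral_ge0 => x _; rewrite lee_fin gdens_ge0.
Qed.

Lemma Gammaf_ge0 a : (0 <= Gammaf a)%R.
Proof.
rewrite /Gammaf fine_ge0//; apply: integral_ge0 => x _.
by rewrite lee_fin mulr_ge0 ?powR_ge0 ?expR_ge0.
Qed.

Lemma Gammaf_gt0 a : (0 < a)%R -> (0 < Gammaf a)%R.
Proof.
move=> a0; rewrite lt_neqAle Gammaf_ge0 andbT; apply/eqP => /esym G0.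
have : \int[mu]_x `|(gdens a x)%:E| = 0.
  under eq_integral do rewrite gee0_abs ?lee_fin ?gdens_ge0//.
  by rewrite -GammafE// G0.
have mg : measurable_fun setT (EFin \o gdens a) by apply/measurable_EFinP; exact: measurable_gdens.
move=> /(ae_eq_integral_abs mu measurableT mg) [N [mN N0 sub]].
have : mu `]0%R, 1%R]%classic <= mu N.
  apply: le_measure; rewrite ?inE//; apply: subset_trans sub => x /=.
  rewrite in_itv/= => /andP[x0 _] /(_ I) [].
  rewrite /gdens x0 => /eqP; rewrite gt_eqF// mulr_gt0 ?powR_gt0 ?expR_gt0//.
by rewrite lebesgue_measure_itv/= lte_fin ltr01 N0 -EFinB lee_fin subr0 ler10.
Qed.

(** The factor exp(-lam x) only rescales: with c = 1 + lam the integrand is c^(1 - a) times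
    [gdens a] at c x, and the change of variables yields another 1 / c. *)
Lemma laplace_gdens a lam : (0 < a)%R -> (0 <= lam)%R ->
  \int[mu]_x (expR (- (lam * x)) * gdens a x)%:E = ((1 + lam) `^ (- a) * Gammaf a)%:E.
Proof.
move=> a0 l0; pose c := (1 + lam)%R.
have c0 : (0 < c)%R by rewrite /c ltr_wpDr.
transitivity (\int[mu]_x ((c `^ (1 - a))%:E * (gdens a (c * x))%:E)).
  apply: eq_integral => x _; rewrite -EFinM; congr EFin.
  rewrite /gdens pmulr_rgt0//; case: ifP => x0; last by rewrite !mulr0.
  rewrite powRM ?ltW//.
  have -> : (expR (- (c * x)) = expR (- (lam * x)) * expR (- x))%R.
    by rewrite -expRD; congr expR; rewrite /c; ring.
  have -> : (c `^ (1 - a) = (c `^ (a - 1))^-1)%R by rewrite -powRN opprB.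
  by field; rewrite gt_eqF// powR_gt0.
have mg : measurable_fun setT (fun x => (gdens a x)%:E) by apply/measurable_EFinP; exact: measurable_gdens.
rewrite ge0_integralZl//; last 3 first.
- by apply: measurableT_comp mg _; exact: mulrl_measurable.
- by move=> x _; rewrite lee_fin gdens_ge0.
- by rewrite lee_fin powR_ge0.
rewrite (@lebesgue_scale R c (fun x => (gdens a x)%:E))//; last first.
  by move=> x; rewrite lee_fin gdens_ge0.
rewrite -GammafE// muleA -!EFinM; congr (_ * _)%:E.
have -> : (c^-1 = c `^ (- 1))%R by rewrite powR_inv1// ltW.
rewrite -powRD; last by apply/implyP => _; rewrite gt_eqF.
by congr (_ `^ _)%R; ring.
Qed.

End gamma_function.

Lemma measurable_powR2 d (T : measurableType d) (R : realType) (f h : T -> R) :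
  measurable_fun setT f -> measurable_fun setT h ->
  measurable_fun setT (fun x => f x `^ h x).
Proof.
move=> mf mh; rewrite /powR; apply: measurable_fun_ifT => //.
- exact: measurable_fun_eqr.
- rewrite (_ : (fun x => _) = (fun x => if h x == 0 then 1 else 0)).
    by apply: measurable_fun_ifT => //; exact: measurable_fun_eqr.
  by apply/funext => x; case: (h x == 0).
- apply: measurableT_comp => //; apply: measurable_funM => //.
  exact: measurableT_comp.
Qed.

Lemma measurable_fine_fun d (T : measurableType d) (R : realType) (f : T -> \bar R) :
  measurable_fun setT f -> measurable_fun setT (fun x => fine (f x)).
Proof. by move=> mf; exact: (measurableT_comp (@fine_measurable R setT measurableT) mf). Qed.

(** Needed because Gamma(r) is integrated in r against the law of [tau]. Measurability in the
    parameter is that of a partial integral of a jointly measurable function. *)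
Lemma measurable_Gammaf (R : realType) : measurable_fun setT (@Gammaf R).
Proof.
pose f (z : R * R) : \bar R := (gdens z.1 z.2)%:E.
have mf : measurable_fun setT f.
  apply/measurable_EFinP; apply: measurable_fun_ifT => //.
  - by apply: measurable_fun_ltr => //; exact: measurable_snd.
  - apply: measurable_funM.
      apply: measurable_powR2; first exact: measurable_snd.
      by apply: measurable_funB => //; exact: measurable_fst.
    by apply: measurableT_comp => //; apply: measurableT_comp => //; exact: measurable_snd.
have f0 z : (0 <= f z)%E by rewrite lee_fin gdens_ge0.
have -> : @Gammaf R = (fun x => fine (fubini_F (@lebesgue_measure R) f x)).
  by apply/funext => a; rewrite /fubini_F /Gammaf -integral_gdens.
by apply: measurable_fine_fun; exact: measurable_fun_fubini_tonelli_F.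
Qed.

(** * Positivity and Laplace transforms of the gamma process *)

Section gamma_process_facts.
Local Open Scope ereal_scope.
Context (R : realType) (d : measure_display) (T : measurableType d).
Variables (P : probability T R) (g : R -> T -> R).
Hypothesis gp : gamma_process P g.

Lemma measurable_gproc t : measurable_fun setT (g t).
Proof. by case: gp. Qed.

Lemma gproc0 w : g 0%R w = 0%R.
Proof. by case: gp. Qed.

Lemma gproc_laplace s t lam : (0 <= s)%R -> (s <= t)%R -> (0 <= lam)%R ->
  \int[P]_w (expR (- (lam * (g t w - g s w))))%:E = ((1 + lam) `^ (- (t - s)))%:E.
Proof. by case: gp => _ _ _ _; apply. Qed.

Lemma measurable_incr s t : measurable_fun setT (fun w => g t w - g s w)%R.
Proof. by apply: measurable_funB; exact: measurable_gproc. Qed.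

(** Exponential Markov inequality: exp(-lam X) >= 1 wherever the increment X is nonpositive, while
    its mean (1 + lam)^(-(t - s)) tends to 0 as lam grows. *)
Lemma gproc_incr_gt0 s t : (0 <= s)%R -> (s < t)%R ->
  {ae P, forall w, (0 < g t w - g s w)%R}.
Proof.
move=> s0 st; pose N := [set w | (g t w - g s w <= 0)%R].
have mN : measurable N.
  rewrite (_ : N = (fun w => g t w - g s w)%R @^-1` `]-oo, 0%R]%classic).
    by rewrite -[X in measurable X]setTI; exact: measurable_incr.
  by apply/seteqP; split => w /=; rewrite in_itv.
exists N; split => //; last by move=> w /= /negP; rewrite -leNgt.
have D0 : (0 < t - s)%R by rewrite subr_gt0.
have PN lam : (0 <= lam)%R -> P N <= ((1 + lam) `^ (- (t - s)))%:E.
  move=> l0; rewrite -(gproc_laplace s0 (ltW st) l0).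
  have -> : P N = \int[P]_w (\1_N w)%:E by rewrite integral_indic// setIT.
  apply: ge0_le_integral => //.
  - by apply/measurable_EFinP; exact: measurable_indic.
  - apply/measurable_EFinP; apply: measurableT_comp => //; apply: measurableT_comp => //.
    by apply: measurable_funM => //; exact: measurable_incr.
  - move=> w _; rewrite lee_fin indicE; have [wN|wN] := boolP (w \in N); last exact: expR_ge0.
    rewrite /= -expR0 ler_expR oppr_ge0 mulr_ge0_le0//.
    by move: wN; rewrite inE.
have PNf : P N \is a fin_num by exact: fin_num_measure.
apply/eqP; rewrite eq_le measure_ge0 andbT leNgt; apply/negP => PN0.
pose p := fine (P N).
have pE : P N = p%:E by rewrite fineK.
have p0 : (0 < p)%R by rewrite -lte_fin -pE.
(* Chosen so that lam^(-(t - s)) = p / 2; the bound (1 + lam)^(-(t - s)) is then below p. *)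
pose lam := ((p / 2) `^ (- (t - s)^-1))%R.
have l0 : (0 < lam)%R by rewrite powR_gt0// divr_gt0.
have := PN _ (ltW l0); rewrite pE lee_fin.
apply/negP; rewrite -ltNge powRN.
apply: (@le_lt_trans _ _ (p / 2)%R); last by rewrite ltr_pdivrMr// ltr_pMr// ltr1n.
have l1 : (0 < 1 + lam)%R by rewrite addr_gt0.
have pp : (0 < (p / 2)^-1)%R by rewrite invr_gt0 divr_gt0.
have pl : (0 < (1 + lam) `^ (t - s))%R by exact: powR_gt0.
rewrite -[leRHS]invrK lef_pV2//.
have -> : ((p / 2)^-1 = lam `^ (t - s))%R.
  by rewrite /lam -powRrM mulNr mulVf ?gt_eqF// powR_inv1// ltW// divr_gt0.
apply: ge0_ler_powR; rewrite ?nnegrE; [exact: ltW|exact: ltW| |by rewrite lerDr].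
by rewrite addr_ge0// ltW.
Qed.

Lemma gproc_incr_ge0 s t : (0 <= s)%R -> (s <= t)%R ->
  {ae P, forall w, (0 <= g t w - g s w)%R}.
Proof.
move=> s0; rewrite le_eqVlt => /orP[/eqP <-|st].
  by apply: aeW => w; rewrite subrr.
by apply: filterS (gproc_incr_gt0 s0 st) => w /ltW.
Qed.

Lemma gproc_ge0 t : (0 <= t)%R -> {ae P, forall w, (0 <= g t w)%R}.
Proof.
by move=> t0; apply: filterS (gproc_incr_ge0 (lexx 0) t0) => w; rewrite gproc0 subr0.
Qed.

Lemma gproc_gt0 t : (0 < t)%R -> {ae P, forall w, (0 < g t w)%R}.
Proof.
by move=> t0; apply: filterS (gproc_incr_gt0 (lexx 0) t0) => w; rewrite gproc0 subr0.
Qed.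

Definition past (I : set R) : set (set T) :=
  [set A | exists u, I u /\ exists B : set R, measurable B /\ A = g u @^-1` B].

(** The same sample space with only the sigma-algebra of the past, so that being determined by the
    past is ordinary measurability. *)
Definition pastT (I : set R) := g_sigma_algebraType (past I).

Lemma past_measurable I : <<s past I >> `<=` @measurable _ T.
Proof.
apply: smallest_sub; first exact: sigma_algebra_measurable.
move=> _ [u [_ [B [mB ->]]]]; rewrite -[X in measurable X]setTI.
exact: measurable_gproc.
Qed.

Lemma measurable_past_fun I d' (U : measurableType d') (Z : T -> U) :
  @measurable_fun _ _ (pastT I) U setT Z -> measurable_fun setT Z.
Proof. by move=> mZ _ B mB; apply: (@past_measurable I); exact: mZ. Qed.

Lemma measurable_gproc_past (I : set R) u : I u ->
  @measurable_fun _ _ (pastT I) R setT (g u).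
Proof.
move=> Iu _ B mB; rewrite setTI; apply: sub_sigma_algebra; exists u; split => //.
by exists B.
Qed.

Lemma indep_incr s t (Z : T -> R) (W : R -> \bar R) :
  (0 <= s)%R -> (s <= t)%R ->
  @measurable_fun _ _ (pastT `[0%R, s]%classic) R setT Z ->
  (forall w, 0 <= Z w)%R -> (forall x, 0 <= W x) -> measurable_fun setT W ->
  \int[P]_w ((Z w)%:E * W (g t w - g s w)%R) =
  \int[P]_w (Z w)%:E * \int[P]_w W (g t w - g s w)%R.
Proof.
move=> s0 st mZ Z0 W0 mW.
pose mfX := isMeasurableFun.Build _ _ _ _ _ (measurable_past_fun mZ).
pose X : {mfun T >-> R} := HB.pack Z mfX.
pose mfY := isMeasurableFun.Build _ _ _ _ _ (measurable_incr s t).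
pose Y : {mfun T >-> R} := HB.pack (fun w => g t w - g s w)%R mfY.
have XY A B : measurable A -> measurable B ->
    P ((X @^-1` A) `&` (Y @^-1` B)) = P (X @^-1` A) * P (Y @^-1` B).
  move=> mA mB; case: gp => _ _ _ + _ => /(_ s t s0 st); apply.
    by have := mZ measurableT A mA; rewrite setTI.
  by apply: sub_sigma_algebra; exists B.
pose h (z : R * R) := `|z.1|%:E * W z.2.
have mh : measurable_fun setT h.
  apply: emeasurable_funM; last exact: measurableT_comp.
  by apply/measurable_EFinP; exact: measurableT_comp.
have h0 z : 0 <= h z by rewrite mule_ge0.
have := indep_integral XY h0 mh.
rewrite /h /=; under eq_integral do rewrite ger0_norm//.
move=> ->.
have mWY : measurable_fun setT (fun w => W (g t w - g s w)%R).
  by apply: measurableT_comp => //; exact: measurable_incr.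
under eq_integral do rewrite ge0_integralZl//.
rewrite ge0_integralZr//; last 2 first.
- by apply/measurable_EFinP; exact: normr_measurable.
- by rewrite integral_ge0.
congr (_ * _); rewrite ge0_integral_distribution//; last first.
  by apply/measurable_EFinP; exact: normr_measurable.
by apply: eq_integral => w _ /=; rewrite ger0_norm.
Qed.

Lemma laplace_split a s t (Z : T -> R) :
  (0 <= a)%R -> (0 <= s)%R -> (s <= t)%R ->
  @measurable_fun _ _ (pastT `[0%R, s]%classic) R setT Z -> (forall w, 0 <= Z w)%R ->
  \int[P]_w (expR (- (a * g t w)) * Z w)%:E =
  ((1 + a) `^ (- (t - s)))%:E * \int[P]_w (expR (- (a * g s w)) * Z w)%:E.
Proof.
move=> a0 s0 st mZ Z0.
have ms : @measurable_fun _ _ (pastT `[0%R, s]%classic) R setT (g s).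
  by apply: measurable_gproc_past; rewrite /= in_itv/= s0 lexx.
transitivity (\int[P]_w ((expR (- (a * g s w)) * Z w)%:E * (expR (- (a * (g t w - g s w))))%:E)).
  apply: eq_integral => w _; rewrite -EFinM mulrAC -expRD.
  by congr (expR _ * _)%:E; ring.
rewrite (@indep_incr s t (fun w => expR (- (a * g s w)) * Z w)%R
  (fun x => (expR (- (a * x)))%:E))//.
- by rewrite gproc_laplace// muleC.
- apply: measurable_funM => //; apply: measurableT_comp => //.
  by apply: measurableT_comp => //; exact: measurable_funM.
- by move=> w; rewrite mulr_ge0// expR_ge0.
- by apply/measurable_EFinP; apply: measurableT_comp => //; apply: measurableT_comp.
Qed.

Lemma measurable_expsum s (l : seq (R * R)) (b : R) : all (fun q => (0 <= q.2 <= s)%R) l ->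
  @measurable_fun _ _ (pastT `[0%R, s]%classic) R setT
    (fun w => expR (- \sum_(q <- l) b * q.1 * g q.2 w))%R.
Proof.
move=> /allP H; apply: measurableT_comp => //; apply: measurableT_comp => //.
rewrite (_ : (fun w => _) = (fun w => \sum_(q <- l) if (0 <= q.2 <= s) then b * q.1 * g q.2 w else 0)%R).
  apply: measurable_sum => q; case qs : (0 <= q.2 <= s)%R => //; apply: measurable_funM => //.
  by apply: measurable_gproc_past; rewrite /= in_itv.
apply/funext => w; rewrite big_seq [in RHS]big_seq; apply: eq_bigr => q ql.
by rewrite H.
Qed.

(** Times are listed downwards from [v], and [mu] collects the coefficients already met. Peeling off
    the increment over [u, v] multiplies by a power -(v - u) of 1 + c + (1 + c) mu = (1 + c)(1 + mu)
    on the left and of 1 + mu on the right; the ratios telescope to (1 + c)^(-v). *)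
Lemma scale_laplace c (l : seq (R * R)) (mu v : R) : (0 <= c)%R -> (0 <= mu)%R -> (0 <= v)%R ->
  path (fun p q : R * R => q.2 <= p.2)%R (mu, v) l ->
  all (fun q => (0 <= q.1) && (0 <= q.2))%R l ->
  \int[P]_w (expR (- ((c + (1 + c) * mu) * g v w)) *
             expR (- \sum_(q <- l) (1 + c) * q.1 * g q.2 w))%:E =
  ((1 + c) `^ (- v))%:E *
  \int[P]_w (expR (- (mu * g v w)) * expR (- \sum_(q <- l) 1 * q.1 * g q.2 w))%:E.
Proof.
move=> c0; have c1 : (0 <= 1 + c)%R by rewrite addr_ge0.
elim: l mu v => [|[lam u] l ih] mu v mu0 v0 /=.
  move=> _ _; have L b : (0 <= b)%R -> \int[P]_w (expR (- (b * g v w)) * 1)%:E = ((1 + b) `^ (- v))%:E.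
    move=> b0; rewrite -[in RHS](subr0 v) -(gproc_laplace (lexx 0) v0 b0).
    by apply: eq_integral => w _; rewrite gproc0 subr0 mulr1.
  under eq_integral do rewrite big_nil oppr0 expR0.
  under [in RHS]eq_integral do rewrite big_nil oppr0 expR0.
  rewrite !L//; last by rewrite addr_ge0// mulr_ge0.
  rewrite -EFinM -powRM ?addr_ge0//; congr (_ `^ _)%:E; ring.
move=> /andP[uv pl] /andP[/andP[lam0 u0] al].
have all_u b : @measurable_fun _ _ (pastT `[0%R, u]%classic) R setT
    (fun w => expR (- \sum_(q <- (lam, u) :: l) b * q.1 * g q.2 w))%R.
  apply: measurable_expsum; rewrite /= u0 lexx/=.
  have tr : transitive (fun p q : R * R => q.2 <= p.2)%R.
    by move=> x y z /= xy yz; exact: le_trans yz xy.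
  have /allP H := order_path_min tr pl.
  apply/allP => q ql; move/allP : al => /(_ _ ql) /andP[_ ->] /=.
  exact: (H _ ql).
have cm0 : (0 <= c + (1 + c) * mu)%R by rewrite addr_ge0// mulr_ge0.
rewrite (laplace_split cm0 u0 uv (all_u (1 + c)%R) (fun=> expR_ge0 _)).
rewrite (laplace_split mu0 u0 uv (all_u 1%R) (fun=> expR_ge0 _)).
have := ih (mu + lam)%R u (addr_ge0 mu0 lam0) u0 _ al.
have pl' : path (fun p q : R * R => q.2 <= p.2)%R (mu + lam, u)%R l.
  by case: l pl {ih al all_u} => [|q l] //=.
move=> /(_ pl') ih'.
transitivity (((1 + (c + (1 + c) * mu)) `^ (- (v - u)))%:E *
  (((1 + c) `^ (- u))%:E * \int[P]_w (expR (- ((mu + lam) * g u w)) *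
    expR (- \sum_(q <- l) 1 * q.1 * g q.2 w))%:E)).
  rewrite -ih'; apply: (congr1 (mule _)); apply: eq_integral => w _.
  by rewrite big_cons/= -!expRD; congr (expR _)%:E; ring.
have -> : \int[P]_w (expR (- (mu * g u w)) * expR (- \sum_(q <- (lam, u) :: l) 1 * q.1 * g q.2 w))%:E
  = \int[P]_w (expR (- ((mu + lam) * g u w)) * expR (- \sum_(q <- l) 1 * q.1 * g q.2 w))%:E.
  by apply: eq_integral => w _; rewrite big_cons/= -!expRD; congr (expR _)%:E; ring.
rewrite !muleA -!EFinM; congr (_%:E * _).
have -> : (1 + (c + (1 + c) * mu) = (1 + c) * (1 + mu))%R by ring.
rewrite powRM ?addr_ge0//.
have -> : ((1 + c) `^ (- v) = (1 + c) `^ (- (v - u)) * (1 + c) `^ (- u))%R.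
  rewrite -powRD; first by congr (_ `^ _)%R; ring.
  by apply/implyP => _; rewrite gt_eqF// ltr_wpDr.
by ring.
Qed.

End gamma_process_facts.

Section clamp.
Context (R : realType).

(* Stopping a path at [clamp u v] makes it a total function of [v : R] that only
   depends on the times in [[0, u]]. *)
Definition clamp (u v : R) : R := Num.max 0 (Num.min v u).

Lemma clamp_itv u v : 0 <= u -> 0 <= clamp u v <= u.
Proof. by move=> u0; rewrite /clamp le_max lexx/= ge_max u0/= ge_min lexx orbT. Qed.

Lemma clamp_id u v : 0 <= v <= u -> clamp u v = v.
Proof. by move=> /andP[v0 vu]; rewrite /clamp (min_idPl vu) (max_idPr v0). Qed.

End clamp.

(** Writing 1 / x as x |x|^(-2) reduces the claim to the measurability of powers; at x = 0 both are
    0. *)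
Lemma measurable_funV d (T : measurableType d) (R : realType) (f : T -> R) :
  measurable_fun setT f -> measurable_fun setT (fun x => (f x)^-1).
Proof.
move=> mf.
have -> : (fun x => (f x)^-1) = (fun x => f x * `|f x| `^ (- 2%:R)).
  apply/funext => x; rewrite powRN powR_mulrn// real_normK ?num_real//.
  have [->|fx0] := eqVneq (f x) 0; first by rewrite invr0 mul0r.
  by field.
apply: measurable_funM => //; apply: measurableT_comp (measurable_powR _) _.
exact: measurableT_comp.
Qed.

Lemma integral_cst_prob d (T : measurableType d) (R : realType) (P : probability T R)
  (c : R) : (\int[P]_w c%:E = c%:E)%E.
Proof.
transitivity (c%:E * P setT)%E; first exact: (integral_cst P measurableT c%:E).
by rewrite probability_setT mule1.
Qed.

(** * Lukacs independence and moments of increments *)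

Section lukacs.
Local Open Scope ereal_scope.
Context (R : realType) (d : measure_display) (T : measurableType d).
Variables (P : probability T R) (g : R -> T -> R).
Hypothesis gp : gamma_process P g.

Lemma gproc_laplace0 t lam : (0 <= t)%R -> (0 <= lam)%R ->
  \int[P]_w (expR (- (lam * g t w)))%:E = ((1 + lam) `^ (- t))%:E.
Proof.
move=> t0 l0; rewrite -[in RHS](subr0 t) -(gproc_laplace gp (lexx 0) t0 l0).
by apply: eq_integral => w _; rewrite (gproc0 gp) subr0.
Qed.

(* Under the density proportional to [expR (- c * g r)] the path [(1 + c) * g] has
   the law of [g]; normalising by [g r] removes the factor [1 + c], whence the
   independence of [qpath r] and [g r]. *)
Lemma lukacs_scale r c (h : pathT R -> \bar R) : (0 <= r)%R -> (0 <= c)%R ->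
  (forall x, 0 <= h x) -> measurable_fun setT h ->
  \int[P]_w (h (fun v => (1 + c) * g (clamp r v) w)%R * (expR (- (c * g r w)))%:E) =
  \int[P]_w (h (fun v => g (clamp r v) w) * ((1 + c) `^ (- r))%:E).
Proof.
move=> r0 c0 h0 mh.
have c1 : (0 <= 1 + c)%R by rewrite addr_ge0.
have mg := measurable_gproc gp.
have ae0 v : {ae P, forall w, (0 <= g (clamp r v) w)%R}.
  by apply: (gproc_ge0 gp); have /andP[] := clamp_itv v r0.
apply: (@laplace_unique_path _ _ T T R P P (fun w => expR (- (c * g r w)))
  (fun=> (1 + c) `^ (- r))%R (fun v w => (1 + c) * g (clamp r v) w)%R
  (fun v w => g (clamp r v) w)) => //.
- by move=> x; exact: powR_ge0.
- apply: measurableT_comp => //; apply: measurableT_comp => //; exact: measurable_funM.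
- by move=> v; exact: measurable_funM.
- by rewrite gproc_laplace0// ltry.
- by rewrite integral_cst_prob ltry.
- by move=> v; apply: filterS (ae0 v) => w ?; rewrite mulr_ge0.
move=> e.
pose le (p q : R * R) := (q.2 <= p.2)%R.
(* Clamped times lie in [0, r]; sorting them downwards gives the order that [scale_laplace]
   requires, started at time [r] with coefficient 0. *)
pose l0 := [seq (q.1%:R : R, clamp r q.2) | q <- e].
pose l := sort le l0.
have tr : transitive le by move=> x y z /= xy yz; exact: le_trans yz xy.
have lE (F : R * R -> R) : (\sum_(q <- e) F (q.1%:R, clamp r q.2) = \sum_(q <- l) F q)%R.
  by rewrite (perm_big l0) ?perm_sort//= big_map.
have memE q : q \in l -> (0 <= q.1)%R && (0 <= q.2 <= r)%R.
  by rewrite mem_sort => /mapP[p _ ->] /=; rewrite ler0n clamp_itv.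
have pl : path le (0%R, r) l.
  rewrite path_min_sorted; last first.
    by apply/allP => q /memE /andP[_ /andP[_]].
  by apply: sort_sorted => p q; exact: le_total.
have al : all (fun q => (0 <= q.1) && (0 <= q.2))%R l.
  by apply/allP => q /memE /andP[-> /andP[-> _]].
have := scale_laplace gp c0 (lexx 0) r0 pl al.
rewrite mulr0 addr0 => H.
transitivity (\int[P]_w (expR (- (c * g r w)) * expR (- \sum_(q <- l) (1 + c) * q.1 * g q.2 w))%:E).
  apply: eq_integral => w _; rewrite mulrC; congr (_ * expR (- _))%:E.
  rewrite -(lE (fun q => (1 + c) * q.1 * g q.2 w)%R); apply: eq_bigr => q _ /=; ring.
rewrite H muleC -ge0_integralZr//; last 2 first.
- apply/measurable_EFinP; apply: measurable_funM.
    by apply: measurableT_comp => //; apply: measurableT_comp => //; exact: measurable_funM.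
  apply: measurableT_comp => //; apply: measurableT_comp => //; apply: measurable_sum => q.
  exact: measurable_funM.
- by rewrite lee_fin powR_ge0.
apply: eq_integral => w _; rewrite -EFinM mul0r oppr0 expR0 mul1r.
congr (expR (- _) * _)%:E; rewrite -(lE (fun q => 1 * q.1 * g q.2 w)%R).
by apply: eq_bigr => q _ /=; rewrite mul1r.
Qed.

(** The gamma bridge of length [r], held at its value at 0 before time 0 and at its terminal value
    after [r]. *)
Definition qpath r w : pathT R := fun v => (g (clamp r v) w / g r w)%R.

Lemma measurable_qpath r : measurable_fun setT (qpath r).
Proof.
apply: measurable_path_fun => v; apply: measurable_funM; first exact: (measurable_gproc gp).
by apply: measurable_funV; exact: (measurable_gproc gp).
Qed.

Let normp r (p : pathT R) : pathT R := fun v => (p v / p r)%R.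

Let measurable_normp r : measurable_fun setT (normp r).
Proof.
apply: measurable_path_fun => v; apply: measurable_funM; first exact: measurable_eval_path.
by apply: measurable_funV; exact: measurable_eval_path.
Qed.

Lemma lukacs_laplace r c (h : pathT R -> \bar R) : (0 <= r)%R -> (0 <= c)%R ->
  (forall x, 0 <= h x) -> measurable_fun setT h ->
  \int[P]_w (h (qpath r w) * (expR (- (c * g r w)))%:E) =
  \int[P]_w h (qpath r w) * ((1 + c) `^ (- r))%:E.
Proof.
move=> r0 c0 h0 mh.
have := @lukacs_scale r c (h \o normp r) r0 c0 (fun x => h0 _) (measurableT_comp mh (measurable_normp r)).
have rr : clamp r r = r by rewrite clamp_id// r0 lexx.
have E k w : (0 < k)%R -> normp r (fun v => k * g (clamp r v) w)%R = qpath r w.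
  move=> k0; apply/funext => v; rewrite /normp/qpath rr.
  by rewrite invfM mulrACA divff ?mul1r// gt_eqF.
have E1 w : normp r (fun v => g (clamp r v) w)%R = qpath r w.
  by apply/funext => v; rewrite /normp/qpath rr.
under eq_integral do rewrite /= E ?ltr_wpDr//.
move=> ->; under eq_integral do rewrite /= E1.
rewrite ge0_integralZr//; last by rewrite lee_fin powR_ge0.
by apply: measurableT_comp => //; exact: measurable_qpath.
Qed.

(** Fix an event A of the bridge. By [lukacs_laplace], the weights 1_A and P(A) give [g r] the same
    Laplace transform, hence the same weighted law; this is independence of A and [g r]. *)
Lemma lukacs_indep r (h : pathT R -> \bar R) (W : R -> \bar R) : (0 <= r)%R ->
  (forall x, 0 <= h x) -> measurable_fun setT h ->
  (forall x, 0 <= W x) -> measurable_fun setT W ->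
  \int[P]_w (h (qpath r w) * W (g r w)) =
  \int[P]_w h (qpath r w) * \int[P]_w W (g r w).
Proof.
move=> r0 h0 mh W0 mW.
have mg := measurable_gproc gp.
have mq := measurable_qpath r.
pose mfX := isMeasurableFun.Build _ _ _ _ _ mq.
pose X : {mfun T >-> pathT R} := HB.pack (qpath r) mfX.
pose mfY := isMeasurableFun.Build _ _ _ _ _ (mg r).
pose Y : {mfun T >-> R} := HB.pack (g r) mfY.
have XY A B : measurable A -> measurable B ->
    P ((X @^-1` A) `&` (Y @^-1` B)) = P (X @^-1` A) * P (Y @^-1` B).
  move=> mA mB.
  have mXA : measurable (X @^-1` A) by have := mq measurableT A mA; rewrite setTI.
  have mYB : measurable (Y @^-1` B) by have := mg r measurableT B mB; rewrite setTI.
  pose a := fine (P (X @^-1` A)).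
  have aE : P (X @^-1` A) = a%:E by rewrite fineK// fin_num_measure.
  have ai : \int[P]_w (\1_A (qpath r w))%:E = a%:E.
    rewrite -aE; transitivity (\int[P]_w (\1_(X @^-1` A) w)%:E) => //.
    by rewrite integral_indic// setIT.
  have m1A : measurable_fun setT (\1_A : pathT R -> R) by exact: measurable_indic.
  have := @laplace_unique _ _ T T R P P (fun w => \1_A (qpath r w)) (fun=> a) (g r) (g r).
  move=> /(_ _ _ _ _ (mg r) (mg r)) H.
  have {}H := H _ _ _ _ _ _ (gproc_ge0 gp r0) (gproc_ge0 gp r0) _ (fun x => (\1_B x)%:E).
  have {}H : \int[P]_x ((\1_B (g r x))%:E * (\1_A (qpath r x))%:E) =
     \int[P]_x ((\1_B (g r x))%:E * a%:E).
    apply: H => //.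
    + by rewrite -lee_fin -aE measure_ge0.
    + exact: measurableT_comp.
    + by rewrite ai ltry.
    + by rewrite integral_cst_prob ltry.
    + move=> n; have m1AE : measurable_fun setT (fun p : pathT R => (\1_A p : R)%:E).
        exact/measurable_EFinP.
      have i0 (x : pathT R) : 0 <= (\1_A x : R)%:E by rewrite lee_fin.
      have HL := @lukacs_laplace r n%:R (fun p => (\1_A p)%:E) r0 (ler0n _ n) i0 m1AE.
      transitivity (\int[P]_w ((\1_A (qpath r w))%:E * (expR (- (n%:R * g r w)))%:E)).
        by apply: eq_integral => w _; rewrite -EFinM mulrC.
      rewrite HL ai -(gproc_laplace0 r0 (ler0n _ n)) -ge0_integralZl//.
      * by apply: eq_integral => w _; rewrite -EFinM mulrC.
      * by apply/measurable_EFinP; apply: measurableT_comp => //; apply: measurableT_comp => //; exact: measurable_funM.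
      * by rewrite -aE measure_ge0.
    + by apply/measurable_EFinP; exact: measurable_indic.
  transitivity (\int[P]_w (\1_((X @^-1` A) `&` (Y @^-1` B)) w)%:E).
    by rewrite integral_indic ?setIT//; exact: measurableI.
  transitivity (\int[P]_x ((\1_B (g r x))%:E * (\1_A (qpath r x))%:E)).
    by apply: eq_integral => w _; rewrite indicI/= -EFinM mulrC.
  rewrite H ge0_integralZr//; [|by apply/measurable_EFinP; apply: measurableT_comp => //; exact: measurable_indic|by rewrite -aE measure_ge0].
  rewrite aE muleC; congr (_ * _).
  transitivity (\int[P]_w (\1_(Y @^-1` B) w)%:E) => //.
  by rewrite integral_indic// setIT.
have := @indep_integral _ _ _ _ _ _ _ P X Y XY (fun z => h z.1 * W z.2).
move=> /(_ (fun z => mule_ge0 (h0 _) (W0 _))) ->/=; last first.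
  by apply: emeasurable_funM; exact: measurableT_comp.
have mWg : measurable_fun setT (fun w => W (g r w)) by exact: measurableT_comp.
under eq_integral do rewrite ge0_integralZl//.
rewrite ge0_integralZr//; last by rewrite integral_ge0.
by congr (_ * _); rewrite ge0_integral_distribution.
Qed.

Lemma incr_density s t (f : R -> \bar R) : (0 <= s)%R -> (s < t)%R ->
  (forall x, 0 <= f x) -> measurable_fun setT f ->
  \int[P]_w f (g t w - g s w)%R =
  \int[@lebesgue_measure R]_x (f x * (gdens (t - s) x / Gammaf (t - s))%:E).
Proof.
move=> s0 st f0 mf; have D0 : (0 < t - s)%R by rewrite subr_gt0.
have G0 := Gammaf_gt0 D0.
(* Laplace uniqueness requires a variable that is nonnegative Lebesgue-almost everywhere; |x| is
   one, and agrees with x where the density is nonzero. *)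
transitivity (\int[@lebesgue_measure R]_x (f `|x|%R * (gdens (t - s) x / Gammaf (t - s))%:E)); last first.
  apply: eq_integral => x _; rewrite /gdens; case: ifPn => x0; last by rewrite mul0r !mule0.
  by rewrite gtr0_norm.
transitivity (\int[P]_w (f (g t w - g s w)%R * (1%R)%:E)).
  by apply: eq_integral => w _; rewrite mule1.
have LG (lam : R) : (0 <= lam)%R -> \int[@lebesgue_measure R]_x
    (expR (- (lam * `|x|)) * (gdens (t - s) x / Gammaf (t - s)))%:E = ((1 + lam) `^ (- (t - s)))%:E.
  move=> l0.
  transitivity (\int[@lebesgue_measure R]_x ((Gammaf (t - s))^-1%:E * (expR (- (lam * x)) * gdens (t - s) x)%:E)).
    apply: eq_integral => x _; rewrite -EFinM; congr EFin; rewrite /gdens.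
    case: ifPn => x0; last by rewrite mul0r !mulr0.
    by rewrite gtr0_norm//; ring.
  rewrite ge0_integralZl//.
  - by rewrite laplace_gdens// -EFinM mulrC mulfK// gt_eqF.
  - apply/measurable_EFinP; apply: measurable_funM; last exact: measurable_gdens.
    by apply: measurableT_comp => //; apply: measurableT_comp => //; exact: mulrl_measurable.
  - by move=> x _; rewrite lee_fin mulr_ge0 ?expR_ge0 ?gdens_ge0.
  - by rewrite lee_fin invr_ge0 ltW.
apply: (@laplace_unique _ _ T _ R P (@lebesgue_measure R) (fun=> 1%R)
  (fun x => gdens (t - s) x / Gammaf (t - s))%R (fun w => g t w - g s w)%R (fun x => `|x|)%R) => //.
- by move=> x; rewrite mulr_ge0 ?gdens_ge0// invr_ge0 ltW.
- by apply: measurable_funM => //; exact: measurable_gdens.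
- exact: (measurable_incr gp).
- exact: normr_measurable.
- by rewrite integral_cst_prob ltry.
- have <- : \int[@lebesgue_measure R]_x (expR (- (0 * `|x|)) * (gdens (t - s) x / Gammaf (t - s)))%:E =
      \int[@lebesgue_measure R]_x (gdens (t - s) x / Gammaf (t - s))%:E.
    by apply: eq_integral => x _; rewrite mul0r oppr0 expR0 mul1r.
  by rewrite LG// ltry.
- by apply: filterS (gproc_incr_gt0 gp s0 st) => w /ltW.
- exact: aeW.
- move=> n; rewrite LG// -(gproc_laplace gp s0 (ltW st) (ler0n _ n)).
  by apply: eq_integral => w _; rewrite mulr1.
Qed.

(** A factor x^b turns the gamma density of parameter t - s into an unnormalised one of parameter t
    - s + b; negative [b] is allowed as long as this parameter stays positive. *)
Lemma incr_moment s t b lam : (0 <= s)%R -> (s < t)%R -> (0 < t - s + b)%R -> (0 <= lam)%R ->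
  \int[P]_w ((g t w - g s w) `^ b * expR (- (lam * (g t w - g s w))))%:E =
  (Gammaf (t - s + b) / Gammaf (t - s) * (1 + lam) `^ (- (t - s + b)))%:E.
Proof.
move=> s0 st b0 l0; have D0 : (0 < t - s)%R by rewrite subr_gt0.
have G0 := Gammaf_gt0 D0.
have me : measurable_fun setT (fun x : R => expR (- (lam * x)))%R.
  by apply: measurableT_comp => //; apply: measurableT_comp => //; exact: mulrl_measurable.
rewrite (@incr_density s t (fun x => (x `^ b * expR (- (lam * x)))%:E) s0 st)//; last 2 first.
- by move=> x; rewrite lee_fin mulr_ge0 ?powR_ge0 ?expR_ge0.
- by apply/measurable_EFinP; apply: measurable_funM => //; exact: measurable_powR.
transitivity (\int[@lebesgue_measure R]_x ((Gammaf (t - s))^-1%:E *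
    (expR (- (lam * x)) * gdens (t - s + b) x)%:E)).
  apply: eq_integral => x _; rewrite -!EFinM; congr EFin; rewrite /gdens.
  case: ifPn => x0; last by rewrite mul0r !mulr0.
  have -> : (x `^ (t - s + b - 1) = x `^ (t - s - 1) * x `^ b)%R.
    rewrite -powRD; last by apply/implyP => _; rewrite gt_eqF.
    by congr (_ `^ _)%R; ring.
  by ring.
rewrite ge0_integralZl//.
- by rewrite laplace_gdens// -EFinM; congr EFin; ring.
- by apply/measurable_EFinP; apply: measurable_funM => //; exact: measurable_gdens.
- by move=> x _; rewrite lee_fin mulr_ge0 ?expR_ge0 ?gdens_ge0.
- by rewrite lee_fin invr_ge0 ltW.
Qed.

End lukacs.

Opaque Gammaf.

(** * The recursion Gamma(a + 1) = a Gamma(a) *)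

Section gamma_rec.
Local Open Scope ereal_scope.
Context (R : realType).
Local Notation mu := (@lebesgue_measure R).

Lemma cvg_difference_quotient (f : R -> R) (l : R) :
  is_derive (0%R : R) 1%R f l ->
  (n.+1%:R * (f (n.+1%:R^-1) - f 0))%R @[n --> \oo] --> l.
Proof.
move=> [df <-].
have : (fun h : R => h^-1 *: ((f \o shift 0%R) (h *: 1%R) - f 0%R))%R @ 0%R^' --> 'D_1%R f 0%R.
  exact: df.
move=> /cvgr_dnbhsP /(_ (fun n => n.+1%:R^-1)%R) K.
have {}K : (n.+1%:R^-1^-1 *: ((f \o shift 0%R) (n.+1%:R^-1 *: (1%R : R)) - f 0%R))%R
    @[n --> \oo] --> 'D_1%R f 0%R.
  by apply: K; split => [n|]; [rewrite invr_eq0 pnatr_eq0|exact: cvg_harmonic].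
move: K; under eq_fun do rewrite invrK /= addr0 /GRing.scale/= mulr1; exact.
Qed.

Lemma cvg_expR_quotient (x : R) :
  (n.+1%:R * (1 - expR (- (n.+1%:R^-1 * x))))%R @[n --> \oo] --> x.
Proof.
have H : is_derive (0%R : R) 1%R (fun h : R => - expR (h * (- x)))%R x.
  apply: is_derive_eq; rewrite ?mul0r ?expR0 ?scaler0 ?scale1r ?addr0 ?add0r /GRing.scale/=.
  by rewrite ?expR0 ?mulr0 ?mulr1 ?mul1r ?add0r ?addr0 ?opprK.
have := cvg_difference_quotient H; rewrite mul0r expR0 opprK.
by under eq_fun do rewrite addrC mulrN; exact.
Qed.

Lemma cvg_powR_quotient (a : R) :
  (n.+1%:R * (1 - (1 + n.+1%:R^-1) `^ (- a)))%R @[n --> \oo] --> a.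
Proof.
have H1 : is_derive (1%R : R) 1%R (@powR R ^~ (- a)%R) (- a * 1 `^ (- a - 1))%R.
  exact: is_derive1_powR.
have H2 : is_derive (0%R : R) 1%R (id + cst 1 : R -> R)%R 1%R.
  by apply: is_derive_eq; rewrite addr0.
have H : is_derive (0%R : R) 1%R (fun h : R => (h + 1) `^ (- a))%R (- a)%R.
  have H1' : is_derive ((id + cst 1 : R -> R) 0 : R)%R 1%R (@powR R ^~ (- a)%R) (- a)%R.
    have -> : ((id + cst 1 : R -> R) 0 = 1)%R by rewrite /= fctE add0r.
    by move: H1; rewrite powR1 mulr1.
  have := is_derive1_comp H1' H2; rewrite mulr1; exact.
have := cvg_difference_quotient H; rewrite add0r powR1 => K.
have := cvgN K; rewrite opprK => K2.
have -> : (fun n : nat => (n.+1%:R * (1 - (1 + n.+1%:R^-1) `^ (- a)))%R : R) =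
    (- (fun n : nat => (n.+1%:R * ((n.+1%:R^-1 + 1) `^ (- a) - 1))%R : R))%R.
  apply/funext => n.
  change ((n.+1%:R * (1 - (1 + n.+1%:R^-1) `^ (- a)))%R =
    (- (n.+1%:R * ((n.+1%:R^-1 + 1) `^ (- a) - 1)))%R).
  by rewrite [(1 + _^-1)%R]addrC -mulrN opprB.
by apply: K2.
Qed.

(** Both sides are minus the derivative at lam = 0 of the Laplace transform (1 + lam)^(-a) Gamma(a)
    of [gdens a]. The quotients are taken along lam = 1 / (n + 1); since 1 - exp(-y) <= y, the
    function x [gdens a x] dominates. *)
Lemma Gammaf_rec (a : R) : (0 < a)%R -> Gammaf (a + 1) = (a * Gammaf a)%R.
Proof.
move=> a0; have a10 : (0 < a + 1)%R by rewrite addr_gt0.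
have xg x : (x * gdens a x = gdens (a + 1) x)%R.
  rewrite /gdens; case: ifPn => x0; last by rewrite mulr0.
  by rewrite mulrA addrK mulr_powRB1// ltW.
pose f_ n x : \bar R := (n.+1%:R * (1 - expR (- (n.+1%:R^-1 * x))) * gdens a x)%:E.
have me n : measurable_fun setT (fun x : R => expR (- (n.+1%:R^-1 * x)))%R.
  by apply: measurableT_comp => //; apply: measurableT_comp => //; exact: mulrl_measurable.
have mg := measurable_gdens a.
have int1 b : (0 < b)%R -> mu.-integrable setT (fun x => (gdens b x)%:E).
  move=> b0; apply/integrableP; split; first by apply/measurable_EFinP; exact: measurable_gdens.
  under eq_integral do rewrite gee0_abs ?lee_fin ?gdens_ge0//.
  exact: gdens_fin.
have n0 n : (0 <= n.+1%:R^-1 :> R)%R by rewrite invr_ge0.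
have mf_ n : measurable_fun setT (f_ n).
  apply/measurable_EFinP; apply: measurable_funM => //; apply: measurable_funM => //.
  exact: measurable_funB.
have H : \int[mu]_x f_ n x @[n --> \oo] --> (Gammaf (a + 1))%:E.
  rewrite GammafE//.
  have [] := @dominated_convergence _ _ R mu setT measurableT f_
    (fun x => (gdens (a + 1) x)%:E) (fun x => (gdens (a + 1) x)%:E) => //.
  - by apply/measurable_EFinP; exact: measurable_gdens.
  - apply: aeW => x _; apply: cvg_EFin; first by apply: nearW => n.
    by rewrite -xg; apply: cvgM; [exact: cvg_expR_quotient|exact: cvg_cst].
  - exact: int1.
  - apply: aeW => x n _; rewrite /f_/= lee_fin normrM (ger0_norm (gdens_ge0 _ _)) -xg.
    have [x0|x0] := ltP 0%R x; last first.
      by rewrite /gdens ltNge x0/= !mulr0.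
    rewrite ler_wpM2r ?gdens_ge0// ger0_norm.
      rewrite mulrC -ler_pdivlMr ?ltr0n// lerBlDr -lerBlDl mulrC.
      by have := expR_ge1Dx (- (n.+1%:R^-1 * x))%R; rewrite addrC.
    by rewrite mulr_ge0// subr_ge0 -[leRHS]expR0 ler_expR oppr_le0 mulr_ge0// ltW.
have E n : \int[mu]_x f_ n x = (n.+1%:R * (1 - (1 + n.+1%:R^-1) `^ (- a)) * Gammaf a)%:E.
  transitivity (\int[mu]_x (n.+1%:R%:E * ((gdens a x)%:E - (expR (- (n.+1%:R^-1 * x)) * gdens a x)%:E))).
    by apply: eq_integral => x _; rewrite /f_ -EFinB -EFinM; congr EFin; ring.
  have int2 : mu.-integrable setT (fun x => (expR (- (n.+1%:R^-1 * x)) * gdens a x)%:E).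
    apply/integrableP; split.
      by apply/measurable_EFinP; apply: measurable_funM; [exact: me|exact: mg].
    under eq_integral do rewrite gee0_abs ?lee_fin ?mulr_ge0 ?gdens_ge0 ?expR_ge0//.
    by rewrite laplace_gdens// ltry.
  rewrite integralZl//; last exact: (integrableB measurableT (int1 _ a0) int2).
  rewrite (integralB measurableT (int1 _ a0) int2) -GammafE// laplace_gdens//.
  by rewrite -EFinB -EFinM; congr EFin; ring.
have H2 : \int[mu]_x f_ n x @[n --> \oo] --> (a * Gammaf a)%:E.
  under eq_fun do rewrite E; apply: cvg_EFin; first by apply: nearW.
  by apply: cvgM; [exact: cvg_powR_quotient|exact: cvg_cst].
have e1 := cvg_lim (@ereal_hausdorff R) H; have e2 := cvg_lim (@ereal_hausdorff R) H2.
suff : (Gammaf (a + 1))%:E = (a * Gammaf a)%:E by case.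
by rewrite -e1 -e2.
Qed.

End gamma_rec.

(** * Conditional mean and absolute continuity of gamma bridges *)

Section bridge.
Local Open Scope ereal_scope.
Context (R : realType) (d : measure_display) (T : measurableType d).
Variables (P : probability T R) (g : R -> T -> R).
Hypothesis gp : gamma_process P g.

(* The pair (path up to [s], terminal value [g r]) encoded as a single process,
   so that [laplace_unique_path] applies to it. *)
Definition bproc s r (v : R) w := if (v <= s)%R then g (clamp s v) w else g r w.
Definition bsum s (e : seq (nat * R)) w : R :=
  (\sum_(q <- e) if q.2 <= s then q.1%:R * g (clamp s q.2) w else 0)%R.
Definition blam s (e : seq (nat * R)) : R := (\sum_(q <- e) if q.2 <= s then 0 else q.1%:R)%R.

Lemma bsumE s r e w : (\sum_(q <- e) q.1%:R * bproc s r q.2 w = bsum s e w + blam s e * g r w)%R.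
Proof.
rewrite /bsum /blam mulr_suml -big_split/=; apply: eq_bigr => q _.
by rewrite /bproc; case: ifP; rewrite ?mul0r ?addr0 ?add0r.
Qed.

Lemma blam_ge0 s e : (0 <= blam s e)%R.
Proof. by apply: sumr_ge0 => q _; case: ifP. Qed.

Lemma measurable_bproc s r v : measurable_fun setT (bproc s r v).
Proof. by rewrite /bproc; case: (v <= s)%R; exact: (measurable_gproc gp). Qed.

Lemma measurable_bpath s r : measurable_fun setT (fun w => (bproc s r ^~ w) : pathT R).
Proof. by apply: measurable_path_fun => v; exact: measurable_bproc. Qed.

Lemma bproc_ge0 s r v : (0 <= s)%R -> (0 <= r)%R -> {ae P, forall w, (0 <= bproc s r v w)%R}.
Proof.
move=> s0 r0; rewrite /bproc; case: (v <= s)%R; apply: (gproc_ge0 gp) => //.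
by have /andP[] := clamp_itv v s0.
Qed.

Lemma measurable_expbsum s u e : (0 <= s)%R -> (s <= u)%R ->
  @measurable_fun _ _ (pastT g `[0%R, u]%classic) R setT (fun w => expR (- bsum s e w)).
Proof.
move=> s0 su; apply: measurableT_comp => //; apply: measurableT_comp => //.
apply: measurable_sum => q; case: (q.2 <= s)%R => //; apply: measurable_funM => //.
apply: measurable_gproc_past; rewrite /= in_itv/=.
by have /andP[-> H] := clamp_itv q.2 s0; rewrite (le_trans H su).
Qed.

Lemma measurable_expbsum_lam s u e : (0 <= s)%R -> (s <= u)%R ->
  @measurable_fun _ _ (pastT g `[0%R, u]%classic) R setT
    (fun w => expR (- (blam s e * g u w)) * expR (- bsum s e w))%R.
Proof.
move=> s0 su; apply: measurable_funM; last exact: measurable_expbsum.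
apply: measurableT_comp => //; apply: measurableT_comp => //; apply: measurable_funM => //.
by apply: measurable_gproc_past; rewrite /= in_itv/= lexx (le_trans s0 su).
Qed.

Definition spath s r w : pathT R := fun v => (g (clamp s v) w / g r w)%R.

Lemma measurable_spath s r : measurable_fun setT (spath s r).
Proof.
apply: measurable_path_fun => v; apply: measurable_funM; first exact: (measurable_gproc gp).
by apply: measurable_funV; exact: (measurable_gproc gp).
Qed.

(** Recovers the bridge from the encoding [bproc]: the index s + 1 is just one index beyond [s],
    where the terminal value is stored. *)
Definition bnorm s (p : pathT R) : pathT R := fun v => (p (clamp s v) / p (s + 1))%R.

Lemma measurable_bnorm s : measurable_fun setT (bnorm s).
Proof.
apply: measurable_path_fun => v; apply: measurable_funM; first exact: measurable_eval_path.
by apply: measurable_funV; exact: measurable_eval_path.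
Qed.

Lemma bnormE s r w : (0 <= s)%R -> bnorm s (bproc s r ^~ w) = spath s r w.
Proof.
move=> s0; apply/funext => v; rewrite /bnorm /spath /bproc.
have /andP[c0 c1] := clamp_itv v s0.
by rewrite c1 leNgt ltrDl ltr01/= (@clamp_id _ s (clamp s v)) ?c0 ?c1.
Qed.

(** The path up to [s] and the increments over [s, u] and [u, r] are independent. The power weights
    only the last increment, so each of the two increments contributes an explicit factor. *)
Lemma moment_split s u r b e : (0 <= s)%R -> (s <= u)%R -> (u < r)%R -> (0 < r - u + b)%R ->
  \int[P]_w (expR (- (\sum_(q <- e) q.1%:R * bproc s r q.2 w)) * (g r w - g u w) `^ b)%:E =
  (Gammaf (r - u + b) / Gammaf (r - u) * (1 + blam s e) `^ (- (r - u + b)) *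
    (1 + blam s e) `^ (- (u - s)))%:E *
  \int[P]_w (expR (- (blam s e * g s w)) * expR (- bsum s e w))%:E.
Proof.
move=> s0 su ur b0; have u0 := le_trans s0 su.
pose W x : \bar R := (x `^ b * expR (- (blam s e * x)))%:E.
transitivity (\int[P]_w ((expR (- (blam s e * g u w)) * expR (- bsum s e w))%:E * W (g r w - g u w)%R)).
  apply: eq_integral => w _; rewrite bsumE /W -EFinM; congr EFin.
  rewrite [RHS]mulrACA mulrC -[in LHS](mul1r (expR (- (_ + _)))).
  rewrite mul1r; have -> : (- (bsum s e w + blam s e * g r w) =
    - (blam s e * g u w) + - bsum s e w + - (blam s e * (g r w - g u w)))%R by ring.
  by rewrite !expRD; ring.
have me : measurable_fun setT (fun x : R => expR (- (blam s e * x)))%R.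
  by apply: measurableT_comp => //; apply: measurableT_comp => //; exact: mulrl_measurable.
rewrite (@indep_incr _ _ _ _ _ gp u r (fun w => expR (- (blam s e * g u w)) * expR (- bsum s e w))%R W).
- rewrite (incr_moment gp u0 ur b0 (blam_ge0 s e)).
  rewrite (laplace_split gp (blam_ge0 s e) s0 su (measurable_expbsum e s0 (lexx s)) (fun=> expR_ge0 _)).
  by rewrite muleC muleA -EFinM.
- exact: u0.
- exact: ltW.
- exact: measurable_expbsum_lam.
- by move=> w; apply: mulr_ge0; exact: expR_ge0.
- by move=> x; rewrite lee_fin; apply: mulr_ge0; [exact: powR_ge0|exact: expR_ge0].
- by apply/measurable_EFinP; apply: measurable_funM; [exact: measurable_powR|exact: me].
Qed.

Lemma fin_moment u r b : (0 <= u)%R -> (u < r)%R -> (0 < r - u + b)%R ->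
  \int[P]_w ((g r w - g u w) `^ b)%:E < +oo.
Proof.
move=> u0 ur b0; have := incr_moment gp u0 ur b0 (lexx 0).
under eq_integral do rewrite mul0r oppr0 expR0 mulr1.
by move=> ->; exact: ltry.
Qed.

Lemma measurable_incr_powR u r b : measurable_fun setT (fun w => (g r w - g u w) `^ b)%R.
Proof. by apply: measurableT_comp (measurable_powR b) _; exact: (measurable_incr gp). Qed.

(** Give the pair (path up to s, [g r]) the weight [g r - g u] or (r - u) / (r - s) times
    [g r - g s]. By [moment_split] both Laplace transforms contain (1 + lam)^(-(r - s + 1)), and
    Gamma(x + 1) / Gamma(x) = x matches the constants r - u and r - s. *)
Lemma bridge_mean s u r (h : pathT R -> \bar R) :
  (0 <= s)%R -> (s <= u)%R -> (u < r)%R ->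
  (forall x, 0 <= h x) -> measurable_fun setT h ->
  \int[P]_w (h (spath s r w) * `|1 - g u w / g r w|%:E) =
  ((r - u) / (r - s))%:E * \int[P]_w (h (spath s r w) * `|1 - g s w / g r w|%:E).
Proof.
move=> s0 su ur h0 mh; have sr := le_lt_trans su ur.
have u0 := le_trans s0 su; have r0 := le_lt_trans s0 sr.
have ru : (0 < r - u)%R by rewrite subr_gt0.
have rs : (0 < r - s)%R by rewrite subr_gt0.
(* As 1 - g_u / g_r = (g_r - g_u) / g_r, the factor 1 / g_r goes into the functional of the encoded
   path and the increment becomes the weight. *)
pose H (p : pathT R) : \bar R := h (bnorm s p) * (`|p (s + 1)%R|^-1)%:E.
have H0 p : 0 <= H p by rewrite mule_ge0// lee_fin invr_ge0.
have mH : measurable_fun setT H.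
  apply: emeasurable_funM; first by apply: measurableT_comp => //; exact: measurable_bnorm.
  apply/measurable_EFinP; apply: measurable_funV.
  by apply: measurableT_comp => //; exact: measurable_eval_path.
have XS w : bproc s r (s + 1)%R w = g r w by rewrite /bproc leNgt ltrDl ltr01.
have mh' z : measurable_fun setT (fun w => h (spath s r w) * `|1 - g z w / g r w|%:E).
  apply: emeasurable_funM; first by apply: measurableT_comp => //; exact: measurable_spath.
  apply/measurable_EFinP; apply: measurableT_comp => //; apply: measurable_funB => //.
  apply: measurable_funM; first exact: (measurable_gproc gp).
  by apply: measurable_funV; exact: (measurable_gproc gp).
have conv z : (0 <= z)%R -> (z < r)%R ->
    \int[P]_w (h (spath s r w) * `|1 - g z w / g r w|%:E) =
    \int[P]_w (H (bproc s r ^~ w) * ((g r w - g z w) `^ 1)%:E).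
  move=> z0 zr; apply: ge0_ae_eq_integral => //.
  - apply: emeasurable_funM; last by apply/measurable_EFinP; exact: measurable_incr_powR.
    exact: (measurableT_comp mH (measurable_bpath s r)).
  - by move=> w _; rewrite mule_ge0.
  - by move=> w _; rewrite mule_ge0// lee_fin powR_ge0.
  apply: filterS2 (gproc_gt0 gp r0) (gproc_incr_gt0 gp z0 zr) => w gr grz _.
  rewrite /H bnormE// XS -muleA -EFinM; congr (_ * _%:E).
  rewrite powRr1 ?(ltW grz)// (gtr0_norm gr).
  have -> : (1 - g z w / g r w = (g r w)^-1 * (g r w - g z w))%R by field; rewrite gt_eqF.
  by rewrite normrM (gtr0_norm grz) gtr0_norm// invr_gt0.
rewrite (conv u u0 ur) (conv s s0 sr).
have b1 : (0 < r - u + 1)%R by rewrite addr_gt0.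
have b2 : (0 < r - s + 1)%R by rewrite addr_gt0.
have c0 : (0 <= (r - u) / (r - s))%R by rewrite divr_ge0 ?ltW.
have mHX : measurable_fun setT (fun w => H (bproc s r ^~ w)).
  exact: (measurableT_comp mH (measurable_bpath s r)).
transitivity (\int[P]_w (H (bproc s r ^~ w) * ((r - u) / (r - s) * (g r w - g s w) `^ 1)%:E)); last first.
  rewrite -ge0_integralZl//.
  - by apply: eq_integral => w _; rewrite EFinM muleCA.
  - by apply: emeasurable_funM => //; apply/measurable_EFinP; exact: measurable_incr_powR.
  - by move=> w _; rewrite mule_ge0// lee_fin powR_ge0.
apply: (@laplace_unique_path _ _ T T R P P (fun w => (g r w - g u w) `^ 1)%R
  (fun w => (r - u) / (r - s) * (g r w - g s w) `^ 1)%R (bproc s r) (bproc s r)) => //.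
- by move=> w; exact: powR_ge0.
- by move=> w; rewrite mulr_ge0 ?powR_ge0.
- exact: measurable_incr_powR.
- by apply: measurable_funM => //; exact: measurable_incr_powR.
- by move=> v; exact: measurable_bproc.
- by move=> v; exact: measurable_bproc.
- exact: fin_moment.
- under eq_integral do rewrite EFinM; rewrite ge0_integralZl//.
  + by rewrite lte_mul_pinfty// fin_moment.
  + by apply/measurable_EFinP; exact: measurable_incr_powR.
  + by move=> w _; rewrite lee_fin powR_ge0.
- by move=> v; apply: bproc_ge0 => //; exact: ltW.
- by move=> v; apply: bproc_ge0 => //; exact: ltW.
move=> e; rewrite (moment_split e s0 su ur b1).
transitivity (((r - u) / (r - s))%:E * \int[P]_w (expR (- (\sum_(q <- e) q.1%:R * bproc s r q.2 w)) *
    (g r w - g s w) `^ 1)%:E); last first.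
  rewrite -ge0_integralZl//.
  - by apply: eq_integral => w _; rewrite -EFinM; congr EFin; ring.
  - apply/measurable_EFinP; apply: measurable_funM; last exact: measurable_incr_powR.
    apply: measurableT_comp => //; apply: measurableT_comp => //; apply: measurable_sum => q.
    by apply: measurable_funM => //; exact: measurable_bproc.
  - by move=> w _; rewrite lee_fin mulr_ge0 ?expR_ge0 ?powR_ge0.
rewrite (moment_split e s0 (lexx s) sr b2) muleA -EFinM; congr (_%:E * _).
have pL x y : ((1 + blam s e) `^ (x + y) = (1 + blam s e) `^ x * (1 + blam s e) `^ y)%R.
  by rewrite powRD//; apply/implyP => _; rewrite gt_eqF// ltr_wpDr// blam_ge0.
rewrite !Gammaf_rec// -!mulrA -!pL.
have -> : (- (r - u + 1) + - (u - s) = - (r - s + 1) + - (s - s))%R by ring.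
have := Gammaf_gt0 ru; have := Gammaf_gt0 rs => G1 G2.
by field; rewrite !gt_eqF// subr_gt0.
Qed.

(** The pair (path up to u, [g r]) has the law of (path up to u, [g (u + 1)]) weighted by Gamma(1) /
    Gamma(r - u) times the power r - u - 1 of the last increment, a ratio of two gamma densities.
    The power factors through [g (u + 1)] and 1 - g_u / g_(u+1), and Lukacs independence integrates
    the former out. *)
Lemma bridge_ac u r (h : pathT R -> \bar R) : (0 < u)%R -> (u < r)%R ->
  (forall x, 0 <= h x) -> measurable_fun setT h ->
  \int[P]_w h (spath u r w) =
  (Gammaf 1 / Gammaf (u + 1) * (Gammaf r / Gammaf (r - u)))%:E *
  \int[P]_w (h (spath u (u + 1) w) * ((1 - g u w / g (u + 1) w) `^ (r - u - 1))%:E).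
Proof.
move=> u0 ur h0 mh; pose b := (r - u - 1)%R.
have u0' := ltW u0; have uu1 : (u < u + 1)%R by rewrite ltrDl.
have u10 : (0 < u + 1)%R by rewrite addr_gt0.
have r0 := lt_trans u0 ur.
have ru : (0 < r - u)%R by rewrite subr_gt0.
have eu : (u + 1 - u = 1)%R by ring.
have eb : (1 + b = r - u)%R by rewrite /b; ring.
have b0 : (0 < u + 1 - u + b)%R by rewrite eu eb.
have G1 := Gammaf_gt0 (@ltr01 R); have Ga := Gammaf_gt0 ru.
pose k := (Gammaf 1 / Gammaf (r - u))%R.
have k0 : (0 <= k)%R by apply: divr_ge0; exact: ltW.
transitivity (\int[P]_w (h (bnorm u (bproc u r ^~ w)) * (1%R)%:E)).
  by apply: eq_integral => w _; rewrite mule1 bnormE.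
transitivity (\int[P]_w (h (bnorm u (bproc u (u + 1) ^~ w)) * (k * (g (u + 1) w - g u w) `^ b)%:E)).
  apply: (@laplace_unique_path _ _ T T R P P (fun=> 1)%R
    (fun w => k * (g (u + 1) w - g u w) `^ b)%R (bproc u r) (bproc u (u + 1)) _ _ _ _ _ _ _ _ _ _ _
    (h \o bnorm u)) => //.
  - by move=> w; rewrite mulr_ge0 ?powR_ge0.
  - by apply: measurable_funM => //; exact: measurable_incr_powR.
  - by move=> v; exact: measurable_bproc.
  - by move=> v; exact: measurable_bproc.
  - by rewrite integral_cst_prob ltry.
  - under eq_integral do rewrite EFinM; rewrite ge0_integralZl//.
    + by rewrite lte_mul_pinfty// fin_moment.
    + by apply/measurable_EFinP; exact: measurable_incr_powR.
    + by move=> w _; rewrite lee_fin powR_ge0.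
  - by move=> v; apply: bproc_ge0 => //; exact: ltW.
  - by move=> v; apply: bproc_ge0 => //; exact: ltW.
  - move=> e.
    transitivity (\int[P]_w (expR (- (blam u e * g r w)) * expR (- bsum u e w))%:E).
      apply: eq_integral => w _; rewrite mulr1 bsumE -expRD; congr (expR _)%:E; ring.
    rewrite (laplace_split gp (blam_ge0 u e) u0' (ltW ur) (measurable_expbsum e u0' (lexx u)) (fun=> expR_ge0 _)).
    transitivity (k%:E * \int[P]_w (expR (- (\sum_(q <- e) q.1%:R * bproc u (u + 1) q.2 w)) *
      (g (u + 1) w - g u w) `^ b)%:E); last first.
      rewrite -ge0_integralZl//.
      + by apply: eq_integral => w _; rewrite -EFinM; congr EFin; ring.
      + apply/measurable_EFinP; apply: measurable_funM; last exact: measurable_incr_powR.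
        apply: measurableT_comp => //; apply: measurableT_comp => //; apply: measurable_sum => q.
        by apply: measurable_funM => //; exact: measurable_bproc.
      + by move=> w _; rewrite lee_fin mulr_ge0 ?expR_ge0 ?powR_ge0.
    rewrite (moment_split e u0' (lexx u) uu1 b0) muleA -EFinM; congr (_%:E * _).
    rewrite eu eb subrr oppr0 powRr0 /k; field.
    by rewrite !gt_eqF.
  - by move=> x; exact: h0.
  - exact: (measurableT_comp mh (measurable_bnorm u)).
(* The integrand as a functional of the bridge of length u + 1 alone, the form to which
   [lukacs_indep] applies. *)
pose h' (p : pathT R) : \bar R := h ((fun v => p (clamp u v)) : pathT R) * ((1 - p u) `^ b)%:E.
have mh' : measurable_fun setT h'.
  apply: emeasurable_funM.
    have mc : measurable_fun setT (fun p : pathT R => (fun v => p (clamp u v)) : pathT R).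
      by apply: measurable_path_fun => v; exact: measurable_eval_path.
    exact: (measurableT_comp mh mc).
  apply/measurable_EFinP; apply: measurableT_comp (measurable_powR b) _.
  by apply: measurable_funB => //; exact: measurable_eval_path.
have h'0 p : 0 <= h' p by rewrite mule_ge0// lee_fin powR_ge0.
have h'E w : h' (qpath g (u + 1) w) = h (spath u (u + 1) w) * ((1 - g u w / g (u + 1) w) `^ b)%:E.
  rewrite /h' /qpath; congr (h _ * _).
    apply/funext => v; rewrite /spath (@clamp_id _ (u + 1)%R (clamp u v))//.
    by have /andP[-> H] := clamp_itv v u0'; rewrite (le_trans H)// ltW.
  by rewrite clamp_id// u0' ltW.
have mS : measurable_fun setT (fun x : R => (x `^ b)%:E) by apply/measurable_EFinP; exact: measurable_powR.
have LI := @lukacs_indep _ _ _ _ _ gp (u + 1)%R h' (fun x => (x `^ b)%:E) (ltW u10) h'0 mh'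
  (fun x => powR_ge0 _ _) mS.
transitivity (\int[P]_w (k%:E * (h' (qpath g (u + 1) w) * ((g (u + 1) w) `^ b)%:E))).
  have mg := measurable_gproc gp.
  have mq := measurable_qpath gp (u + 1)%R.
  apply: ge0_ae_eq_integral => //.
  - apply: emeasurable_funM; first exact: (measurableT_comp (measurableT_comp mh (measurable_bnorm u)) (measurable_bpath u (u + 1)%R)).
    by apply/measurable_EFinP; apply: measurable_funM => //; exact: measurable_incr_powR.
  - apply: measurable_funeM; apply: emeasurable_funM; first exact: measurableT_comp.
    by apply/measurable_EFinP; apply: measurableT_comp (measurable_powR b) _.
  - by move=> w _; rewrite mule_ge0// lee_fin mulr_ge0 ?powR_ge0.
  - by move=> w _; rewrite !mule_ge0// lee_fin powR_ge0.
  apply: filterS2 (gproc_gt0 gp u10) (gproc_incr_gt0 gp u0' uu1) => w gS gY _.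
  rewrite h'E bnormE// EFinM muleCA -muleA; congr (_ * (_ * _)).
  rewrite -EFinM; congr EFin; rewrite -powRM ?(ltW gS)//; last first.
    rewrite subr_ge0 ler_pdivrMr// mul1r -subr_ge0; exact: ltW.
  by congr (_ `^ _)%R; field; rewrite gt_eqF.
have mq := measurable_qpath gp (u + 1)%R.
rewrite ge0_integralZl//; last 2 first.
- apply: emeasurable_funM; first exact: measurableT_comp.
  by apply/measurable_EFinP; apply: measurableT_comp (measurable_powR b) _; exact: (measurable_gproc gp).
- by move=> w _; rewrite mule_ge0// lee_fin powR_ge0.
rewrite LI.
(* The moment of order r - u - 1 of a gamma variable of parameter u + 1 is Gamma(r) / Gamma(u + 1),
   the source of Gamma(r) in phi. *)
have -> : \int[P]_w ((g (u + 1) w) `^ b)%:E = (Gammaf r / Gammaf (u + 1))%:E.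
  have b1 : (0 < u + 1 - 0 + b)%R by rewrite /b; have -> : (u + 1 - 0 + (r - u - 1) = r)%R by ring.
  have := incr_moment gp (lexx 0) u10 b1 (lexx 0).
  have -> : (u + 1 - 0 + b = r)%R by rewrite /b; ring.
  rewrite subr0 addr0 powR1 mulr1 => <-.
  by apply: eq_integral => w _; rewrite (gproc0 gp) subr0 mul0r oppr0 expR0 mulr1.
rewrite [X in _ * X]muleC muleA -EFinM.
have -> : (k * (Gammaf r / Gammaf (u + 1)) =
    Gammaf 1 / Gammaf (u + 1) * (Gammaf r / Gammaf (r - u)))%R by rewrite /k; ring.
by apply: (congr1 (mule _)); apply: eq_integral => w _; exact: h'E.
Qed.

End bridge.

(** * Right-continuous processes are jointly measurable *)

Section right_continuous.
Context (R : realType).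
Implicit Types f : R -> R.

Definition right_cont f := forall t, 0 <= t -> f x @[x --> t^'+] --> f t.

Lemma right_cont_min f c : 0 <= c -> right_cont f ->
  right_cont (fun s => f (Num.min s c)).
Proof.
move=> c0 rf t t0; have [tc|ct] := ltP t c.
  apply: cvg_trans (rf t t0); apply: near_eq_cvg; near=> x.
  rewrite (min_idPl _)//; near: x.
  by apply: filterS (nbhs_right_lt tc) => x /ltW.
apply: cvg_near_cst; near=> x.
rewrite (min_idPr _)//; apply: le_trans ct _; apply: ltW; near: x; exact: nbhs_right_gt.
Unshelve. all: by end_near. Qed.

Lemma right_contZ f k : right_cont f -> right_cont (fun s => f s * k).
Proof. by move=> rf t t0; apply: cvgM; [exact: rf|exact: cvg_cst]. Qed.

End right_continuous.

(** Time is rounded up to the grid of step 1 / (n + 1); the rounded process is piecewise constant in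
    time, hence jointly measurable, and right continuity gives the limit. The maximum with 0 makes
    time total. *)
Lemma measurable_joint d (T : measurableType d) (R : realType) (X : R -> T -> R) :
  (forall r, 0 <= r -> measurable_fun setT (X r)) ->
  (forall w, right_cont (X ^~ w)) ->
  measurable_fun setT (fun z : R * T => X (Num.max 0 z.1) z.2).
Proof.
move=> mX rX.
pose y n (z : R * T) : R := n.+1%:R * Num.max 0 z.1.
have my n : measurable_fun setT (y n).
  by apply: measurable_funM => //; apply: measurable_maxr => //; exact: measurable_fst.
have y0 n z : 0 <= y n z by rewrite mulr_ge0// le_max lexx.
(* The successor [k.+1] puts the grid point strictly to the right of the time, as sequences testing
   a right limit must be. *)
pose u k n : R := k.+1%:R / n.+1%:R.
pose h n (z : R * T) : R := X (u (Num.truncn (y n z)) n) z.2.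
apply: (@measurable_fun_cvg _ _ _ setT h).
  move=> n _ B mB; rewrite setTI.
  rewrite (_ : h n @^-1` B = \bigcup_k ((y n @^-1` `[k%:R, k.+1%:R[%classic) `&`
      ((fun z => X (u k n) z.2) @^-1` B))).
    apply: bigcupT_measurable => k; apply: measurableI.
      by rewrite -[X in measurable X]setTI; exact: my.
    rewrite -[X in measurable X]setTI.
    apply: (measurableT_comp (mX (u k n) _) (measurable_snd)) => //.
    by rewrite divr_ge0.
  apply/seteqP; split => z /=.
    by move=> Bz; exists (Num.truncn (y n z)) => //=; rewrite in_itv/= truncn_itv.
  by move=> [k _ /= [+ Bz]]; rewrite in_itv/= /h => /truncn_def ->.
move=> z _; set p := Num.max 0 z.1.
have p0 : 0 <= p by rewrite le_max lexx.
have := rX z.2 p p0 => /cvg_at_rightP /(_ (fun n => u (Num.truncn (y n z)) n)); apply.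
have lb n : p < u (Num.truncn (y n z)) n.
  by rewrite /u ltr_pdivlMr ?ltr0n// mulrC; exact: truncnS_gt.
have ub n : u (Num.truncn (y n z)) n <= p + n.+1%:R^-1.
  rewrite /u ler_pdivrMr ?ltr0n// mulrDl mulVf ?pnatr_eq0// -natr1 lerD2r mulrC.
  by have /andP[] := truncn_itv (y0 n z).
split => //.
apply: (@squeeze_cvgr _ _ _ _ (cst p) (fun n => p + n.+1%:R^-1)).
- by apply: nearW => n; rewrite ub (ltW (lb n)).
- exact: cvg_cst.
- rewrite -[X in _ --> X]addr0; apply: cvgD; first exact: cvg_cst.
  exact: cvg_harmonic.
Qed.

(** * Disintegration with respect to the length tau *)

Section disintegration.
Local Open Scope ereal_scope.
Context (R : realType) (d : measure_display) (T : measurableType d).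
Variables (P : probability T R) (g : R -> T -> R) (tau : {mfun T >-> R}).
Hypothesis gp : gamma_process P g.
Hypothesis tau0 : forall w, (0 < tau w)%R.
Hypothesis taug : indep P (sigma_rv tau) (gen_sigma `[0%R, +oo[%classic g).

(** The sample space seen through gamma alone: independence of [tau] and gamma becomes independence
    of [tau] and the identity map into [Om], to which [indep_integral] applies. *)
Let Om := pastT g `[0%R, +oo[%classic.

Lemma gproc_right_cont w : right_cont (g ^~ w).
Proof. by case: gp => _ _ /(_ w) [] H _ _ _ t t0; exact: H. Qed.

Lemma measurable_gjoint :
  measurable_fun setT (fun z : R * Om => g (Num.max 0%R z.1) z.2).
Proof.
apply: measurable_joint => [r r0|w]; last exact: gproc_right_cont.
by apply: measurable_gproc_past; rewrite /= in_itv/= r0.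
Qed.

Lemma measurable_gjointT :
  measurable_fun setT (fun z : R * T => g (Num.max 0%R z.1) z.2).
Proof.
apply: measurable_joint => [r r0|w]; last exact: gproc_right_cont.
exact: (measurable_gproc gp).
Qed.

Definition zt t w : R := (g (Num.min t (tau w)) w / g (tau w) w)%R.

Lemma measurable_gtau : measurable_fun setT (fun w => g (tau w) w).
Proof.
have : measurable_fun setT (fun w => g (Num.max 0%R (tau w)) w).
  by apply: (measurableT_comp measurable_gjointT (measurable_fun_pair _ _)).
rewrite (_ : (fun w => _) = (fun w => g (tau w) w))//.
by apply/funext => w; rewrite (max_idPr _)// ltW.
Qed.

Lemma measurable_zt t : (0 <= t)%R -> measurable_fun setT (zt t).
Proof.
move=> t0; apply: measurable_funM; last exact/measurable_funV/measurable_gtau.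
have : measurable_fun setT (fun w => g (Num.max 0%R (Num.min t (tau w))) w).
  apply: (measurableT_comp measurable_gjointT (measurable_fun_pair _ _)) => //.
  exact: measurable_minr.
rewrite (_ : (fun w => _) = (fun w => g (Num.min t (tau w)) w))//.
by apply/funext => w; rewrite (max_idPr _)// le_min t0 ltW.
Qed.

Lemma right_cont_zt w : right_cont (zt ^~ w).
Proof.
apply: (@right_contZ _ (fun s => g (Num.min s (tau w)) w)).
by apply: (@right_cont_min _ (g ^~ w)); [exact: ltW|exact: gproc_right_cont].
Qed.

Lemma disintegration (F : R * Om -> \bar R) :
  (forall z, 0 <= F z) -> measurable_fun setT F ->
  \int[P]_w F (tau w, w) = \int[distribution P tau]_r \int[P]_w F (r, w).
Proof.
move=> F0 mF.
have mid : measurable_fun setT (id : T -> Om).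
  by move=> _ B mB; rewrite setTI; exact: (past_measurable gp mB).
pose mfY := isMeasurableFun.Build _ _ _ _ _ mid.
pose Y : {mfun T >-> Om} := HB.pack (id : T -> Om) mfY.
apply: (@indep_integral _ _ _ T R Om R P tau Y _ F F0 mF).
move=> A B mA mB; apply: taug; last exact: mB.
by apply: sub_sigma_algebra; exists A.
Qed.

(** When tau > u, stopping at tau is not felt on [0, u], so zeta there is the bridge of length tau,
    which may be frozen at tau = r. *)
Lemma disintegration_path u (H : R * pathT R -> \bar R) : (0 <= u)%R ->
  (forall z, 0 <= H z) -> measurable_fun setT H ->
  \int[P]_(w in tau @^-1` `]u, +oo[) H (tau w, (fun v => zt (clamp u v) w) : pathT R) =
  \int[distribution P tau]_(r in `]u, +oo[) \int[P]_w H (r, spath g u r w).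
Proof.
move=> u0 H0 mH.
pose F (z : R * Om) : \bar R :=
  if (u < z.1)%R then H (z.1, spath g u (Num.max 0%R z.1) z.2) else 0.
have msp : measurable_fun setT (fun z : R * Om => spath g u (Num.max 0%R z.1) z.2).
  apply: measurable_path_fun => v; apply: measurable_funM.
    apply: measurableT_comp; last exact: measurable_snd.
    apply: measurable_gproc_past; rewrite /= in_itv/=.
    by have /andP[->] := clamp_itv v u0.
  by apply: measurable_funV; exact: measurable_gjoint.
have mF : measurable_fun setT F.
  apply: measurable_fun_ifT => //.
    by apply: measurable_fun_ltr => //; exact: measurable_fst.
  by apply: (measurableT_comp mH); apply: measurable_fun_pair.
have F0 z : 0 <= F z by rewrite /F; case: ifP.
have E := disintegration F0 mF.
rewrite integral_mkcond [in RHS]integral_mkcond.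
transitivity (\int[P]_w F (tau w, w)).
  apply: eq_integral => w _; rewrite patchE /F /=.
  have [uw|wu] := ltP u (tau w).
    rewrite mem_set/= ?in_itv/= ?uw//; congr (H (_, _)); apply/funext => v.
    rewrite /zt /spath (max_idPr _) ?(ltW (tau0 w))// (min_idPl _)//.
    by have /andP[_ /le_trans] := clamp_itv v u0; apply; exact: ltW.
  by rewrite memNset//= in_itv/= andbT; apply/negP; rewrite -leNgt.
rewrite E; apply: eq_integral => r _; rewrite patchE /F /=.
have [ur|ru] := ltP u r.
  rewrite mem_set/= ?in_itv/= ?ur//; apply: eq_integral => w _.
  by rewrite (max_idPr _)// (le_trans u0)// ltW.
rewrite memNset/= ?in_itv/= ?andbT; last by apply/negP; rewrite -leNgt.
by apply: integral0_eq.
Qed.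

End disintegration.

(** * The drift density and its identification by Bayes' rule *)

Section compensator_density.
Local Open Scope ereal_scope.
Context (R : realType) (d : measure_display) (T : measurableType d).
Variables (P : probability T R) (g : R -> T -> R) (tau : {mfun T >-> R}).
Hypothesis gp : gamma_process P g.
Hypothesis tau0 : forall w, (0 < tau w)%R.
Hypothesis taug : indep P (sigma_rv tau) (gen_sigma `[0%R, +oo[%classic g).

Let Ptau := distribution P tau.

(** The numerator of phi without its indicator. Its normalisation is [Dz], phi itself is [phiz], and
    [bz] is the rate of the drift. *)
Definition Kf (u x r : R) : R := ((1 - x) `^ r * (Gammaf r / Gammaf (r - u)))%R.

Definition Dz u x : \bar R := \int[Ptau]_(r in `]u, +oo[) (Kf u x r)%:E.

Definition phiz u r x : R :=
  (Kf u x r / fine (Dz u x) * (if (0 < x < 1)%R then 1 else 0))%R.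

(** Kept in the extended reals: finiteness is not known pointwise, and Tonelli needs only
    nonnegativity. *)
Definition bz u x : \bar R :=
  ((1 - x) * (if 0 < x < 1 then 1 else 0))%:E *
  \int[Ptau]_(r in `]u, +oo[) ((r - u)^-1 * phiz u r x)%:E.

Lemma Kf_ge0 u x r : (0 <= Kf u x r)%R.
Proof. by rewrite mulr_ge0 ?powR_ge0// divr_ge0// Gammaf_ge0. Qed.

Lemma Dz_ge0 u x : 0 <= Dz u x.
Proof. by apply: integral_ge0 => r _; rewrite lee_fin Kf_ge0. Qed.

Lemma phiz_ge0 u r x : (0 <= phiz u r x)%R.
Proof.
rewrite /phiz mulr_ge0//; last by case: ifP.
by rewrite divr_ge0 ?Kf_ge0// fine_ge0// Dz_ge0.
Qed.

Lemma bz_ge0 u x : 0 <= bz u x.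
Proof.
rewrite /bz mule_ge0//.
  rewrite lee_fin; case: ifP => [/andP[_ x1]|]; last by rewrite mulr0.
  by rewrite mulr1 subr_ge0 ltW.
apply: integral_ge0 => r /=; rewrite in_itv/= andbT => ur.
by rewrite lee_fin mulr_ge0 ?phiz_ge0// invr_ge0 subr_ge0 ltW.
Qed.

Lemma bz_out u x : ~~ (0 < x < 1)%R -> bz u x = 0.
Proof. by move=> x01; rewrite /bz (negbTE x01) mulr0 mul0e. Qed.

(** The domain depends on the parameter; moving it into the integrand as a condition gives a partial
    integral over a product. *)
Lemma measurable_tail_integral (f : (R * R) * R -> R) : measurable_fun setT f ->
  (forall z r, (z.1 < r)%R -> (0 <= f (z, r))%R) ->
  measurable_fun setT (fun z : R * R => \int[Ptau]_(r in `]z.1, +oo[) (f (z, r))%:E).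
Proof.
move=> mf f0; pose F (z : (R * R) * R) : \bar R := if (z.1.1 < z.2)%R then (f z)%:E else 0.
have mF : measurable_fun setT F.
  apply: measurable_fun_ifT => //; last exact/measurable_EFinP.
  by apply: measurable_fun_ltr => //; apply: (measurableT_comp measurable_fst measurable_fst).
have F0 z : 0 <= F z by case: z => z r; rewrite /F /=; case: ifP => // zr; rewrite lee_fin f0.
have -> : (fun z : R * R => \int[Ptau]_(r in `]z.1, +oo[) (f (z, r))%:E) = fubini_F Ptau F.
  apply/funext => z; rewrite /fubini_F [LHS]integral_mkcond; apply: eq_integral => r _.
  rewrite patchE /F /=; have [zr|rz] := ltP z.1 r; first by rewrite mem_set//= in_itv/= zr.
  by rewrite memNset//= in_itv/= andbT; apply/negP; rewrite -leNgt.
exact: measurable_fun_fubini_tonelli_F.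
Qed.

Lemma measurable_Kf d' (U : measurableType d') (a b c : U -> R) :
  measurable_fun setT a -> measurable_fun setT b -> measurable_fun setT c ->
  measurable_fun setT (fun z => Kf (a z) (b z) (c z)).
Proof.
move=> ma mb mc; apply: measurable_funM.
  by apply: measurable_powR2 => //; exact: measurable_funB.
apply: measurable_funM; first exact: (measurableT_comp (@measurable_Gammaf R) mc).
apply: measurable_funV; apply: (measurableT_comp (@measurable_Gammaf R)).
exact: measurable_funB.
Qed.

Lemma measurable_Dz : measurable_fun setT (fun z : R * R => Dz z.1 z.2).
Proof.
apply: (measurable_tail_integral (f := fun z => Kf z.1.1 z.1.2 z.2)).
  apply: measurable_Kf => //.
  - exact: (measurableT_comp measurable_fst measurable_fst).
  - exact: (measurableT_comp measurable_snd measurable_fst).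
by move=> z r _; exact: Kf_ge0.
Qed.

Lemma measurable_bz : measurable_fun setT (fun z : R * R => bz z.1 z.2).
Proof.
have mx01 d' (U : measurableType d') (f : U -> R) : measurable_fun setT f ->
    measurable_fun setT (fun z => if (0 < f z < 1)%R then 1 else 0 : R)%R.
  move=> mf; apply: measurable_fun_ifT => //.
  by apply: measurable_and; apply: measurable_fun_ltr.
apply: emeasurable_funM.
  apply/measurable_EFinP; apply: measurable_funM.
    by apply: measurable_funB => //; exact: measurable_snd.
  by apply: mx01; exact: measurable_snd.
have m11 : measurable_fun setT (fun z : (R * R) * R => z.1.1).
  exact: (measurableT_comp measurable_fst measurable_fst).
have m12 : measurable_fun setT (fun z : (R * R) * R => z.1.2).
  exact: (measurableT_comp measurable_snd measurable_fst).
have m2 : measurable_fun setT (fun z : (R * R) * R => z.2) by exact: measurable_snd.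
apply: (measurable_tail_integral (f := fun z => (z.2 - z.1.1)^-1 * phiz z.1.1 z.2 z.1.2)%R).
  apply: measurable_funM; first by apply: measurable_funV; exact: measurable_funB.
  apply: measurable_funM; last exact: mx01.
  apply: measurable_funM; first exact: measurable_Kf.
  apply: measurable_funV; apply: measurable_fine_fun.
  exact: (measurableT_comp measurable_Dz measurable_fst).
by move=> z r zr; rewrite /= mulr_ge0 ?phiz_ge0// invr_ge0 subr_ge0 ltW.
Qed.

Definition kap u : R := (Gammaf 1 / Gammaf (u + 1))%R.
(* [wt u x * Kf u x r] is the density on [[0, u]] of the bridge of length [r] with
   respect to the bridge of length [u + 1], at paths with value [x] at time [u]. *)
Definition wt u x : R := (kap u * (1 - x) `^ (- u - 1))%R.

Lemma kap_gt0 u : (0 < u)%R -> (0 < kap u)%R.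
Proof. by move=> u0; rewrite divr_gt0// Gammaf_gt0// addr_gt0. Qed.

Lemma wt_ge0 u x : (0 < u)%R -> (0 <= wt u x)%R.
Proof. by move=> u0; rewrite mulr_ge0 ?powR_ge0// ltW// kap_gt0. Qed.

Lemma spath_itv u r : (0 < u)%R -> (u < r)%R ->
  {ae P, forall w, (0 < spath g u r w u < 1)%R}.
Proof.
move=> u0 ur; apply: filterS2 (gproc_gt0 gp u0) (gproc_incr_gt0 gp (ltW u0) ur) => w gu gr.
have gr0 : (0 < g r w)%R by rewrite -(subrK (g u w) (g r w)) addr_gt0.
rewrite /spath clamp_id; last by rewrite lexx (ltW u0).
by rewrite divr_gt0//= ltr_pdivrMr// mul1r -subr_gt0.
Qed.

(** All bridges of length r > u are carried to the reference bridge of length u + 1 by [bridge_ac].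
    Once the law no longer depends on r, Tonelli brings the integral over r inside. *)
Lemma mix_ac u (H : R * pathT R -> \bar R) : (0 < u)%R ->
  (forall z, 0 <= H z) -> measurable_fun setT H ->
  \int[Ptau]_(r in `]u, +oo[) \int[P]_w H (r, spath g u r w) =
  \int[P]_w \int[Ptau]_(r in `]u, +oo[) (H (r, spath g u (u + 1) w) *
    (wt u (spath g u (u + 1) w u) * Kf u (spath g u (u + 1) w u) r)%:E).
Proof.
move=> u0 H0 mH; have u0' := ltW u0.
have uu1 : (u < u + 1)%R by rewrite ltrDl.
pose p w := spath g u (u + 1) w.
have mp : measurable_fun setT p by exact: (measurable_spath gp).
have mpu : measurable_fun setT (fun w => p w u).
  exact: (measurableT_comp (measurable_eval_path u) mp).
pose F (z : R * T) : \bar R := if (u < z.1)%R then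
  H (z.1, p z.2) * (wt u (p z.2 u) * Kf u (p z.2 u) z.1)%:E else 0.
have mpu2 : measurable_fun setT (fun z : R * T => p z.2 u).
  exact: (measurableT_comp mpu measurable_snd).
have mF : measurable_fun setT F.
  apply: measurable_fun_ifT => //.
    by apply: measurable_fun_ltr => //; exact: measurable_fst.
  apply: emeasurable_funM.
    apply: (measurableT_comp mH); apply: measurable_fun_pair => //.
    exact: (measurableT_comp mp measurable_snd).
  apply/measurable_EFinP; apply: measurable_funM.
    apply: measurable_funM => //; apply: measurable_powR2 => //; exact: measurable_funB.
  by apply: measurable_Kf => //; exact: measurable_fst.
have F0 z : 0 <= F z.
  rewrite /F; case: ifP => // _; rewrite mule_ge0// lee_fin mulr_ge0 ?Kf_ge0//.
  exact: wt_ge0.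
transitivity (\int[Ptau]_r \int[P]_w F (r, w)).
  rewrite integral_mkcond; apply: eq_integral => r _; rewrite patchE /F /=.
  have [ur|ru] := ltP u r; last first.
    rewrite memNset/= ?in_itv/= ?andbT; last by apply/negP; rewrite -leNgt.
    by apply/esym/integral0_eq.
  rewrite mem_set/= ?in_itv/= ?ur//.
  have mHr : measurable_fun setT (fun q : pathT R => H (r, q)).
    by apply: (measurableT_comp mH); apply: measurable_fun_pair.
  rewrite (bridge_ac gp u0 ur (fun q => H0 (r, q)) mHr) -ge0_integralZl//.
  - apply: ge0_ae_eq_integral => //.
    + apply: measurable_funeM; apply: emeasurable_funM; first exact: (measurableT_comp mHr mp).
      apply/measurable_EFinP; apply: measurable_powR2 => //; apply: measurable_funB => //.
      apply: measurable_funM; first exact: (measurable_gproc gp).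
      by apply: measurable_funV; exact: (measurable_gproc gp).
    + apply: emeasurable_funM; first exact: (measurableT_comp mHr mp).
      apply/measurable_EFinP; apply: measurable_funM; last exact: measurable_Kf.
      by apply: measurable_funM => //; apply: measurable_powR2 => //; exact: measurable_funB.
    + move=> w _; rewrite !mule_ge0// lee_fin ?powR_ge0//.
      by rewrite mulr_ge0// divr_ge0// Gammaf_ge0.
    + move=> w _; rewrite !mule_ge0// lee_fin mulr_ge0 ?Kf_ge0//; exact: wt_ge0.
    apply: filterS (spath_itv u0 uu1) => w /andP[x0 x1] _.
    rewrite muleCA; congr (_ * _); rewrite -EFinM; congr EFin.
    have -> : (g u w / g (u + 1) w = p w u)%R.
      by rewrite /p /spath clamp_id// lexx u0'.
    have y0 : (0 < 1 - p w u)%R by rewrite subr_gt0.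
    rewrite /wt /Kf /kap.
    have -> : ((1 - p w u) `^ (r - u - 1) = (1 - p w u) `^ (- u - 1) * (1 - p w u) `^ r)%R.
      rewrite -powRD; last by apply/implyP => _; rewrite gt_eqF.
      by congr (_ `^ _)%R; ring.
    by ring.
  - apply: emeasurable_funM; first exact: (measurableT_comp mHr mp).
    apply/measurable_EFinP; apply: measurable_powR2 => //; apply: measurable_funB => //.
    apply: measurable_funM; first exact: (measurable_gproc gp).
    by apply: measurable_funV; exact: (measurable_gproc gp).
  - by move=> w _; rewrite mule_ge0// lee_fin powR_ge0.
  - rewrite lee_fin mulr_ge0 ?divr_ge0 ?Gammaf_ge0//.
rewrite (fubini_tonelli F mF F0); apply: eq_integral => w _.
rewrite [in RHS]integral_mkcond; apply: eq_integral => r _; rewrite patchE /F /=.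
have [ur|ru] := ltP u r; first by rewrite mem_set//= in_itv/= ur.
by rewrite memNset//= in_itv/= andbT; apply/negP; rewrite -leNgt.
Qed.

Lemma measurable_Kf_tail u x : measurable_fun (`]u, +oo[%classic : set R) (fun r => (Kf u x r)%:E).
Proof. by apply: measurable_funTS; apply/measurable_EFinP; exact: measurable_Kf. Qed.

(** The integral in the drift before division by the normalisation [Dz]. *)
Definition Nz u x : \bar R := \int[Ptau]_(r in `]u, +oo[) ((r - u)^-1 * Kf u x r)%:E.

Lemma measurable_Nf_tail u x : measurable_fun (`]u, +oo[%classic : set R) (fun r => ((r - u)^-1 * Kf u x r)%:E).
Proof.
apply: measurable_funTS; apply/measurable_EFinP; apply: measurable_funM.
  by apply: measurable_funV; exact: measurable_funB.
exact: measurable_Kf.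
Qed.

(** By [mix_ac] with H = 1, the product of [wt] and [Dz] has mean P(tau > u) <= 1; as [wt] is
    positive, [Dz] is almost surely finite, and [fine] in [phiz] loses nothing. *)
Lemma Dz_fin u : (0 < u)%R -> {ae P, forall w, Dz u (spath g u (u + 1) w u) \is a fin_num}.
Proof.
move=> u0; have uu1 : (u < u + 1)%R by rewrite ltrDl.
have mx : measurable_fun setT (fun w => spath g u (u + 1) w u).
  exact: (measurableT_comp (measurable_eval_path u) (measurable_spath gp u (u + 1))).
pose f w := (wt u (spath g u (u + 1) w u))%:E * Dz u (spath g u (u + 1) w u).
have f0 w : 0 <= f w by rewrite mule_ge0 ?Dz_ge0// lee_fin wt_ge0.
have mf : measurable_fun setT f.
  apply: emeasurable_funM; last first.
    exact: (measurableT_comp measurable_Dz (measurable_fun_pair (measurable_cst u) mx)).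
  by apply/measurable_EFinP; apply: measurable_funM => //; apply: measurable_powR2 => //; exact: measurable_funB.
have : P.-integrable setT f.
  apply/integrableP; split => //.
  under eq_integral do rewrite gee0_abs//.
  have := @mix_ac u (cst 1) u0 (fun=> lee01) (measurable_cst _).
  have -> : \int[P]_w \int[Ptau]_(r in `]u, +oo[) (cst 1 (r, spath g u (u + 1) w) *
      (wt u (spath g u (u + 1) w u) * Kf u (spath g u (u + 1) w u) r)%:E) = \int[P]_w f w.
    apply: eq_integral => w _; rewrite /f /Dz -ge0_integralZl//.
    - by apply: eq_integral => r _; rewrite mul1e.
    - exact: measurable_Kf_tail.
    - by move=> r _; rewrite lee_fin Kf_ge0.
    - by rewrite lee_fin wt_ge0.
  move=> <-; apply: (@le_lt_trans _ _ (\int[Ptau]_r 1%:E)); last by rewrite integral_cst_prob ltry.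
  have -> : \int[Ptau]_(r in `]u, +oo[) \int[P]_w cst 1 (r, spath g u r w) = \int[Ptau]_(r in `]u, +oo[) 1%:E.
    by apply: eq_integral => r _; exact: integral_cst_prob.
  apply: ge0_subset_integral => //; exact: measurable_cst.
move=> /(integrable_ae measurableT); apply: filterS2 (spath_itv u0 uu1) => w /andP[x0 x1] /(_ I).
rewrite /f; set D := Dz _ _; have D0 : 0 <= D by exact: Dz_ge0.
have : (0 < wt u (spath g u (u + 1) w u))%R.
  by rewrite mulr_gt0 ?kap_gt0// powR_gt0// subr_gt0.
by move=> wt0; case: D D0 => [r _ _ //|_|//]; rewrite gt0_muley ?lte_fin.
Qed.

Lemma bz_Dz u x : (0 < u)%R -> (0 < x < 1)%R -> Dz u x \is a fin_num ->
  bz u x * Dz u x = (1 - x)%:E * Nz u x.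
Proof.
move=> u0 x01 Dfin; have /andP[x0 x1] := x01.
(* If tau never exceeds u almost surely, both integrals vanish. Otherwise [Kf] is positive for every
   r > u, so [Dz] is positive and can be divided by. *)
have [t0|t0] := eqVneq (Ptau `]u, +oo[%classic) 0.
  rewrite /Dz null_set_integral//; last exact: measurable_Kf_tail.
  rewrite /Nz null_set_integral//; last exact: measurable_Nf_tail.
  by rewrite !mule0.
have Dpos : 0 < Dz u x.
  rewrite lt_neqAle Dz_ge0 andbT; apply/eqP => /esym D0; move/eqP : t0; apply.
  have : \int[Ptau]_(r in `]u, +oo[) `|(Kf u x r)%:E| = 0.
    by under eq_integral do rewrite gee0_abs ?lee_fin ?Kf_ge0//.
  move=> /(ae_eq_integral_abs Ptau (measurable_itv _) (@measurable_Kf_tail u x)) [N [mN N0 sub]].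
  apply: (subset_measure0 _ mN _ N0) => // r ur; apply: sub => /= /(_ ur) /= [] /eqP.
  rewrite gt_eqF//; move: ur; rewrite /= in_itv/= andbT => ur.
  rewrite mulr_gt0 ?powR_gt0 ?subr_gt0// divr_gt0// Gammaf_gt0 ?subr_gt0//.
  exact: lt_trans ur.
pose D := fine (Dz u x).
have DE : Dz u x = D%:E by rewrite fineK.
have D0 : (0 < D)%R by rewrite -lte_fin -DE.
rewrite /bz x01 mulr1.
have -> : \int[Ptau]_(r in `]u, +oo[) ((r - u)^-1 * phiz u r x)%:E = (D^-1)%:E * Nz u x.
  rewrite /Nz -ge0_integralZl//.
  - by apply: eq_integral => r _; rewrite -EFinM /phiz x01 mulr1 -/D; congr EFin; ring.
  - exact: measurable_Nf_tail.
  - move=> r /=; rewrite in_itv/= andbT => ur.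
    by rewrite lee_fin mulr_ge0 ?Kf_ge0// invr_ge0 subr_ge0 ltW.
  - by rewrite lee_fin invr_ge0 ltW.
rewrite DE -muleA; congr (_ * _); rewrite muleAC -EFinM mulVf ?mul1e//.
by rewrite gt_eqF.
Qed.

(** Both sides are carried to the reference bridge. The left integrand gets the factor [Dz], the
    r-integral of the density, which cancels the denominator of phi; the right one produces [Nz].
    They agree by [bz_Dz]. *)
Lemma compensator_density u (l : seq (R * set R)) : (0 < u)%R -> mrect l ->
  all (fun q => (0 <= q.1 <= u)%R) l ->
  \int[P]_w ((\1_(rect l) ((zt g tau ^~ w) : pathT R))%:E * bz u (zt g tau u w)) =
  \int[Ptau]_(r in `]u, +oo[) \int[P]_w ((\1_(rect l) (spath g u r w))%:E *
    ((r - u)^-1 * `|1 - spath g u r w u|)%:E).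
Proof.
move=> u0 ml al; have u0' := ltW u0; have uu1 : (u < u + 1)%R by rewrite ltrDl.
pose ind (p : pathT R) : \bar R := (\1_(rect l) p : R)%:E.
have mind : measurable_fun setT ind.
  by apply/measurable_EFinP; apply: measurable_indic; exact: measurable_rect.
have ind0 p : 0 <= ind p by rewrite lee_fin.
pose H1 (z : R * pathT R) : \bar R := ind z.2 * bz u (z.2 u).
have mev : measurable_fun setT (fun z : R * pathT R => z.2 u).
  exact: (measurableT_comp (measurable_eval_path u) measurable_snd).
have mH1 : measurable_fun setT H1.
  apply: emeasurable_funM; first exact: (measurableT_comp mind measurable_snd).
  exact: (measurableT_comp measurable_bz (measurable_fun_pair (measurable_cst u) mev)).
have H10 z : 0 <= H1 z by rewrite mule_ge0// bz_ge0.
pose H2 (z : R * pathT R) : \bar R := if (u < z.1)%R then ind z.2 * ((z.1 - u)^-1 * `|1 - z.2 u|)%:E else 0.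
have mH2 : measurable_fun setT H2.
  apply: measurable_fun_ifT => //.
    by apply: measurable_fun_ltr => //; exact: measurable_fst.
  apply: emeasurable_funM; first exact: (measurableT_comp mind measurable_snd).
  apply/measurable_EFinP; apply: measurable_funM.
    by apply: measurable_funV; apply: measurable_funB => //; exact: measurable_fst.
  by apply: measurableT_comp => //; exact: measurable_funB.
have H20 z : 0 <= H2 z.
  rewrite /H2; case: ifP => // uz; rewrite mule_ge0// lee_fin mulr_ge0// invr_ge0 subr_ge0.
  exact: ltW.
have rectE (p q : pathT R) : (forall v, (0 <= v <= u)%R -> p v = q v) -> ind p = ind q.
  move=> pq; rewrite /ind !indicE; congr (_%:R)%:E.
  have : rect l p = rect l q.
    elim: l al {ml ind mind ind0 H1 mH1 H10 H2 mH2 H20} => //= q0 l ih /andP[q0u al].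
    by rewrite /setI /= (ih al) pq.
  by rewrite /in_mem /= /in_set /= => ->.
transitivity (\int[P]_(w in tau @^-1` `]u, +oo[)
    H1 (tau w, (fun v => zt g tau (clamp u v) w) : pathT R)).
  rewrite [RHS]integral_mkcond; apply: eq_integral => w _; rewrite patchE.
  have [uw|wu] := ltP u (tau w).
    rewrite mem_set/= ?in_itv/= ?uw// /H1/=; congr (_ * _).
      by apply: rectE => v vu; rewrite clamp_id.
    by rewrite clamp_id// lexx u0'.
  rewrite memNset/= ?in_itv/= ?andbT; last by apply/negP; rewrite -leNgt.
  (* On tau <= u, zeta_u is 1, or 0 by the convention 0 / 0 = 0 when g vanishes at tau; both values
     lie outside (0, 1). *)
  rewrite bz_out ?mule0// /zt (min_idPr wu).
  have [->|gz] := eqVneq (g (tau w) w) 0%R; first by rewrite mul0r ltxx.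
  by rewrite divff// ltxx andbF.
rewrite (disintegration_path gp tau0 taug u0' H10 mH1).
rewrite -/Ptau (mix_ac u0 H10 mH1).
transitivity (\int[Ptau]_(r in `]u, +oo[) \int[P]_w H2 (r, spath g u r w)); last first.
  apply: eq_integral => r; rewrite inE/= in_itv/= andbT => ur.
  by apply: eq_integral => w _; rewrite /H2 /= ur.
rewrite (mix_ac u0 H20 mH2).
pose x w := spath g u (u + 1) w u.
have mp := measurable_spath gp u (u + 1)%R.
have mx : measurable_fun setT x by exact: (measurableT_comp (measurable_eval_path u) mp).
have mwt : measurable_fun setT (fun w => (wt u (x w))%:E).
  by apply/measurable_EFinP; apply: measurable_funM => //; apply: measurable_powR2 => //; exact: measurable_funB.
have mDx : measurable_fun setT (fun w => Dz u (x w)).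
  exact: (measurableT_comp measurable_Dz (measurable_fun_pair (measurable_cst u) mx)).
have mbx : measurable_fun setT (fun w => bz u (x w)).
  exact: (measurableT_comp measurable_bz (measurable_fun_pair (measurable_cst u) mx)).
have mip : measurable_fun setT (fun w => ind (spath g u (u + 1) w)) by exact: (measurableT_comp mind mp).
have mNx : measurable_fun setT (fun w => Nz u (x w)).
  have := measurable_tail_integral (f := fun z => (z.2 - z.1.1)^-1 * Kf z.1.1 z.1.2 z.2)%R.
  move=> HN; have {}HN := HN _ _.
  apply: (measurableT_comp (HN _ _) (measurable_fun_pair (measurable_cst u) mx)).
  - apply: measurable_funM.
      apply: measurable_funV; apply: measurable_funB => //.
      exact: (measurableT_comp measurable_fst measurable_fst).
    apply: measurable_Kf => //.
    + exact: (measurableT_comp measurable_fst measurable_fst).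
    + exact: (measurableT_comp measurable_snd measurable_fst).
  - by move=> z r zr; rewrite mulr_ge0 ?Kf_ge0// invr_ge0 subr_ge0 ltW.
have Nz0 y : 0 <= Nz u y.
  apply: integral_ge0 => r /=; rewrite in_itv/= andbT => ur.
  by rewrite lee_fin mulr_ge0 ?Kf_ge0// invr_ge0 subr_ge0 ltW.
transitivity (\int[P]_w (ind (spath g u (u + 1) w) * bz u (x w) * ((wt u (x w))%:E * Dz u (x w)))).
  apply: eq_integral => w _; rewrite /H1/= -/(x w).
  rewrite ge0_integralZl//.
  - congr (_ * _); rewrite /Dz -ge0_integralZl//.
    + exact: measurable_Kf_tail.
    + by move=> r _; rewrite lee_fin Kf_ge0.
    + by rewrite lee_fin wt_ge0.
  - apply: measurable_funTS; apply/measurable_EFinP; apply: measurable_funM => //.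
    exact: measurable_Kf.
  - by move=> r _; rewrite lee_fin mulr_ge0 ?Kf_ge0// wt_ge0.
  - by rewrite mule_ge0// bz_ge0.
transitivity (\int[P]_w (ind (spath g u (u + 1) w) * (wt u (x w) * `|1 - x w|)%:E * Nz u (x w))); last first.
  apply: eq_integral => w _; rewrite /H2/= -/(x w).
  transitivity (\int[Ptau]_(r in `]u, +oo[) (ind (spath g u (u + 1) w) *
    (wt u (x w) * `|1 - x w|)%:E * ((r - u)^-1 * Kf u (x w) r)%:E)).
    rewrite ge0_integralZl//.
    - exact: measurable_Nf_tail.
    - move=> r /=; rewrite in_itv/= andbT => ur.
      by rewrite lee_fin mulr_ge0 ?Kf_ge0// invr_ge0 subr_ge0 ltW.
    - by rewrite mule_ge0// lee_fin mulr_ge0// wt_ge0.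
  apply: eq_integral => r; rewrite inE/= in_itv/= andbT => ur; rewrite ur.
  rewrite -[LHS]muleA -[RHS]muleA; congr (_ * _).
  by rewrite -!EFinM; congr EFin; ring.
apply: ge0_ae_eq_integral => //.
- by apply: emeasurable_funM; [exact: emeasurable_funM|exact: emeasurable_funM].
- apply: emeasurable_funM => //; apply: emeasurable_funM => //.
  apply/measurable_EFinP; apply: measurable_funM; first by apply/measurable_EFinP.
  by apply: measurableT_comp => //; exact: measurable_funB.
- move=> w _; apply: mule_ge0; apply: mule_ge0; [exact: ind0|exact: bz_ge0| |exact: Dz_ge0].
  by rewrite lee_fin wt_ge0.
- move=> w _; apply: mule_ge0; [apply: mule_ge0; first exact: ind0|exact: Nz0].
  by rewrite lee_fin mulr_ge0// wt_ge0.
apply: filterS2 (spath_itv u0 uu1) (Dz_fin u0) => w x01 Df _.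
have /andP[x0 x1] := x01.
rewrite -[LHS]muleA -[RHS]muleA; congr (_ * _).
have BD : bz u (x w) * Dz u (x w) = (1 - x w)%:E * Nz u (x w) := bz_Dz u0 x01 Df.
rewrite [LHS]muleCA BD muleA -EFinM; congr ((_ * _)%:E * _).
by rewrite gtr0_norm// subr_gt0.
Qed.

End compensator_density.

(** * The compensator, null sets, and means on rectangles *)

Section compensator.
Local Open Scope ereal_scope.
Context (R : realType) (d : measure_display) (T : measurableType d).
Variables (P : probability T R) (g : R -> T -> R) (tau : {mfun T >-> R}).
Hypothesis gp : gamma_process P g.
Hypothesis tau0 : forall w, (0 < tau w)%R.
Hypothesis taug : indep P (sigma_rv tau) (gen_sigma `[0%R, +oo[%classic g).

Local Notation Ptau := (distribution P tau).
Local Notation Om := (pastT g `[0%R, +oo[%classic).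
Local Notation leb := (@lebesgue_measure R).
Local Notation z := (zt g tau).
Local Notation b := (bz P tau).

Lemma measurable_spath_joint s : (0 <= s)%R ->
  measurable_fun setT (fun y : R * T => spath g s (Num.max 0%R y.1) y.2).
Proof.
move=> s0; apply: measurable_path_fun => v; apply: measurable_funM.
  by apply: measurableT_comp; [exact: (measurable_gproc gp)|exact: measurable_snd].
by apply: measurable_funV; exact: (measurable_gjointT gp).
Qed.

(** The map [f] leaves the source space free: [T] itself for Tonelli, or [T] with the sigma-algebra
    of the past up to [t] for adaptedness. *)
Lemma measurable_btime (d' : measure_display) (U : measurableType d') (f : U -> T) t :
  (0 <= t)%R ->
  (forall v, (0 <= v <= t)%R -> measurable_fun setT (fun x => z v (f x))) ->
  measurable_fun setT (fun y : R * U => b y.1 (z (clamp t y.1) (f y.2))).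
Proof.
move=> t0 mz.
have H : measurable_fun setT (fun y : R * U => z (Num.min (Num.max 0%R y.1) t) (f y.2)).
  apply: (@measurable_joint _ U R (fun v x => z (Num.min v t) (f x))).
    by move=> r r0; apply: mz; rewrite le_min r0 t0 ge_min lexx orbT.
  move=> x; apply: (@right_cont_min _ (z ^~ (f x))) => //.
  exact: (right_cont_zt gp).
have E (y : R) : clamp t y = Num.min (Num.max 0%R y) t.
  rewrite /clamp; have [y0|y0] := leP 0%R y.
    by rewrite (max_idPr _)// le_min y0.
  rewrite (min_idPl t0) (max_idPl _)//.
  by rewrite ge_min (ltW y0).
under eq_fun do rewrite E.
exact: (measurableT_comp (measurable_bz P tau) (measurable_fun_pair measurable_fst H)).
Qed.

Definition comp (D : set R) w : \bar R := \int[leb]_(u in D) b u (z u w).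

Lemma comp_ge0 D w : 0 <= comp D w.
Proof. by apply: integral_ge0 => u _; exact: bz_ge0. Qed.

Lemma measurable_comp_D (d' : measure_display) (U : measurableType d') (f : U -> T) t (D : set R) :
  (0 <= t)%R -> measurable D -> D `<=` `[0%R, t]%classic ->
  (forall v, (0 <= v <= t)%R -> measurable_fun setT (fun x => z v (f x))) ->
  measurable_fun setT (fun x => comp D (f x)).
Proof.
move=> t0 mD Dt mz.
pose F (y : U * R) : \bar R := (\1_D y.2)%:E * b y.2 (z (clamp t y.2) (f y.1)).
have mF : measurable_fun setT F.
  apply: emeasurable_funM.
    apply/measurable_EFinP; apply: measurableT_comp; last exact: measurable_snd.
    exact: measurable_indic.
  exact: (measurableT_comp (measurable_btime t0 mz) (measurable_fun_pair measurable_snd measurable_fst)).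
have F0 y : 0 <= F y by rewrite mule_ge0 ?bz_ge0// lee_fin.
have -> : (fun x => comp D (f x)) = fubini_F leb F.
  apply/funext => x; rewrite /comp /fubini_F [LHS]integral_mkcond; apply: eq_integral => u _.
  rewrite patchE /F /= indicE; have [uD|uD] := boolP (u \in D); last by rewrite mul0e.
  rewrite mul1e clamp_id//.
  by have := Dt u; rewrite /= in_itv/=; apply; move: uD; rewrite inE.
exact: measurable_fun_fubini_tonelli_F.
Qed.

Lemma measurable_compT t (D : set R) :
  (0 <= t)%R -> measurable D -> D `<=` `[0%R, t]%classic -> measurable_fun setT (comp D).
Proof.
move=> t0 mD Dt; apply: (@measurable_comp_D _ T id t D) => // v /andP[v0 _].
exact: (measurable_zt gp).
Qed.

Lemma measurable_btime1 t w : (0 <= t)%R ->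
  measurable_fun (`[0%R, t]%classic : set R) (fun u => b u (z u w)).
Proof.
move=> t0.
have H : measurable_fun setT (fun u => b u (z (clamp t u) w)).
  have := @measurable_btime _ T id t t0.
  move=> /(_ (fun v => ltac:(by move=> /andP[v0 _]; exact: (measurable_zt gp)))) K.
  exact: (measurableT_comp K (measurable_fun_pair (@measurable_id _ R setT) (measurable_cst w))).
apply: (@eq_measurable_fun _ _ _ _ _ (fun u => b u (z (clamp t u) w))).
  by move=> u; rewrite inE/= in_itv/= => ut; rewrite clamp_id.
exact: measurable_funTS.
Qed.

Lemma comp_split s t w : (0 <= s)%R -> (s <= t)%R ->
  comp `[0%R, t]%classic w = comp `[0%R, s]%classic w + comp `]s, t]%classic w.
Proof.
move=> s0 st; have t0 := le_trans s0 st.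
have E : `[0%R, t]%classic = `[0%R, s]%classic `|` `]s, t]%classic :> set R.
  by apply: itv_bndbnd_setU; rewrite bnd_simp.
rewrite /comp E ge0_integral_setU//.
- by rewrite -E; exact: measurable_btime1.
- by move=> u _; exact: bz_ge0.
- apply/disj_setPS => u [] /=; rewrite !in_itv/= => /andP[_ us] /andP[su _].
  by have := lt_le_trans su us; rewrite ltxx.
Qed.

Lemma comp0 w : comp `[0%R, 0%R]%classic w = 0.
Proof.
apply: null_set_integral => //; first exact: measurable_btime1.
have : leb `[0%R, 0%R]%classic = 0 by rewrite lebesgue_measure_itv/= ltxx.
exact.
Qed.

Lemma b_after u w : (tau w <= u)%R -> b u (z u w) = 0.
Proof.
move=> wu; apply: bz_out; rewrite /zt (min_idPr wu).
have [->|gz] := eqVneq (g (tau w) w) 0%R; first by rewrite mul0r ltxx.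
by rewrite divff// ltxx andbF.
Qed.

(** The drift vanishes after tau by [b_after]; this is the whole reason why the martingale is
    stopped there. *)
Lemma comp_stop t w : comp `[0%R, t]%classic w = comp `[0%R, Num.min t (tau w)]%classic w.
Proof.
rewrite /comp integral_mkcond [in RHS]integral_mkcond; apply: eq_integral => u _.
rewrite !patchE !mem_setE !in_itv/= le_min.
have [u0|] := leP 0%R u => //=.
have [ut|] := leP u t => //=.
by have [uw|wu] := leP u (tau w) => //; rewrite b_after// ltW.
Qed.

(** Null events at each fixed length r stay null at the random length [tau]: integrate the indicator
    of [B] by [disintegration]. *)
Lemma ae_disintegration (B : set (R * Om)) : measurable B ->
  (forall r, (0 < r)%R -> {ae P, forall w, ~ B (r, w)}) ->
  {ae P, forall w, ~ B (tau w, w)}.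
Proof.
move=> mB B0.
have mid : measurable_fun setT (id : T -> Om).
  by move=> _ A mA; rewrite setTI; exact: (past_measurable gp mA).
have mpair : measurable_fun setT (fun w : T => (tau w, w : Om)).
  exact: (measurable_fun_pair _ mid).
pose F (y : R * Om) : \bar R := if (0 < y.1)%R then (\1_B y)%:E else 0.
have mF : measurable_fun setT F.
  apply: measurable_fun_ifT => //.
    by apply: measurable_fun_ltr => //; exact: measurable_fst.
  by apply/measurable_EFinP; exact: measurable_indic.
have F0 y : 0 <= F y by rewrite /F; case: ifP.
have E := disintegration gp taug F0 mF.
have Z : \int[P]_w F (tau w, w) = 0.
  rewrite E; apply: integral0_eq => r _; rewrite /F /=.
  have [r0|r0] := ltP 0%R r; last exact: integral0_eq.
  have mBr : measurable_fun setT (fun w : T => (\1_B (r, w : Om) : R)%:E).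
    have H : measurable_fun setT (fun w : T => (r, w : Om)).
      exact: (measurable_fun_pair (measurable_cst r) mid).
    apply/measurable_EFinP; exact: (measurableT_comp (@measurable_indic _ _ R setT B mB) H).
  have -> : \int[P]_w (\1_B (r, w : Om))%:E = \int[P]_w (cst 0 w).
    apply: ge0_ae_eq_integral => //.
    have [N [mN N0 sub]] := B0 r r0; exists N; split => // w /= H; apply: sub => /= nB.
    by apply: H => _; rewrite indicE memNset.
  exact: integral0.
have mFt : measurable_fun setT (fun w => F (tau w, w)) by exact: (measurableT_comp mF mpair).
have : \int[P]_w `|F (tau w, w)| = 0 by under eq_integral do rewrite gee0_abs//.
move=> /(ae_eq_integral_abs P measurableT mFt); apply: filterS => w /(_ I).
rewrite /F /= tau0 indicE => H nB; move: H; rewrite mem_set//= => -[] /eqP.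
by rewrite oner_eq0.
Qed.

(** Monotonicity of gamma is known almost surely only at fixed pairs of times, and here one of the
    times is random; the bounds are proved for each r and transferred by [ae_disintegration]. *)
Lemma zt_itv t : (0 <= t)%R ->
  {ae P, forall w, (0 < g (tau w) w)%R /\ (0 <= z t w <= 1)%R}.
Proof.
move=> t0.
have mg1 := measurable_gjoint gp.
have mg2 : measurable_fun setT (fun y : R * Om => g (Num.max 0%R (Num.min t y.1)) y.2).
  have H : measurable_fun setT (fun y : R * Om => (Num.min t y.1, y.2)).
    apply: measurable_fun_pair => //; apply: measurable_minr => //; exact: measurable_fst.
  exact: (measurableT_comp mg1 H).
pose f (y : R * Om) := ((0 < g (Num.max 0 y.1) y.2) &&
  ((0 <= g (Num.max 0 (Num.min t y.1)) y.2) &&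
   (g (Num.max 0 (Num.min t y.1)) y.2 <= g (Num.max 0 y.1) y.2)))%R.
have mf : measurable_fun setT f.
  apply: measurable_and; first exact: measurable_fun_ltr.
  by apply: measurable_and; exact: measurable_fun_ler.
have mB : measurable (f @^-1` [set false]) by have := mf measurableT [set false] (I : measurable [set false]); rewrite setTI.
have aeB r : (0 < r)%R -> {ae P, forall w, ~ (f @^-1` [set false]) (r, w)}.
  move=> r0.
  have m0 : (0 <= Num.min t r)%R by rewrite le_min t0 ltW.
  have mr : (Num.min t r <= r)%R by rewrite ge_min lexx orbT.
  apply: filterS3 (gproc_gt0 gp r0) (gproc_ge0 gp m0) (gproc_incr_ge0 gp m0 mr) => w h1 h2 h3 /=.
  rewrite /f /= (max_idPr (ltW r0)) (max_idPr m0) h1 h2/=.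
  by rewrite -subr_ge0 h3.
apply: filterS (ae_disintegration mB aeB) => w /= nB.
have : f (tau w, w) by case: (f (tau w, w)) nB => // /(_ erefl).
have m0 : (0 <= Num.min t (tau w))%R by rewrite le_min t0 ltW.
rewrite /f /= (max_idPr (ltW (tau0 w))) (max_idPr m0) => /and3P[h1 h2 h3]; split => //.
apply/andP; split; rewrite /zt; last by rewrite ler_pdivrMr// mul1r.
by apply: divr_ge0 => //; exact: ltW.
Qed.

Section rectangle.
Variables (s : R) (l : seq (R * set R)).
Hypotheses (s0 : (0 <= s)%R) (ml : mrect l) (al : all (fun q => (0 <= q.1 <= s)%R) l).

Definition rind (p : pathT R) : \bar R := (\1_(rect l) p : R)%:E.

Lemma rind_ge0 p : 0 <= rind p.
Proof. by rewrite lee_fin. Qed.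

Lemma measurable_rind : measurable_fun setT rind.
Proof. by apply/measurable_EFinP; apply: measurable_indic; exact: measurable_rect. Qed.

Lemma rind_eq (p q : pathT R) : (forall v, (0 <= v <= s)%R -> p v = q v) -> rind p = rind q.
Proof.
move=> pq; rewrite /rind !indicE; congr (_%:R)%:E.
have : rect l p = rect l q.
  elim: l al => //= q0 l' ih /andP[q0u al'].
  by rewrite /setI /= (ih al') pq.
by rewrite /in_mem /= /in_set /= => ->.
Qed.

(* Outside a null set [0 <= g s / g r <= 1] and the absolute value is superfluous;
   it makes the integrand nonnegative everywhere. *)
Definition Cr r : \bar R := \int[P]_w (rind (spath g s r w) * `|1 - g s w / g r w|%:E).

Lemma Cr_ge0 r : 0 <= Cr r.
Proof. by apply: integral_ge0 => w _; rewrite mule_ge0// rind_ge0. Qed.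

Lemma measurable_Cr : measurable_fun setT (fun r : R => Cr (Num.max 0%R r)).
Proof.
pose F (y : R * T) : \bar R := rind (spath g s (Num.max 0%R y.1) y.2) *
  `|1 - g s y.2 / g (Num.max 0%R y.1) y.2|%:E.
have mF : measurable_fun setT F.
  apply: emeasurable_funM; first exact: (measurableT_comp measurable_rind (measurable_spath_joint s0)).
  apply/measurable_EFinP; apply: measurableT_comp => //; apply: measurable_funB => //.
  apply: measurable_funM; last by apply: measurable_funV; exact: (measurable_gjointT gp).
  by apply: measurableT_comp; [exact: (measurable_gproc gp)|exact: measurable_snd].
have F0 y : 0 <= F y by rewrite mule_ge0// rind_ge0.
exact: (measurable_fun_fubini_tonelli_F F mF F0).
Qed.

Lemma bridge_mean_rind u r : (s <= u)%R -> (u < r)%R ->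
  \int[P]_w (rind (spath g u r w) * `|1 - spath g u r w u|%:E) = ((r - u) / (r - s))%:E * Cr r.
Proof.
move=> su ur; have u0 := le_trans s0 su.
rewrite -(bridge_mean gp s0 su ur rind_ge0 measurable_rind).
apply: eq_integral => w _; congr (_ * `|1 - _|%:E).
  apply: rind_eq => v /andP[v0 vs]; rewrite /spath !clamp_id ?v0 ?vs//.
  exact: le_trans vs su.
by rewrite /spath clamp_id// u0 lexx.
Qed.

(** Once tau <= u, 1 - zeta_u is almost surely zero, so only lengths r > u contribute, each with its
    bridge mean. *)
Lemma rect_value u : (s <= u)%R ->
  \int[P]_w (rind (z ^~ w) * `|1 - z u w|%:E) =
  \int[Ptau]_(r in `]u, +oo[) (((r - u) / (r - s))%:E * Cr r).
Proof.
move=> su; have u0 := le_trans s0 su.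
pose H (y : R * pathT R) : \bar R := rind y.2 * `|1 - y.2 u|%:E.
have mH : measurable_fun setT H.
  apply: emeasurable_funM; first exact: (measurableT_comp measurable_rind measurable_snd).
  apply/measurable_EFinP; apply: measurableT_comp => //; apply: measurable_funB => //.
  exact: (measurableT_comp (measurable_eval_path u) measurable_snd).
have H0 y : 0 <= H y by rewrite mule_ge0// rind_ge0.
have mclamp : measurable_fun setT (fun w => (fun v => z (clamp u v) w) : pathT R).
  apply: measurable_path_fun => v; apply: (measurable_zt gp) => //.
  by have /andP[] := clamp_itv v u0.
have zE w : rind (z ^~ w) * `|1 - z u w|%:E = H (tau w, (fun v => z (clamp u v) w) : pathT R).
  rewrite /H /=; congr (_ * `|1 - _|%:E).
    apply: rind_eq => v /andP[v0 vs]; rewrite clamp_id// v0.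
    exact: le_trans vs su.
  by rewrite clamp_id// u0 lexx.
transitivity (\int[P]_(w in tau @^-1` `]u, +oo[)
    H (tau w, (fun v => z (clamp u v) w) : pathT R)); last first.
  rewrite (disintegration_path gp tau0 taug u0 H0 mH).
  apply: eq_integral => r; rewrite inE/= in_itv/= andbT => ur.
  by rewrite -(bridge_mean_rind su ur).
have mHw : measurable_fun setT (fun w => H (tau w, (fun v => z (clamp u v) w) : pathT R)).
  exact: (measurableT_comp mH (measurable_fun_pair _ mclamp)).
have mS : measurable (tau @^-1` `]u, +oo[%classic).
  by rewrite -[X in measurable X]setTI; exact: measurable_funP.
rewrite [RHS]integral_mkcond; apply: ge0_ae_eq_integral => //.
- by under eq_fun do rewrite zE.
- apply/measurable_restrict => //; rewrite setTI; exact: measurable_funTS.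
- by move=> w _; rewrite mule_ge0// rind_ge0.
- by move=> w _; rewrite patchE; case: ifP.
apply: filterS (zt_itv u0) => w [gt _] _; rewrite patchE zE.
have [uw|wu] := ltP u (tau w); first by rewrite mem_set//= in_itv/= uw.
rewrite memNset/= ?in_itv/= ?andbT; last by apply/negP; rewrite -leNgt.
rewrite -zE /zt (min_idPr wu) divff ?gt_eqF// subrr normr0 mule0//.
Qed.

End rectangle.

End compensator.

(** * Balance on rectangles and on the completed past *)

Section martingale_property.
Local Open Scope ereal_scope.
Context (R : realType) (d : measure_display) (T : measurableType d).
Variables (P : probability T R) (g : R -> T -> R) (tau : {mfun T >-> R}).
Hypothesis gp : gamma_process P g.
Hypothesis tau0 : forall w, (0 < tau w)%R.
Hypothesis taug : indep P (sigma_rv tau) (gen_sigma `[0%R, +oo[%classic g).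

Local Notation Ptau := (distribution P tau).
Local Notation leb := (@lebesgue_measure R).
Local Notation z := (zt g tau).
Local Notation b := (bz P tau).
Local Notation cp := (comp P g tau).

Section rectangle_balance.
Variables (s : R) (l : seq (R * set R)).
Hypotheses (s0 : (0 <= s)%R) (ml : mrect l) (al : all (fun q => (0 <= q.1 <= s)%R) l).
Local Notation C := (Cr P g s l).

Lemma measurable_rind_z : measurable_fun setT (fun w => rind l (z ^~ w)).
Proof.
have H : measurable_fun setT (fun w => (fun v => z (clamp s v) w) : pathT R).
  apply: measurable_path_fun => v; apply: (measurable_zt gp) => //.
  by have /andP[] := clamp_itv v s0.
have -> : (fun w => rind l (z ^~ w)) = (fun w => rind l (fun v => z (clamp s v) w)).
  by apply/funext => w; apply: (rind_eq al) => v vs; rewrite clamp_id.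
exact: (measurableT_comp (measurable_rind ml) H).
Qed.

(** The factor 1 / (r - u) of the drift cancels the r - u of the bridge mean; what remains depends
    on u only through the condition r > u. *)
Lemma rect_density u : (s < u)%R ->
  \int[P]_w (rind l (z ^~ w) * b u (z u w)) =
  \int[Ptau]_(r in `]u, +oo[) (((r - s)^-1)%:E * C r).
Proof.
move=> su; have u0 := le_lt_trans s0 su.
have al' : all (fun q => (0 <= q.1 <= u)%R) l.
  apply/allP => q ql; move/allP : al => /(_ _ ql) /andP[-> qs] /=.
  by rewrite (le_trans qs)// ltW.
rewrite (compensator_density gp tau0 taug u0 ml al').
apply: eq_integral => r; rewrite inE/= in_itv/= andbT => ur.
have ru : (0 < r - u)%R by rewrite subr_gt0.
have rs : (0 < r - s)%R by rewrite subr_gt0 (lt_trans su).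
transitivity (((r - u)^-1)%:E * \int[P]_w (rind l (spath g u r w) * `|1 - spath g u r w u|%:E)).
  rewrite -ge0_integralZl.
  - by apply: eq_integral => w _; rewrite EFinM muleCA.
  - by [].
  - have mp := measurable_spath gp u r.
    apply: emeasurable_funM; first exact: (measurableT_comp (measurable_rind ml) mp).
    apply/measurable_EFinP; apply: measurableT_comp => //; apply: measurable_funB => //.
    exact: (measurableT_comp (measurable_eval_path u) mp).
  - by move=> w _; rewrite mule_ge0// rind_ge0.
  - by rewrite lee_fin invr_ge0 ltW.
rewrite (bridge_mean_rind gp s0 ml al (ltW su) ur) muleA -EFinM; congr (_%:E * _).
by field; rewrite !gt_eqF.
Qed.

Lemma rect_comp t : (s <= t)%R ->
  \int[P]_w (rind l (z ^~ w) * cp `]s, t]%classic w) =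
  \int[Ptau]_(r in `]s, +oo[) (((Num.min t r - s) / (r - s))%:E * C r).
Proof.
move=> st; have t0 := le_trans s0 st.
have sub : (`]s, t]%classic : set R) `<=` `[0%R, t]%classic.
  by move=> u /=; rewrite !in_itv/= => /andP[su ->]; rewrite (le_trans s0)// ltW.
pose F1 (y : T * R) : \bar R :=
  (\1_(`]s, t]%classic : set R) y.2)%:E * (rind l (z ^~ y.1) * b y.2 (z (clamp t y.2) y.1)).
have mbt : measurable_fun setT (fun y : R * T => b y.1 (z (clamp t y.1) y.2)).
  apply: (measurable_btime gp tau0 (f := id)) => // v /andP[v0 _].
  exact: (measurable_zt gp).
have mF1 : measurable_fun setT F1.
  apply: emeasurable_funM.
    apply/measurable_EFinP; apply: measurableT_comp; last exact: measurable_snd.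
    exact: measurable_indic.
  apply: emeasurable_funM; first exact: (measurableT_comp measurable_rind_z measurable_fst).
  exact: (measurableT_comp mbt (measurable_fun_pair measurable_snd measurable_fst)).
have F10 y : 0 <= F1 y.
  apply: mule_ge0; first by rewrite lee_fin.
  by apply: mule_ge0; [exact: rind_ge0|exact: bz_ge0].
(* Tonelli is used twice: time is exchanged with the sample point so that [rect_density] applies at
   fixed u, then with the length r. *)
transitivity (\int[P]_w \int[leb]_u F1 (w, u)).
  apply: eq_integral => w _; rewrite /comp -ge0_integralZl.
  - rewrite integral_mkcond; apply: eq_integral => u _; rewrite patchE /F1 /= indicE.
    have [us|us] := boolP (u \in `]s, t]%classic); last by rewrite mul0e.
    by rewrite mul1e clamp_id//; have := sub u; rewrite /= in_itv/=; apply; move: us; rewrite inE.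
  - exact: measurable_itv.
  - apply: measurable_funS sub _; first exact: measurable_itv.
    exact: (measurable_btime1 gp tau0).
  - by move=> u _; exact: bz_ge0.
  - exact: rind_ge0.
etransitivity; first exact: (fubini_tonelli (m1 := P) (m2 := leb) F1 mF1 F10).
pose F2 (y : R * R) : \bar R := if ((s < y.1) && (y.1 <= t) && (y.1 < y.2))%R then
  ((y.2 - s)^-1)%:E * C (Num.max 0%R y.2) else 0.
have mF2 : measurable_fun setT F2.
  apply: measurable_fun_ifT => //.
    apply: measurable_and; last by apply: measurable_fun_ltr; [exact: measurable_fst|exact: measurable_snd].
    by apply: measurable_and; [apply: measurable_fun_ltr|apply: measurable_fun_ler] => //; exact: measurable_fst.
  apply: emeasurable_funM; last exact: (measurableT_comp (measurable_Cr gp s0 ml) measurable_snd).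
  apply/measurable_EFinP; apply: measurable_funV; exact: measurable_funB.
have F20 y : 0 <= F2 y.
  rewrite /F2; case: ifP => // /andP[/andP[h1 _] h3].
  by apply: mule_ge0; [rewrite lee_fin invr_ge0 subr_ge0 ltW// (lt_trans h1)|exact: Cr_ge0].
transitivity (\int[leb]_u \int[Ptau]_r F2 (u, r)).
  apply: eq_integral => u _; rewrite /F1 /F2 /=.
  have [us|us] := boolP ((s < u) && (u <= t))%R; last first.
    rewrite [RHS]integral0_eq// [LHS]integral0_eq// => w _.
    by rewrite indicE memNset ?mul0e//= in_itv/=; exact/negP.
  have /andP[su ut] := us.
  transitivity (\int[P]_w (rind l (z ^~ w) * b u (z u w))).
    apply: eq_integral => w _; rewrite indicE mem_set/= ?in_itv//= mul1e clamp_id//.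
    by rewrite ut (le_trans s0)// ltW.
  rewrite (rect_density su) integral_mkcond; apply: eq_integral => r _; rewrite patchE /=.
  have [ur|ru] := ltP u r.
    rewrite mem_set/= ?in_itv/= ?ur// (max_idPr _)//.
    by rewrite (le_trans s0)// ltW// (lt_trans su).
  by rewrite memNset//= in_itv/= andbT; apply/negP; rewrite -leNgt.
etransitivity; first exact: (fubini_tonelli (m1 := leb) (m2 := Ptau) F2 mF2 F20).
rewrite [RHS]integral_mkcond; apply: eq_integral => r _.
rewrite patchE; have [sr|rs] := ltP s r; last first.
  rewrite memNset/= ?in_itv/= ?andbT; last by apply/negP; rewrite -leNgt.
  apply: integral0_eq => u _; rewrite /F2 /=.
  case: ifP => // /andP[/andP[h1 _] h2].
  by have := le_lt_trans rs (lt_trans h1 h2); rewrite ltxx.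
rewrite mem_set/= ?in_itv/= ?sr//.
have rs0 : (0 < r - s)%R by rewrite subr_gt0.
(* The times u with s < u <= t and u < r, at fixed r; closed at t or open at r, the interval has
   length min(t, r) - s. *)
pose S : set R := if (t < r)%R then `]s, t]%classic else `]s, r[%classic.
have mS : measurable (S : set (measurableTypeR R)).
  by rewrite /S; case: ifP => _; exact: measurable_itv.
have lebS : leb S = (Num.min t r - s)%:E.
  rewrite /S; have [tr|rt] := ltP t r.
    have : leb `]s, t]%classic = (t - s)%:E.
      rewrite lebesgue_measure_itv/= lte_fin; case: ltP => // ts.
      by rewrite (le_anti (introT andP (conj st ts))) subrr.
    exact.
  have : leb `]s, r[%classic = (r - s)%:E by rewrite lebesgue_measure_itv/= lte_fin sr.
  exact.
transitivity (\int[leb]_u ((((r - s)^-1)%:E * C r) * (\1_S u)%:E)).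
  apply: eq_integral => u _; rewrite /F2 /= (max_idPr _); last first.
    by rewrite (le_trans s0)// ltW.
  have uS : (u \in S) = ((s < u) && (u <= t) && (u < r))%R.
    rewrite /S; have [tr|rt] := ltP t r; apply/idP/idP; rewrite inE/= in_itv/=.
    - by move=> /andP[-> ut]; rewrite ut (le_lt_trans ut tr).
    - by move=> /andP[].
    - by move=> /andP[-> ur]; rewrite ur andbT (le_trans (ltW ur) rt).
    - by move=> /andP[/andP[-> _] ->].
  by rewrite indicE uS; case: ifP; rewrite ?mule1 ?mule0.
rewrite ge0_integralZl.
- rewrite integral_indic// setIT.
  transitivity (((r - s)^-1)%:E * C r * (Num.min t r - s)%:E).
    exact: (congr1 (fun y => ((r - s)^-1)%:E * C r * y) lebS).
  by rewrite muleAC -EFinM; congr (_%:E * _); rewrite mulrC.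
- by [].
- by apply/measurable_EFinP; exact: measurable_indic.
- by move=> u _; rewrite lee_fin.
- by apply: mule_ge0; [rewrite lee_fin invr_ge0 ltW|exact: Cr_ge0].
Qed.

(** For each r > s the coefficients add up to 1: (r - t) / (r - s) if r > t, plus (min(t, r) - s) /
    (r - s). The drift is added instead of subtracted, so all terms are nonnegative. *)
Lemma rect_balance t : (s <= t)%R ->
  \int[P]_w (rind l (z ^~ w) * `|1 - z s w|%:E) =
  \int[P]_w (rind l (z ^~ w) * `|1 - z t w|%:E) +
  \int[P]_w (rind l (z ^~ w) * cp `]s, t]%classic w).
Proof.
move=> st.
rewrite (rect_value gp tau0 taug s0 ml al (lexx s)) (rect_value gp tau0 taug s0 ml al st).
rewrite rect_comp// integral_mkcond [X in _ = X + _]integral_mkcond [X in _ = _ + X]integral_mkcond.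
have mC := measurable_Cr gp s0 ml.
have mgen u (k : R -> R) : (s <= u)%R -> measurable_fun setT k ->
    measurable_fun setT ((fun r => (k r)%:E * C r) \_ `]u, +oo[%classic).
  move=> su mk; have u0 := le_trans s0 su.
  apply/measurable_restrict; [exact: measurable_itv|exact: measurableT|rewrite setTI].
  apply: (@eq_measurable_fun _ _ _ _ _ (fun r => (k r)%:E * C (Num.max 0%R r))).
    move=> r; rewrite inE/= in_itv/= andbT => ur; rewrite (max_idPr _)//.
    by rewrite (le_trans u0)// ltW.
  apply: measurable_funTS; apply: emeasurable_funM => //; exact/measurable_EFinP.
have g0 u (k : R -> R) : (forall r, (u < r)%R -> (0 <= k r)%R) ->
    forall r, 0 <= ((fun r => (k r)%:E * C r) \_ `]u, +oo[%classic) r.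
  move=> k0 r; rewrite patchE; case: ifPn => //; rewrite inE/= in_itv/= andbT => ur.
  by rewrite mule_ge0 ?Cr_ge0// lee_fin k0.
have mdiv (k : R -> R) : measurable_fun setT k -> measurable_fun setT (fun r : R => k r / (r - s))%R.
  move=> mk; apply: measurable_funM => //; apply: measurable_funV.
  exact: measurable_funB.
rewrite -ge0_integralD.
- apply: eq_integral => r _; rewrite !patchE.
  have [sr|rs] := ltP s r; last first.
    have rt := le_trans rs st.
    by rewrite !memNset/= ?in_itv/= ?andbT ?adde0//; apply/negP; rewrite -leNgt.
  have rs0 : (0 < r - s)%R by rewrite subr_gt0.
  have inS : r \in `]s, +oo[%classic by rewrite inE/= in_itv/= sr.
  rewrite inS; have [tr|rt] := ltP t r.
    have inT : r \in `]t, +oo[%classic by rewrite inE/= in_itv/= tr.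
    rewrite inT -ge0_muleDl ?lee_fin ?divr_ge0 ?subr_ge0 ?(ltW sr) ?(ltW tr)//.
    by rewrite -EFinD; congr (_%:E * _); field; rewrite gt_eqF.
  have ninT : (r \in `]t, +oo[%classic) = false.
    by rewrite memNset//= in_itv/= andbT; apply/negP; rewrite -leNgt.
  by rewrite ninT add0e.
- exact: measurableT.
- by move=> r _; apply: g0 => x tx; rewrite divr_ge0// subr_ge0 ltW// (le_lt_trans st).
- apply: mgen => //; apply: mdiv; exact: measurable_funB.
- move=> r _; apply: g0 => x sx; rewrite divr_ge0 ?subr_ge0 ?(ltW sx)//.
  by rewrite le_min st ltW.
- apply: mgen => //; apply: mdiv; apply: measurable_funB => //; exact: measurable_minr.
Qed.

End rectangle_balance.

Definition Fgen t : set (set T) :=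
  [set A | (exists u, (0 <= u <= t)%R /\ exists B : set R, measurable B /\ A = z u @^-1` B)
           \/ (measurable A /\ P A = 0)].

(* A pi-system generating the completed past of [zeta] up to time [s]. *)
Definition rects_z s : set (set T) :=
  [set A | (exists l, [/\ mrect l, all (fun q => (0 <= q.1 <= s)%R) l &
                         A = [set w | rect l (z ^~ w)]])
           \/ (measurable A /\ P A = 0)].

Lemma Fgen_measurable t : <<s Fgen t >> `<=` @measurable _ T.
Proof.
apply: smallest_sub; first exact: sigma_algebra_measurable.
move=> A [[u [/andP[u0 _] [B [mB ->]]]]|[]//].
by rewrite -[X in measurable X]setTI; exact: (measurable_zt gp).
Qed.

Lemma measurable_compP s t : (0 <= s)%R -> (s <= t)%R -> measurable_fun setT (cp `]s, t]%classic).
Proof.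
move=> s0 st; apply: (measurable_compT gp tau0 (t := t)); [exact: le_trans st|exact: measurable_itv|].
by move=> u /=; rewrite !in_itv/= => /andP[su ->]; rewrite (le_trans s0)// ltW.
Qed.

Lemma measurable_abs1z t : (0 <= t)%R -> measurable_fun setT (fun w => `|1 - z t w|%:E).
Proof.
move=> t0; apply/measurable_EFinP; apply: measurableT_comp => //.
by apply: measurable_funB => //; exact: (measurable_zt gp).
Qed.

Lemma integral_abs1z t : (0 <= t)%R -> \int[P]_w `|1 - z t w|%:E <= 1.
Proof.
move=> t0; apply: (@le_trans _ _ (\int[P]_w 1%:E)); last by rewrite integral_cst_prob.
apply: ae_ge0_le_integral => //.
- exact: measurable_abs1z.
apply: filterS (zt_itv gp tau0 taug t0) => w [_ /andP[z0 z1]] _.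
by rewrite lee_fin ger0_norm ?subr_ge0// gerBl.
Qed.

(** In additive form each side is a measure in [A], of total mass at most 1. The two agree on the
    pi-system [rects_z], by [rect_balance] on rectangles and trivially on null sets. *)
Lemma Fgen_balance s t A : (0 <= s)%R -> (s <= t)%R -> <<s Fgen s >> A ->
  \int[P]_(w in A) `|1 - z s w|%:E =
  \int[P]_(w in A) (`|1 - z t w|%:E + cp `]s, t]%classic w).
Proof.
move=> s0 st FA; have t0 := le_trans s0 st.
have mk1 := measurable_abs1z s0.
have mk2 : measurable_fun setT (fun w => `|1 - z t w|%:E + cp `]s, t]%classic w).
  by apply: emeasurable_funD; [exact: measurable_abs1z|exact: measurable_compP].
have k20 w : 0 <= `|1 - z t w|%:E + cp `]s, t]%classic w by rewrite adde_ge0// comp_ge0.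
have [m1 m1E] := weighted_measure_ex P (k := fun w => `|1 - z s w|%:E) (fun w => normr_ge0 _) mk1.
have [m2 m2E] := weighted_measure_ex P k20 mk2.
rewrite -m1E -m2E.
have mrectz l : mrect l -> all (fun q => (0 <= q.1 <= s)%R) l -> measurable [set w | rect l (z ^~ w)].
  elim: l => [|q l ih] /=; first by move=> _ _; exact: measurableT.
  move=> [mq ml] /andP[/andP[q0 qs] al].
  rewrite (_ : [set w | _] = (z q.1 @^-1` q.2) `&` [set w | rect l (z ^~ w)])//.
  apply: measurableI; last exact: ih.
  by rewrite -[X in measurable X]setTI; exact: (measurable_zt gp).
have mG : rects_z s `<=` measurable.
  by move=> B [[l [ml al ->]]|[]//]; exact: mrectz.
have GT : rects_z s setT by left; exists [::]; split.
apply: (g_sigma_algebra_measure_unique (rects_z s) mG (fun=> setT)) => //.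
- by rewrite bigcup_const//; exists 0%N.
- move=> B1 B2 [[l1 [ml1 al1 ->]]|[mB1 PB1]].
    move=> [[l2 [ml2 al2 ->]]|[mB2 PB2]].
      left; exists (l1 ++ l2); split; [exact: mrect_cat|by rewrite all_cat al1|].
      by apply/seteqP; split => w /=; rewrite rect_cat.
    right; split; first by apply: measurableI => //; exact: mrectz.
    by apply: (subset_measure0 _ mB2 _ PB2); [apply: measurableI => //; exact: mrectz|exact: subIsetr].
  move=> B2G; have mB2 := mG _ B2G; right; split; first exact: measurableI.
  by apply: (subset_measure0 _ mB1 _ PB1); [exact: measurableI|exact: subIsetl].
- move=> B [[l [ml al ->]]|[mB PB]]; rewrite m1E m2E; last first.
    rewrite !null_set_integral//; exact: measurable_funTS.
  have ind (k : T -> \bar R) : \int[P]_(w in [set w | rect l (z ^~ w)]) k w =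
      \int[P]_w (rind l (z ^~ w) * k w).
    rewrite integral_mkcond; apply: eq_integral => w _.
    by rewrite epatch_indic muleC.
  rewrite !ind (rect_balance s0 ml al st) -ge0_integralD//.
  + apply: eq_integral => w _; apply/esym/ge0_muleDr; first by rewrite lee_fin.
    exact: comp_ge0.
  + by move=> w _; apply: mule_ge0; [exact: rind_ge0|rewrite lee_fin].
  + by apply: emeasurable_funM; [exact: (measurable_rind_z s0 ml al)|exact: measurable_abs1z].
  + by move=> w _; apply: mule_ge0; [exact: rind_ge0|exact: comp_ge0].
  + by apply: emeasurable_funM; [exact: (measurable_rind_z s0 ml al)|exact: measurable_compP].
- move=> _; rewrite m1E; apply: le_lt_trans (ltry 1); exact: integral_abs1z.
- apply: sub_smallest2r FA => // B [[u [us [D [mD ->]]]]|PB]; last first.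
    by right.
  left; exists [:: (u, D)]; split => //=; first by rewrite us.
  by apply/seteqP; split => w /=; [|case].
Qed.

End martingale_property.

Lemma sube_injr (R : realDomainType) (x y v : \bar R) :
  (x \is a fin_num -> x - y = x - v -> y = v)%E.
Proof.
case: x => [x| |] //; case: y => [y| |]; case: v => [v| |] //= _ [].
by move=> /addrI /oppr_inj ->.
Qed.

(** * Integrability and the decomposition *)

Section semimartingale_decomposition.
Local Open Scope ereal_scope.
Context (R : realType) (d : measure_display) (T : measurableType d).
Variables (P : probability T R) (g : R -> T -> R) (tau : {mfun T >-> R}).
Hypothesis gp : gamma_process P g.
Hypothesis tau0 : forall w, (0 < tau w)%R.
Hypothesis taug : indep P (sigma_rv tau) (gen_sigma `[0%R, +oo[%classic g).

Local Notation z := (zt g tau).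
Local Notation cp := (comp P g tau).
Local Notation Fg := (Fgen P g tau).

(** The balance on the whole space between times 0 and t bounds the mean drift by the mean of |1 -
    zeta_0|. *)
Lemma integral_comp_le1 t : (0 <= t)%R -> \int[P]_w cp `]0%R, t]%classic w <= 1.
Proof.
move=> t0; apply: le_trans (integral_abs1z gp tau0 taug (lexx 0%R)).
have FT : <<s Fg 0%R >> setT.
  exact: (@measurableT _ (g_sigma_algebraType (Fg 0%R))).
rewrite (Fgen_balance gp tau0 taug (lexx 0%R) t0 FT).
apply: ge0_le_integral => //.
- by move=> w _; exact: comp_ge0.
- exact: (measurable_compP gp tau0 (lexx _) t0).
- apply: emeasurable_funD; [exact: (measurable_abs1z gp tau0 t0)|].
  exact: (measurable_compP gp tau0 (lexx _) t0).
- by move=> w _; rewrite leeDr.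
Qed.

(** The balance concerns half-open intervals while the decomposition integrates over a closed one;
    the point 0 is null. *)
Lemma comp_itv0 t w : (0 <= t)%R -> cp `[0%R, t]%classic w = cp `]0%R, t]%classic w.
Proof. by move=> t0; rewrite (comp_split gp tau0 w (lexx 0%R) t0) (comp0 gp tau0) add0e. Qed.

Lemma comp_le s t w : (0 <= s)%R -> (s <= t)%R -> cp `[0%R, s]%classic w <= cp `[0%R, t]%classic w.
Proof. by move=> s0 st; rewrite (comp_split gp tau0 w s0 st) leeDl// comp_ge0. Qed.

Lemma measurable_comp0 t : (0 <= t)%R -> measurable_fun setT (cp `[0%R, t]%classic).
Proof. by move=> t0; apply: (measurable_compT gp tau0 t0); [exact: measurable_itv|]. Qed.

Lemma integrable_comp t : (0 <= t)%R -> P.-integrable setT (cp `[0%R, t]%classic).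
Proof.
move=> t0; apply/integrableP; split; first exact: measurable_comp0.
apply: le_lt_trans (ltry 1); apply: le_trans (integral_comp_le1 t0).
rewrite le_eqVlt; apply/orP; left; apply/eqP; apply: eq_integral => w _.
by rewrite gee0_abs ?comp_ge0// comp_itv0.
Qed.

(** One null set serves all times: finiteness is tested at integers and extended by monotonicity in
    t. *)
Lemma comp_fin : {ae P, forall w, forall t, (0 <= t)%R -> cp `[0%R, t]%classic w \is a fin_num}.
Proof.
have H n : {ae P, forall w, cp `[0%R, n%:R]%classic w \is a fin_num}.
  by apply: filterS (integrable_ae measurableT (integrable_comp (ler0n R n))) => w /(_ I).
apply: filterS (ae_foralln H) => w Hw t t0.
have tn : (t <= (Num.truncn t).+1%:R)%R by rewrite ltW// truncnS_gt.
rewrite ge0_fin_numE ?comp_ge0//; apply: le_lt_trans (comp_le w t0 tn) _.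
by rewrite -ge0_fin_numE ?comp_ge0.
Qed.

(** [fine] makes the process real valued, with 0 in place of an infinite compensator. Stopping at
    tau then holds for every sample point, and only the decomposition is almost sure. *)
Definition compensated t w : R := (z t w - fine (cp `[0%R, t]%classic w))%R.

Lemma compensated_stopped t w : (0 <= t)%R -> compensated t w = compensated (Num.min t (tau w)) w.
Proof.
move=> t0; rewrite /compensated -comp_stop; congr (_ - _)%R.
by rewrite /zt -minA minxx.
Qed.

Lemma compensated_decomposition : {ae P, forall w, forall t, (0 <= t)%R ->
  (z t w)%:E = (compensated t w)%:E + cp `[0%R, t]%classic w}.
Proof.
apply: filterS comp_fin => w Hw t t0.
by rewrite /compensated -{2}(fineK (Hw t t0)) -EFinD subrK.
Qed.

(** The drift up to t uses zeta on [0, t] only, so the joint measurability argument is rerun with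
    the past up to t as sigma-algebra. *)
Lemma compensated_adapted t (B : set R) : (0 <= t)%R -> measurable B -> <<s Fg t >> (compensated t @^-1` B).
Proof.
move=> t0 mB.
have mz v : (0 <= v <= t)%R -> measurable_fun (setT : set (g_sigma_algebraType (Fg t))) (z v).
  move=> vt _ D mD; rewrite setTI; apply: sub_sigma_algebra; left.
  by exists v; split => //; exists D.
have mN : measurable_fun (setT : set (g_sigma_algebraType (Fg t))) (compensated t).
  apply: measurable_funB; first by apply: mz; rewrite t0 lexx.
  apply: measurable_fine_fun.
  apply: (measurable_comp_D gp tau0 (f := (fun x => x) : g_sigma_algebraType (Fg t) -> T) t0) => //.
by have := mN measurableT B mB; rewrite setTI.
Qed.

Lemma integrable_zt t : (0 <= t)%R -> P.-integrable setT (EFin \o z t).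
Proof.
move=> t0.
have mz : measurable_fun setT (EFin \o z t).
  by apply/measurable_EFinP; exact: (measurable_zt gp).
apply/integrableP; split => //.
apply: le_lt_trans (ltry 1); apply: (@le_trans _ _ (\int[P]_w 1%:E)); last by rewrite integral_cst_prob.
apply: ae_ge0_le_integral => //; first exact: measurableT_comp.
apply: filterS (zt_itv gp tau0 taug t0) => w [_ /andP[z0 z1]] _.
by rewrite /= lee_fin ger0_norm.
Qed.

Lemma integrable_fine_comp t : (0 <= t)%R ->
  P.-integrable setT (EFin \o (fun w => fine (cp `[0%R, t]%classic w))).
Proof.
move=> t0; apply: le_integrable (integrable_comp t0) => //.
  by apply/measurable_EFinP; apply: measurable_fine_fun; exact: measurable_comp0.
move=> w _ /=; rewrite gee0_abs ?comp_ge0// ger0_norm ?fine_ge0 ?comp_ge0//.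
by have := comp_ge0 P g tau `[0%R, t]%classic w; case: (cp _ _) => //= _; exact: leey.
Qed.

Lemma integrable_compensated t : (0 <= t)%R -> P.-integrable setT (EFin \o compensated t).
Proof.
move=> t0; rewrite (_ : EFin \o _ = (EFin \o z t) \- (EFin \o (fun w => fine (cp `[0%R, t]%classic w))))//.
by apply: integrableB => //; [exact: integrable_zt|exact: integrable_fine_comp].
Qed.

Lemma martingale_compensated : martingale P (fun t => <<s Fg t >>) compensated.
Proof.
split=> [t t0|s t s0 st A FA].
  by split; [move=> B; exact: compensated_adapted|exact: integrable_compensated].
have t0 := le_trans s0 st.
have mA := Fgen_measurable gp tau0 FA.
have iN u : (0 <= u)%R -> P.-integrable A (EFin \o compensated u).
  by move=> u0; apply: integrableS (integrable_compensated u0).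
(* With N the compensated process, M - N_s is 1 - zeta_s and M - N_t is 1 - zeta_t plus the drift
   over ]s, t], almost surely: these are the two sides of the balance. As [M] is integrable, it can
   be cancelled. *)
pose M w : R := (1 - fine (cp `[0%R, s]%classic w))%R.
have iM : P.-integrable A (EFin \o M).
  apply: (@integrableS _ _ _ _ setT) => //.
  rewrite (_ : EFin \o _ = (EFin \o cst 1%R) \- (EFin \o (fun w => fine (cp `[0%R, s]%classic w))))//.
  apply: integrableB => //; [|exact: integrable_fine_comp].
  exact: finite_measure_integrable_cst.
have key u w : (0 <= z u w <= 1)%R -> `|1 - z u w|%R = (1 - z u w)%R.
  by move=> /andP[_ z1]; rewrite ger0_norm// subr_ge0.
have Es : \int[P]_(w in A) (M w - compensated s w)%:E = \int[P]_(w in A) (M w - compensated t w)%:E.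
  transitivity (\int[P]_(w in A) `|1 - z s w|%:E).
    apply: ae_eq_integral => //.
    - apply/measurable_EFinP; apply: measurable_funB; apply/measurable_EFinP.
        exact: measurable_int iM.
      exact: measurable_int (iN _ s0).
    - by apply: measurable_funTS; exact: (measurable_abs1z gp tau0 s0).
    apply: filterS (zt_itv gp tau0 taug s0) => w [_ zs] _.
    by rewrite key// /M /compensated; congr EFin; ring.
  rewrite (Fgen_balance gp tau0 taug s0 st FA).
  apply: ae_eq_integral => //.
  - apply: measurable_funTS; apply: emeasurable_funD; first exact: (measurable_abs1z gp tau0 t0).
    exact: (measurable_compP gp tau0 s0 st).
  - apply/measurable_EFinP; apply: measurable_funB; apply/measurable_EFinP.
      exact: measurable_int iM.
    exact: measurable_int (iN _ t0).
  apply: filterS2 (zt_itv gp tau0 taug t0) comp_fin => w [_ zs] cf _.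
  have cs := cf s s0; have ct := cf t t0.
  have E := comp_split gp tau0 w s0 st.
  have cst' : cp `]s, t]%classic w \is a fin_num.
    rewrite ge0_fin_numE ?comp_ge0//; apply: (@le_lt_trans _ _ (cp `[0%R, t]%classic w)).
      by rewrite E leeDr// comp_ge0.
    by rewrite -ge0_fin_numE ?comp_ge0.
  transitivity (`|1 - z t w|%:E + (fine (cp `]s, t]%classic w))%:E).
    exact: (congr1 (fun y => `|1 - z t w|%:E + y) (esym (fineK cst'))).
  have F : fine (cp `[0%R, t]%classic w) =
      (fine (cp `[0%R, s]%classic w) + fine (cp `]s, t]%classic w))%R.
    by rewrite E; exact: fineD.
  by rewrite -EFinD (key _ _ zs) /M /compensated F; congr EFin; ring.
have B u : (0 <= u)%R -> \int[P]_(w in A) (M w - compensated u w)%:E =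
    \int[P]_(w in A) (M w)%:E - \int[P]_(w in A) (compensated u w)%:E.
  by move=> u0; exact: (integralB_EFin mA iM (iN u u0)).
apply: (sube_injr (integrable_fin_num mA iM)).
exact: etrans (esym (B _ t0)) (etrans (esym Es) (B _ s0)).
Qed.

End semimartingale_decomposition.

Theorem mainTheorem13 (R : realType) (d : measure_display) (T : measurableType d)
  (P : probability T R) (gam : R -> T -> R) (tau : {mfun T >-> R}) :
  complete_prob P ->
  gamma_process P gam ->
  (forall w, 0 < tau w) ->
  indep P (sigma_rv tau) (gen_sigma `[0, +oo[ gam) ->
  let zeta : R -> T -> R := fun t w => gam (Num.min t (tau w)) w / gam (tau w) w in
  let Ptau := distribution P tau in
  let phi : R -> R -> R -> R := fun s r x =>
    (powR (1 - x) r * (Gammaf r / Gammaf (r - s))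
      / fine (\int[Ptau]_(v in `]s, +oo[)
                (powR (1 - x) v * (Gammaf v / Gammaf (v - s)))%:E)%E)
    * (if 0 < x < 1 then 1 else 0) in
  let Fz : R -> set (set T) := fun t =>
    <<s [set A | (exists u, 0 <= u <= t /\
                   exists B : set R, measurable B /\ A = zeta u @^-1` B)
                 \/ (measurable A /\ P A = 0%E)] >> in
  exists N : R -> T -> R,
    [/\ martingale P Fz N,
        (forall t w, 0 <= t -> N t w = N (Num.min t (tau w)) w) &
        {ae P, forall w, forall t, 0 <= t ->
          ((zeta t w)%:E = (N t w)%:E +
            \int[@lebesgue_measure R]_(s in `[0%R, t]%classic)
              (((1 - zeta s w) * (if 0 < zeta s w < 1 then 1 else 0))%:E *
               \int[Ptau]_(r in `]s, +oo[) ((r - s)^-1 * phi s r (zeta s w))%:E))%E}].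
Proof.
(* The kernel, the drift and the filtration of the statement agree by conversion with [phiz], [comp]
   and [Fgen]. *)
move=> _ gp tau0 taug zeta Ptau phi Fz; exists (compensated P gam tau); split.
- exact: martingale_compensated.
- by move=> t w; exact: compensated_stopped.
- exact: compensated_decomposition.
Qed.
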